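(* Let $0<q<1$, let $a,b,c,d,r,u,v$ be complex numbers with $\max\{|a|,|b|,|c|,|d|,|r|\}<1$, and put $\alpha=a^2bcdr/q$. Then \begin{align*} &\int_{0}^{\pi} \frac{(e^{2i\theta},e^{-2i\theta};q)_\infty}{(ae^{i\theta},ae^{-i\theta},be^{i\theta},be^{-i\theta},ce^{i\theta},ce^{-i\theta},de^{i\theta},de^{-i\theta},re^{i\theta},re^{-i\theta};q)_\infty}\, {}_3\phi_2\left({{ae^{i\theta}, ae^{-i\theta}, \alpha uv/q}\atop{\alpha u, \alpha v}}; q, bcdr\right) d\theta\\ &=\frac{2\pi (abcd, abcr, abdr, acdr; q)_\infty}{(q, ab, ac, ad, ar, bc, bd, br, cd, cr, dr, a^2bcdr; q)_\infty} \sum_{n=0}^\infty \frac{(1-\alpha q^{2n})(\alpha, ab, ac, ad, ar, q/u, q/v; q)_n}{(1-\alpha)(q, abcd, abcr, abdr, acdr, \alpha u, \alpha v; q)_n} \left(-\frac{\alpha bcdruv}{q}\right)^n q^{n(n-1)/2}. \end{align*}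
   Context: For $0<q<1$: $(a;q)_n=\prod_{k=0}^{n-1}(1-aq^k)$, $(a;q)_\infty=\prod_{k\ge0}(1-aq^k)$, $(a_1,\dots,a_m;q)_n=(a_1;q)_n\cdots(a_m;q)_n$. ${}_{3}\phi_2\left({{a_1,a_2,a_3}\atop{b_1,b_2}};q,z\right)=\sum_{n\ge0}\frac{(a_1,a_2,a_3;q)_n}{(q,b_1,b_2;q)_n}z^n$. *)

(* Defs.v *)
From Stdlib Require Import Reals List.
From Coquelicot Require Import Coquelicot.
Import ListNotations.
Open Scope C_scope.

(* Limits and sums of complex sequences are taken componentwise with
   Coquelicot's total operators; they are meaningful when the sequence
   (resp. series) converges in C. *)
Definition CLim_seq (u : nat -> C) : C :=
  (real (Lim_seq (fun n => Re (u n))), real (Lim_seq (fun n => Im (u n)))).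

Definition CSeries (u : nat -> C) : C :=
  (Series (fun n => Re (u n)), Series (fun n => Im (u n))).

(* e^{i t} for real t *)
Definition Cexpi (t : R) : C := (cos t, sin t).

(* (a; q)_n = (1 - a)(1 - a q) ... (1 - a q^{n-1}) *)
Fixpoint qpoch (a : C) (q : R) (n : nat) : C :=
  match n with
  | O => 1
  | S m => qpoch a q m * (1 - a * RtoC q ^ m)
  end.

Definition qpoch_inf (a : C) (q : R) : C := CLim_seq (qpoch a q).

(* (a_1, ..., a_m; q)_n and (a_1, ..., a_m; q)_oo *)
Definition qpochs (l : list C) (q : R) (n : nat) : C :=
  fold_right (fun a p => qpoch a q n * p) 1 l.

Definition qpochs_inf (l : list C) (q : R) : C :=
  fold_right (fun a p => qpoch_inf a q * p) 1 l.

(* 3phi2(a1, a2, a3; b1, b2; q, z) *)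
Definition phi32 (a1 a2 a3 b1 b2 : C) (q : R) (z : C) : C :=
  CSeries (fun n =>
    qpochs [a1; a2; a3] q n / qpochs [RtoC q; b1; b2] q n * z ^ n).

(* Main.v *)
(** Write z = e^{it}, m = abcdr and let W(m; a, b, c, d, r; z) be the weight
    (z^2, z^-2, mz, m/z; q)_oo / prod (a_j z, a_j / z; q)_oo over the five
    parameters a_j.

    Rahman's integral of W is evaluated by a first order recursion in a. Comparing
    the circles |z| = 1 and |z| = q, the function F (called [antishift])
    satisfies F(qz) = - F(1/z) on |z| = 1, so its mean vanishes; on the unit circle
    F(z) + F(1/z) combines W at a and at aq.
    Iterating a -> aq^n -> 0 in each parameter leaves the integral with all
    parameters zero, which is read off at (q, -q, sqrt q, - sqrt q, 0).

    The 3phi2 is expanded pointwise, by the limiting 6phi5 sum and the q-Saalschuetz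
    sum (a limit of Watson's transformation), into a series whose n-th term turns
    W(m; a) into a multiple of W(m q^n; a q^n). Integrating term by term
    gives the right-hand side. *)
Require Import Defs.
From Stdlib Require Import Reals List Lra Lia.
From Coquelicot Require Import Coquelicot.
Import ListNotations.
Open Scope C_scope.

(** * Convergence of complex sequences *)

(** With X = a z, Y = a / z and s = bcdr one has α q = XYs, Xs = m z and Ys = m / z. This is the
    balance that the limiting 6phi5 sum requires, and it confines the z-dependence of the n-th term
    to (az, a/z; q)_n / (mz, m/z; q)_n, the quotient by which the weights at (m; a) and (m q^n; a
    q^n) differ.

    Three obstacles shape the rest. The operators for limits and sums are total, so convergence is
    carried by the separate predicate [Ccv], mostly together with a geometric rate. The comparison
    of two circles is made within a class of functions generated by monomials and closed under
    uniform limits; it contains the quotients of infinite products that occur, and equality of means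
    passes through its constructors. Finally u and v are restricted only by nonvanishing
    denominators, so the expansion is bounded through the quadratic exponent of q and not through
    the size of α s u v / q. *)

Definition Ccv (w : nat -> C) (l : C) : Prop :=
  is_lim_seq (fun n => Cmod (w n - l)) 0%R.

Lemma is_lim_seq_squeeze0 (x y : nat -> R) :
  (forall n, 0 <= x n <= y n)%R -> is_lim_seq y 0%R -> is_lim_seq x 0%R.
Proof.
  intros H Hy.
  apply is_lim_seq_le_le with (fun _ => 0%R) y; auto.
  apply is_lim_seq_const.
Qed.

Lemma is_lim_seq_geom0 (M rho : R) :
  (0 <= rho < 1)%R -> is_lim_seq (fun n => (M * rho ^ n)%R) 0%R.
Proof.
  intros H.
  replace (Finite 0) with (Rbar_mult M 0%R) by (simpl; f_equal; ring).
  apply is_lim_seq_scal_l, is_lim_seq_geom.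
  rewrite Rabs_pos_eq; lra.
Qed.

Lemma Ccv_bound (w : nat -> C) (l : C) (e : nat -> R) :
  (forall n, Cmod (w n - l) <= e n)%R -> is_lim_seq e 0%R -> Ccv w l.
Proof.
  intros H He. apply is_lim_seq_squeeze0 with e; auto.
  intros n; split; [apply Cmod_ge_0 | apply H].
Qed.

Lemma Ccv_ext (w w' : nat -> C) (l : C) :
  (forall n, w n = w' n) -> Ccv w l -> Ccv w' l.
Proof.
  intros H. apply is_lim_seq_ext; intros n; now rewrite H.
Qed.

Lemma Ccv_const (l : C) : Ccv (fun _ => l) l.
Proof.
  apply is_lim_seq_ext with (fun _ => 0%R); [|apply is_lim_seq_const].
  intros _. replace (l - l) with (RtoC 0) by ring. now rewrite Cmod_0.
Qed.

Lemma Ccv_incr_n (w : nat -> C) (N : nat) (l : C) :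
  Ccv (fun n => w (n + N)%nat) l <-> Ccv w l.
Proof.
  unfold Ccv.
  symmetry; apply (is_lim_seq_incr_n (fun n => Cmod (w n - l)) N).
Qed.

Lemma Ccv_plus (w1 w2 : nat -> C) (l1 l2 : C) :
  Ccv w1 l1 -> Ccv w2 l2 -> Ccv (fun n => w1 n + w2 n) (l1 + l2).
Proof.
  intros H1 H2.
  apply Ccv_bound with (fun n => (Cmod (w1 n - l1) + Cmod (w2 n - l2))%R).
  - intros n.
    replace (w1 n + w2 n - (l1 + l2)) with ((w1 n - l1) + (w2 n - l2)) by ring.
    apply Cmod_triangle.
  - replace 0%R with (0 + 0)%R by ring. now apply is_lim_seq_plus'.
Qed.

Lemma Ccv_mult (w1 w2 : nat -> C) (l1 l2 : C) :
  Ccv w1 l1 -> Ccv w2 l2 -> Ccv (fun n => w1 n * w2 n) (l1 * l2).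
Proof.
  intros H1 H2.
  apply Ccv_bound with (fun n => (Cmod (w1 n - l1) * Cmod (w2 n - l2)
     + (Cmod l1 * Cmod (w2 n - l2) + Cmod l2 * Cmod (w1 n - l1)))%R).
  - intros n.
    replace (w1 n * w2 n - l1 * l2)
      with ((w1 n - l1) * (w2 n - l2) + (l1 * (w2 n - l2) + l2 * (w1 n - l1)))
      by ring.
    eapply Rle_trans; [apply Cmod_triangle|].
    rewrite Cmod_mult. apply Rplus_le_compat_l.
    eapply Rle_trans; [apply Cmod_triangle|].
    rewrite !Cmod_mult. apply Rle_refl.
  - replace 0%R with (0 * 0 + (Cmod l1 * 0 + Cmod l2 * 0))%R by ring.
    apply is_lim_seq_plus'; [now apply is_lim_seq_mult'|].
    apply is_lim_seq_plus'; apply is_lim_seq_mult'; auto;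
      apply is_lim_seq_const.
Qed.

Lemma Ccv_scal (k : C) (w : nat -> C) (l : C) :
  Ccv w l -> Ccv (fun n => k * w n) (k * l).
Proof. intros H. apply Ccv_mult; auto. apply Ccv_const. Qed.

Lemma im_le_Cmod (z : C) : (Rabs (Im z) <= Cmod z)%R.
Proof.
  eapply Rle_trans; [|apply Rmax_Cmod]. apply Rmax_r.
Qed.

Lemma Ccv_Re (w : nat -> C) (l : C) :
  Ccv w l -> is_lim_seq (fun n => Re (w n)) (Re l).
Proof.
  intros H.
  apply is_lim_seq_ext with (fun n => (Re (w n - l) + Re l)%R).
  { intros n. unfold Re, Im. simpl. ring. }
  replace (Finite (Re l)) with (Finite (0 + Re l)) by (f_equal; ring).
  apply is_lim_seq_plus'; [|apply is_lim_seq_const].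
  apply is_lim_seq_abs_0.
  apply is_lim_seq_squeeze0 with (2 := H).
  intros n; split; [apply Rabs_pos | apply re_le_Cmod].
Qed.

Lemma Ccv_Im (w : nat -> C) (l : C) :
  Ccv w l -> is_lim_seq (fun n => Im (w n)) (Im l).
Proof.
  intros H.
  apply is_lim_seq_ext with (fun n => (Im (w n - l) + Im l)%R).
  { intros n. unfold Re, Im. simpl. ring. }
  replace (Finite (Im l)) with (Finite (0 + Im l)) by (f_equal; ring).
  apply is_lim_seq_plus'; [|apply is_lim_seq_const].
  apply is_lim_seq_abs_0.
  apply is_lim_seq_squeeze0 with (2 := H).
  intros n; split; [apply Rabs_pos | apply im_le_Cmod].
Qed.

Lemma Cmod_le_Re_Im (z : C) : (Cmod z <= Rabs (Re z) + Rabs (Im z))%R.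
Proof.
  replace z with (RtoC (Re z) + RtoC (Im z) * Ci) at 1.
  - eapply Rle_trans; [apply Cmod_triangle|].
    rewrite Cmod_mult, Cmod_Ci, !Cmod_R. lra.
  - destruct z as [x y]; unfold RtoC, Ci, Cplus, Cmult; simpl; f_equal; ring.
Qed.

Lemma Ccv_pair (w : nat -> C) (l : C) :
  is_lim_seq (fun n => Re (w n)) (Re l) ->
  is_lim_seq (fun n => Im (w n)) (Im l) -> Ccv w l.
Proof.
  intros H1 H2.
  apply Ccv_bound
    with (fun n => (Rabs (Re (w n) - Re l) + Rabs (Im (w n) - Im l))%R).
  - intros n. apply Cmod_le_Re_Im.
  - replace 0%R with (0 + 0)%R by ring.
    apply is_lim_seq_plus'; apply (proj1 (is_lim_seq_abs_0 _)).
    + replace 0%R with (Re l - Re l)%R by ring.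
      apply is_lim_seq_minus'; auto. apply is_lim_seq_const.
    + replace 0%R with (Im l - Im l)%R by ring.
      apply is_lim_seq_minus'; auto. apply is_lim_seq_const.
Qed.

Lemma CLim_seq_Ccv (w : nat -> C) (l : C) : Ccv w l -> CLim_seq w = l.
Proof.
  intros H. unfold CLim_seq.
  rewrite (is_lim_seq_unique _ _ (Ccv_Re _ _ H)).
  rewrite (is_lim_seq_unique _ _ (Ccv_Im _ _ H)).
  now destruct l.
Qed.

Lemma Ccv_unique (w : nat -> C) (l l' : C) : Ccv w l -> Ccv w l' -> l = l'.
Proof.
  intros H H'.
  now rewrite <- (CLim_seq_Ccv _ _ H), <- (CLim_seq_Ccv _ _ H').
Qed.

Lemma Ccv_Cmod (w : nat -> C) (l : C) :
  Ccv w l -> is_lim_seq (fun n => Cmod (w n)) (Cmod l).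
Proof.
  intros H.
  apply is_lim_seq_ext with (fun n => ((Cmod (w n) - Cmod l) + Cmod l)%R).
  { intros n. ring. }
  replace (Finite (Cmod l)) with (Finite (0 + Cmod l)) by (f_equal; ring).
  apply is_lim_seq_plus'; [|apply is_lim_seq_const].
  apply is_lim_seq_abs_0.
  apply is_lim_seq_squeeze0 with (2 := H).
  intros n; split; [apply Rabs_pos|].
  apply Rabs_le.
  pose proof (Cmod_triangle (w n - l) l) as T1.
  replace (w n - l + l) with (w n) in T1 by ring.
  pose proof (Cmod_triangle (- (w n - l)) (w n)) as T2.
  replace (- (w n - l) + w n) with l in T2 by ring.
  rewrite Cmod_opp in T2. lra.
Qed.

Lemma Ccv_le (w : nat -> C) (l : C) (M : R) :
  Ccv w l -> (forall n, Cmod (w n) <= M)%R -> (Cmod l <= M)%R.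
Proof.
  intros H HM.
  apply (is_lim_seq_le (fun n => Cmod (w n)) (fun _ => M) (Cmod l) M);
    auto using Ccv_Cmod, is_lim_seq_const.
Qed.

Lemma Ccv_ge (w : nat -> C) (l : C) (M : R) :
  Ccv w l -> (forall n, M <= Cmod (w n))%R -> (M <= Cmod l)%R.
Proof.
  intros H HM.
  apply (is_lim_seq_le (fun _ => M) (fun n => Cmod (w n)) M (Cmod l));
    auto using Ccv_Cmod, is_lim_seq_const.
Qed.

(** * Finite sums and geometric majorants *)

(** The upper end is excluded, unlike in [sum_n], so that inductions start from the empty sum. *)
Fixpoint csum (f : nat -> C) (n : nat) : C :=
  match n with
  | O => 0
  | S m => csum f m + f m
  end.

Lemma csum_ext (f g : nat -> C) (n : nat) :
  (forall k, (k < n)%nat -> f k = g k) -> csum f n = csum g n.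
Proof.
  induction n as [|n IH]; intros H; simpl; auto.
  rewrite IH by (intros; apply H; lia). now rewrite H by lia.
Qed.

Lemma csum_scal (k : C) (f : nat -> C) (n : nat) :
  csum (fun j => k * f j) n = k * csum f n.
Proof. induction n as [|n IH]; simpl; [ring | rewrite IH; ring]. Qed.

Lemma csum_minus (f g : nat -> C) (n : nat) :
  csum (fun j => f j - g j) n = csum f n - csum g n.
Proof. induction n as [|n IH]; simpl; [ring | rewrite IH; ring]. Qed.

Lemma csum_Sl (f : nat -> C) (n : nat) :
  csum f (S n) = f O + csum (fun k => f (S k)) n.
Proof.
  induction n as [|n IH]; [simpl; ring|].
  change (csum f (S (S n))) with (csum f (S n) + f (S n)).
  rewrite IH. simpl. ring.
Qed.

Lemma Re_csum (f : nat -> C) (n : nat) :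
  Re (csum f (S n)) = sum_n (fun k => Re (f k)) n.
Proof.
  induction n as [|n IH].
  - rewrite sum_O. simpl. unfold Re, Im. simpl. ring.
  - rewrite sum_Sn, <- IH. reflexivity.
Qed.

Lemma Im_csum (f : nat -> C) (n : nat) :
  Im (csum f (S n)) = sum_n (fun k => Im (f k)) n.
Proof.
  induction n as [|n IH].
  - rewrite sum_O. simpl. unfold Re, Im. simpl. ring.
  - rewrite sum_Sn, <- IH. reflexivity.
Qed.

Lemma CSeries_Ccv (f : nat -> C) (l : C) : Ccv (csum f) l -> CSeries f = l.
Proof.
  intros H. unfold CSeries.
  rewrite (is_series_unique _ (Re l)), (is_series_unique _ (Im l)).
  - now destruct l.
  - change (is_lim_seq (sum_n (fun k => Im (f k))) (Im l)).
    apply (is_lim_seq_ext (fun n => Im (csum f (S n)))).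
    { apply Im_csum. }
    apply (is_lim_seq_incr_1 (fun n => Im (csum f n))). now apply Ccv_Im.
  - change (is_lim_seq (sum_n (fun k => Re (f k))) (Re l)).
    apply (is_lim_seq_ext (fun n => Re (csum f (S n)))).
    { apply Re_csum. }
    apply (is_lim_seq_incr_1 (fun n => Re (csum f n))). now apply Ccv_Re.
Qed.

Lemma csum_geom_tail (f : nat -> C) (M rho : R) (n k : nat) :
  (0 <= rho < 1)%R -> (forall j, Cmod (f j) <= M * rho ^ j)%R ->
  (Cmod (csum f n - csum f (n + k)) <= M * rho ^ n / (1 - rho))%R.
Proof.
  intros Hr Hf.
  assert (HM : (0 <= M)%R).
  { specialize (Hf O). simpl in Hf. pose proof (Cmod_ge_0 (f O)). lra. }
  assert (H : (Cmod (csum f n - csum f (n + k))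
               <= M * rho ^ n * (1 - rho ^ k) / (1 - rho))%R).
  { induction k as [|k IH].
    - rewrite Nat.add_0_r. replace (csum f n - csum f n) with (RtoC 0) by ring.
      rewrite Cmod_0. right. simpl. field. lra.
    - rewrite Nat.add_succ_r. cbn [csum].
      replace (csum f n - (csum f (n + k) + f (n + k)%nat))
        with ((csum f n - csum f (n + k)) + - f (n + k)%nat) by ring.
      eapply Rle_trans; [apply Cmod_triangle|].
      rewrite Cmod_opp.
      eapply Rle_trans; [apply Rplus_le_compat; [apply IH | apply Hf]|].
      right. rewrite pow_add. simpl. field. lra. }
  eapply Rle_trans; [apply H|].
  unfold Rdiv. apply Rmult_le_compat_r; [left; apply Rinv_0_lt_compat; lra|].
  rewrite <- (Rmult_1_r (M * rho ^ n)) at 2.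
  apply Rmult_le_compat_l; [apply Rmult_le_pos; auto; apply pow_le; lra|].
  pose proof (pow_le rho k (proj1 Hr)). lra.
Qed.

(** The rate is kept next to the limit: it depends on f only through M and rho, which turns
    pointwise convergence of families into uniform convergence. *)
Lemma csum_geom (f : nat -> C) (M rho : R) :
  (0 <= rho < 1)%R -> (forall j, Cmod (f j) <= M * rho ^ j)%R ->
  exists l, Ccv (csum f) l /\
    forall n, (Cmod (csum f n - l) <= M * rho ^ n / (1 - rho))%R.
Proof.
  intros Hr Hf.
  assert (HG : ex_series (fun j => (M * rho ^ j)%R)).
  { apply (ex_series_scal (K := R_AbsRing) (V := R_NormedModule) M).
    apply ex_series_geom. rewrite Rabs_pos_eq; lra. }
  assert (HRe : ex_series (fun j => Re (f j))).
  { apply (ex_series_le (K := R_AbsRing) (V := R_CompleteNormedModule)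
             (fun j => Re (f j)) (fun j => (M * rho ^ j)%R)); auto.
    intros j. eapply Rle_trans; [apply re_le_Cmod | apply Hf]. }
  assert (HIm : ex_series (fun j => Im (f j))).
  { apply (ex_series_le (K := R_AbsRing) (V := R_CompleteNormedModule)
             (fun j => Im (f j)) (fun j => (M * rho ^ j)%R)); auto.
    intros j. eapply Rle_trans; [apply im_le_Cmod | apply Hf]. }
  destruct HRe as [x Hx], HIm as [y Hy].
  exists ((x, y) : C).
  assert (Hl : Ccv (csum f) (x, y)).
  { apply (Ccv_incr_n _ 1), Ccv_pair.
    - apply (is_lim_seq_ext (sum_n (fun k => Re (f k)))); [|exact Hx].
      intros n. rewrite Nat.add_1_r. symmetry. apply Re_csum.
    - apply (is_lim_seq_ext (sum_n (fun k => Im (f k)))); [|exact Hy].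
      intros n. rewrite Nat.add_1_r. symmetry. apply Im_csum. }
  split; auto. intros n.
  apply Ccv_le with (fun k => csum f n + - (1) * csum f (k + n)).
  - replace (csum f n - (x, y)) with (csum f n + - (1) * (x, y)) by ring.
    apply Ccv_plus; [apply Ccv_const|]. apply Ccv_scal.
    now apply Ccv_incr_n.
  - intros k.
    replace (csum f n + - (1) * csum f (k + n))
      with (csum f n - csum f (n + k)) by (rewrite (Nat.add_comm k n); ring).
    now apply csum_geom_tail.
Qed.

(** * q-shifted factorials *)

Lemma Cmod_pow_q (q : R) (n : nat) :
  (0 < q < 1)%R -> Cmod (RtoC q ^ n) = (q ^ n)%R.
Proof.
  intros hq. rewrite Cmod_pow, Cmod_R, Rabs_pos_eq; [auto | lra].
Qed.

Lemma pow_q_bound (q : R) (n : nat) : (0 < q < 1)%R -> (0 < q ^ n <= 1)%R.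
Proof.
  intros hq. split; [apply pow_lt; lra|].
  induction n as [|n IH]; simpl; [lra|].
  assert (0 < q ^ n)%R by (apply pow_lt; lra). nra.
Qed.

Lemma RtoC_neq0 (x : R) : x <> 0%R -> RtoC x <> 0.
Proof. intros H E. apply H. now injection E. Qed.

Lemma one_minus_neq0 (z : C) : (Cmod z < 1)%R -> 1 - z <> 0.
Proof.
  intros H E.
  assert (E' : z = 1).
  { replace z with (1 - (1 - z)) by ring. rewrite E. ring. }
  rewrite E', Cmod_1 in H. lra.
Qed.

Lemma qpoch_add (a : C) (q : R) (n m : nat) :
  qpoch a q (n + m) = qpoch a q n * qpoch (a * RtoC q ^ n) q m.
Proof.
  induction m as [|m IH].
  - rewrite Nat.add_0_r. simpl. ring.
  - rewrite Nat.add_succ_r. simpl. rewrite IH, Cpow_add_r. ring.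
Qed.

Lemma qpoch_Sl (a : C) (q : R) (n : nat) :
  qpoch a q (S n) = (1 - a) * qpoch (a * RtoC q) q n.
Proof.
  change (S n) with (1 + n)%nat. rewrite qpoch_add, Cpow_1_r. simpl. ring.
Qed.

Lemma qpoch_neq0 (a : C) (q : R) (n : nat) :
  (forall k, 1 - a * RtoC q ^ k <> 0) -> qpoch a q n <> 0.
Proof.
  intros H. induction n as [|n IH]; simpl.
  - apply RtoC_neq0. lra.
  - now apply Cmult_neq_0.
Qed.

Lemma qfactor_neq0 (a : C) (q : R) (k : nat) :
  (0 < q < 1)%R -> (Cmod a < 1)%R -> 1 - a * RtoC q ^ k <> 0.
Proof.
  intros hq ha. apply one_minus_neq0.
  rewrite Cmod_mult, Cmod_pow_q by auto.
  pose proof (pow_q_bound q k hq). pose proof (Cmod_ge_0 a). nra.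
Qed.

Lemma qpoch_small_neq0 (a : C) (q : R) (n : nat) :
  (0 < q < 1)%R -> (Cmod a < 1)%R -> qpoch a q n <> 0.
Proof. intros; apply qpoch_neq0; intros; now apply qfactor_neq0. Qed.

(** Written as 1 plus the sum of its increments, the product inherits convergence and an explicit
    rate from [csum_geom]. *)
Lemma qpoch_csum (a : C) (q : R) (n : nat) :
  qpoch a q n = 1 + csum (fun k => - (qpoch a q k * a) * RtoC q ^ k) n.
Proof. induction n as [|n IH]; simpl; [|rewrite Cplus_assoc, <- IH]; ring. Qed.

(** Each factor is at most 1 + A q^k <= exp(A q^k), and the exponents form a geometric series. The
    bound involves a only through A, which makes later estimates uniform on circles. *)
Lemma qpoch_le (q A : R) (a : C) (n : nat) :
  (0 < q < 1)%R -> (Cmod a <= A)%R ->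
  (Cmod (qpoch a q n) <= exp (A / (1 - q)))%R.
Proof.
  intros hq ha.
  assert (hA : (0 <= A)%R) by (pose proof (Cmod_ge_0 a); lra).
  assert (H : (Cmod (qpoch a q n) <= exp (A * (1 - q ^ n) / (1 - q)))%R).
  { induction n as [|n IH].
    - simpl. rewrite Cmod_1. right. replace (A * (1 - 1) / (1 - q))%R with 0%R.
      + now rewrite exp_0.
      + field. lra.
    - cbn [qpoch]. rewrite Cmod_mult.
      replace (A * (1 - q ^ S n) / (1 - q))%R
        with (A * (1 - q ^ n) / (1 - q) + A * q ^ n)%R by (simpl; field; lra).
      rewrite exp_plus.
      apply Rmult_le_compat; auto using Cmod_ge_0.
      eapply Rle_trans; [apply Cmod_triangle|].
      rewrite Cmod_opp, Cmod_1, Cmod_mult, Cmod_pow_q by auto.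
      pose proof (pow_q_bound q n hq).
      eapply Rle_trans; [|apply exp_ineq1_le].
      nra. }
  eapply Rle_trans; [apply H|].
  assert (Hle : (A * (1 - q ^ n) / (1 - q) <= A / (1 - q))%R).
  { unfold Rdiv. apply Rmult_le_compat_r; [left; apply Rinv_0_lt_compat; lra|].
    pose proof (pow_q_bound q n hq). nra. }
  destruct Hle as [Hlt|Heq]; [left; now apply exp_increasing | right; now rewrite Heq].
Qed.

Lemma qpoch_cv_aux (q A : R) (a : C) :
  (0 < q < 1)%R -> (Cmod a <= A)%R ->
  Ccv (qpoch a q) (qpoch_inf a q) /\
  forall n, (Cmod (qpoch a q n - qpoch_inf a q)
             <= exp (A / (1 - q)) * Cmod a * q ^ n / (1 - q))%R.
Proof.
  intros hq ha.
  destruct (csum_geom (fun k => - (qpoch a q k * a) * RtoC q ^ k)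
              (exp (A / (1 - q)) * Cmod a) q) as [l [Hl Hb]].
  { lra. }
  { intros j. rewrite Cmod_mult, Cmod_opp, Cmod_mult, Cmod_pow_q by auto.
    apply Rmult_le_compat_r; [left; now apply pow_q_bound|].
    apply Rmult_le_compat_r; [apply Cmod_ge_0|]. now apply qpoch_le. }
  assert (Hc : Ccv (qpoch a q) (1 + l)).
  { apply Ccv_ext
      with (fun n => 1 + csum (fun k => - (qpoch a q k * a) * RtoC q ^ k) n).
    - intros n. now rewrite <- qpoch_csum.
    - apply Ccv_plus; auto. apply Ccv_const. }
  assert (E : qpoch_inf a q = 1 + l) by (now apply CLim_seq_Ccv).
  rewrite E. split; auto. intros n. rewrite qpoch_csum.
  set (s := csum _ n).
  replace (1 + s - (1 + l)) with (s - l) by ring. apply Hb.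
Qed.

Lemma qpoch_cv (q : R) (a : C) :
  (0 < q < 1)%R -> Ccv (qpoch a q) (qpoch_inf a q).
Proof. intros hq. apply (qpoch_cv_aux q (Cmod a) a hq). lra. Qed.

Lemma qpoch_rate (q A : R) (a : C) (n : nat) :
  (0 < q < 1)%R -> (Cmod a <= A)%R ->
  (Cmod (qpoch a q n - qpoch_inf a q)
     <= exp (A / (1 - q)) * A / (1 - q) * q ^ n)%R.
Proof.
  intros hq ha.
  eapply Rle_trans; [apply (proj2 (qpoch_cv_aux q A a hq ha))|].
  replace (exp (A / (1 - q)) * A / (1 - q) * q ^ n)%R
    with (exp (A / (1 - q)) * A * q ^ n / (1 - q))%R by (field; lra).
  unfold Rdiv. apply Rmult_le_compat_r; [left; apply Rinv_0_lt_compat; lra|].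
  apply Rmult_le_compat_r; [left; now apply pow_q_bound|].
  apply Rmult_le_compat_l; [left; apply exp_pos | auto].
Qed.

Lemma qpoch_inf_near1 (q A : R) (a : C) :
  (0 < q < 1)%R -> (Cmod a <= A)%R ->
  (Cmod (qpoch_inf a q - 1) <= exp (A / (1 - q)) / (1 - q) * Cmod a)%R.
Proof.
  intros hq ha.
  pose proof (proj2 (qpoch_cv_aux q A a hq ha) O) as H. simpl in H.
  replace (qpoch_inf a q - 1) with (- (1 - qpoch_inf a q)) by ring.
  rewrite Cmod_opp. eapply Rle_trans; [apply H|]. right. field. lra.
Qed.

Lemma qpoch_inf_le (q A : R) (a : C) :
  (0 < q < 1)%R -> (Cmod a <= A)%R ->
  (Cmod (qpoch_inf a q) <= exp (A / (1 - q)))%R.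
Proof.
  intros hq ha. apply Ccv_le with (qpoch a q).
  - now apply qpoch_cv.
  - intros n. now apply qpoch_le.
Qed.

(** Each factor satisfies 1 - rho q^k >= exp(- q^k / (1 - rho)), and the exponents again form a
    geometric series. *)
Lemma qpoch_ge (q rho : R) (a : C) (n : nat) :
  (0 < q < 1)%R -> (Cmod a <= rho < 1)%R ->
  (exp (- / ((1 - rho) * (1 - q))) <= Cmod (qpoch a q n))%R.
Proof.
  intros hq ha.
  assert (hr : (0 <= rho < 1)%R) by (pose proof (Cmod_ge_0 a); lra).
  assert (H : (exp (- ((1 - q ^ n) / ((1 - rho) * (1 - q))))
               <= Cmod (qpoch a q n))%R).
  { induction n as [|n IH].
    - simpl. rewrite Cmod_1. right.
      replace (- ((1 - 1) / ((1 - rho) * (1 - q))))%R with 0%R.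
      + apply exp_0.
      + field. lra.
    - cbn [qpoch]. rewrite Cmod_mult.
      replace (- ((1 - q ^ S n) / ((1 - rho) * (1 - q))))%R
        with (- ((1 - q ^ n) / ((1 - rho) * (1 - q)))
              + - (q ^ n / (1 - rho)))%R by (simpl; field; lra).
      rewrite exp_plus.
      apply Rmult_le_compat; auto; try (left; apply exp_pos).
      pose proof (pow_q_bound q n hq) as Hp.
      apply Rle_trans with (1 - rho * q ^ n)%R.
      + rewrite exp_Ropp.
        pose proof (exp_ineq1_le (q ^ n / (1 - rho))) as He.
        assert (H1 : (1 - rho * q ^ n > 0)%R) by nra.
        apply Rmult_le_reg_l with (exp (q ^ n / (1 - rho))); [apply exp_pos|].
        rewrite Rinv_r by (apply Rgt_not_eq, exp_pos).
        apply Rle_trans with ((1 + q ^ n / (1 - rho)) * (1 - rho * q ^ n))%R;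
          [|apply Rmult_le_compat_r; lra].
        replace ((1 + q ^ n / (1 - rho)) * (1 - rho * q ^ n))%R
          with (1 + q ^ n * ((1 - rho) ^ 2 + rho * (1 - q ^ n)) / (1 - rho))%R
          by (field; lra).
        assert (0 <= q ^ n * ((1 - rho) ^ 2 + rho * (1 - q ^ n)) / (1 - rho))%R;
          [|lra].
        apply Rmult_le_pos; [|left; apply Rinv_0_lt_compat; lra].
        apply Rmult_le_pos; [lra|]. nra.
      + pose proof (Cmod_triangle (1 - a * RtoC q ^ n) (a * RtoC q ^ n)) as HT.
        replace (1 - a * RtoC q ^ n + a * RtoC q ^ n) with (RtoC 1) in HT by ring.
        rewrite Cmod_1, Cmod_mult, Cmod_pow_q in HT by auto. nra. }
  eapply Rle_trans; [|apply H].
  assert (Hle : (- / ((1 - rho) * (1 - q))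
                 <= - ((1 - q ^ n) / ((1 - rho) * (1 - q))))%R).
  { apply Ropp_le_contravar. unfold Rdiv.
    rewrite <- (Rmult_1_l (/ _)) at 2.
    apply Rmult_le_compat_r.
    - left; apply Rinv_0_lt_compat. nra.
    - pose proof (pow_q_bound q n hq). lra. }
  destruct Hle as [Hlt|Heq];
    [left; now apply exp_increasing | right; now rewrite Heq].
Qed.

Lemma qpoch_inf_ge (q rho : R) (a : C) :
  (0 < q < 1)%R -> (Cmod a <= rho < 1)%R ->
  (exp (- / ((1 - rho) * (1 - q))) <= Cmod (qpoch_inf a q))%R.
Proof.
  intros hq ha. apply Ccv_ge with (qpoch a q).
  - now apply qpoch_cv.
  - intros n. now apply qpoch_ge.
Qed.

Lemma qpoch_inf_neq0 (q : R) (a : C) :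
  (0 < q < 1)%R -> (Cmod a < 1)%R -> qpoch_inf a q <> 0.
Proof.
  intros hq ha. apply Cmod_gt_0.
  eapply Rlt_le_trans; [apply exp_pos|].
  apply (qpoch_inf_ge q (Cmod a) a hq). lra.
Qed.

Lemma Cmod_inv_le (z : C) (m : R) :
  (0 < m)%R -> (m <= Cmod z)%R -> (Cmod (/ z) <= / m)%R.
Proof.
  intros hm hz. rewrite Cmod_inv.
  - apply Rinv_le_contravar; auto.
  - apply Cmod_gt_0. lra.
Qed.

Lemma qpoch_inf_inv_le (q rho : R) (a : C) :
  (0 < q < 1)%R -> (Cmod a <= rho < 1)%R ->
  (Cmod (/ qpoch_inf a q) <= exp (/ ((1 - rho) * (1 - q))))%R.
Proof.
  intros hq ha.
  rewrite <- (Rinv_inv (exp (/ _))), <- exp_Ropp.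
  apply Cmod_inv_le; [apply exp_pos | now apply qpoch_inf_ge].
Qed.

(** Here a may be large, as happens for α u and α v. Only finitely many factors have |a q^k| >= 1;
    they are peeled off one at a time until [qpoch_ge] applies. *)
Lemma qpoch_inv_le (q : R) (a : C) :
  (0 < q < 1)%R -> (forall n, 1 - a * RtoC q ^ n <> 0) ->
  exists B : R, forall n, (Cmod (/ qpoch a q n) <= B)%R.
Proof.
  intros hq.
  assert (H : exists N, (Cmod a * q ^ N < 1)%R).
  { destruct (pow_lt_1_zero q) with (y := (/ (Cmod a + 1))%R) as [N HN].
    - rewrite Rabs_pos_eq; lra.
    - apply Rinv_0_lt_compat. pose proof (Cmod_ge_0 a). lra.
    - exists N. specialize (HN N (le_n N)).
      pose proof (pow_q_bound q N hq) as Hp. pose proof (Cmod_ge_0 a) as Ha.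
      rewrite Rabs_pos_eq in HN by lra.
      apply (Rmult_lt_compat_l (Cmod a + 1)) in HN; [|lra].
      rewrite Rinv_r in HN by lra. nra. }
  destruct H as [N HN]. revert a HN.
  induction N as [|N IH]; intros a HN Ha.
  - simpl in HN. rewrite Rmult_1_r in HN.
    exists (exp (/ ((1 - Cmod a) * (1 - q))))%R. intros n.
    rewrite <- (Rinv_inv (exp (/ _))), <- exp_Ropp.
    apply Cmod_inv_le; [apply exp_pos | apply qpoch_ge; auto; lra].
  - destruct (IH (a * RtoC q)) as [B HB].
    + rewrite Cmod_mult, Cmod_R, Rabs_pos_eq by lra. simpl in HN. lra.
    + intros n. specialize (Ha (S n)). rewrite Cpow_S in Ha.
      now replace (a * RtoC q * RtoC q ^ n)
        with (a * (RtoC q * RtoC q ^ n)) by ring.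
    + assert (H1 : 1 - a <> 0).
      { specialize (Ha O). simpl in Ha. now rewrite Cmult_1_r in Ha. }
      assert (H0 : (0 <= B)%R).
      { eapply Rle_trans; [apply Cmod_ge_0 | apply (HB O)]. }
      pose proof (Cmod_ge_0 (/ (1 - a))) as H2.
      exists (1 + Cmod (/ (1 - a)) * B)%R. intros [|n].
      * simpl. replace (/ 1) with (RtoC 1) by (field; apply RtoC_neq0; lra).
        rewrite Cmod_1. nra.
      * rewrite qpoch_Sl.
        replace (/ ((1 - a) * qpoch (a * RtoC q) q n))
          with (/ (1 - a) * / qpoch (a * RtoC q) q n).
        -- rewrite Cmod_mult. specialize (HB n).
           pose proof (Cmod_ge_0 (/ qpoch (a * RtoC q) q n)). nra.
        -- field. split; auto. apply qpoch_neq0. intros k.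
           specialize (Ha (S k)). rewrite Cpow_S in Ha.
           now replace (a * RtoC q * RtoC q ^ k)
             with (a * (RtoC q * RtoC q ^ k)) by ring.
Qed.

Lemma qpoch_inf_split (q : R) (a : C) (n : nat) :
  (0 < q < 1)%R -> qpoch_inf a q = qpoch a q n * qpoch_inf (a * RtoC q ^ n) q.
Proof.
  intros hq. apply Ccv_unique with (qpoch a q).
  - now apply qpoch_cv.
  - apply (Ccv_incr_n _ n).
    apply Ccv_ext with (fun m => qpoch a q n * qpoch (a * RtoC q ^ n) q m).
    + intros m. now rewrite Nat.add_comm, qpoch_add.
    + apply Ccv_scal. now apply qpoch_cv.
Qed.

Lemma qpoch_inf_Sl (q : R) (a : C) :
  (0 < q < 1)%R -> qpoch_inf a q = (1 - a) * qpoch_inf (a * RtoC q) q.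
Proof.
  intros hq. rewrite (qpoch_inf_split q a 1 hq), Cpow_1_r. simpl. ring.
Qed.

Lemma qpoch_inf_0 (q : R) : (0 < q < 1)%R -> qpoch_inf 0 q = 1.
Proof.
  intros hq. apply CLim_seq_Ccv.
  apply Ccv_ext with (fun _ => RtoC 1); [|apply Ccv_const].
  induction n as [|n IH]; simpl; [auto | rewrite <- IH; ring].
Qed.

Lemma qpoch_inf_square (q : R) (a : C) :
  (0 < q < 1)%R ->
  qpoch_inf (a * a) (q * q) = qpoch_inf a q * qpoch_inf (- a) q.
Proof.
  intros hq. apply CLim_seq_Ccv.
  apply Ccv_ext with (fun n => qpoch a q n * qpoch (- a) q n).
  - induction n as [|n IH]; simpl; [ring|]. rewrite <- IH.
    rewrite RtoC_mult, Cpow_mult_l. ring.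
  - apply Ccv_mult; now apply qpoch_cv.
Qed.

Lemma qpoch_inf_bisect (q : R) (a : C) :
  (0 < q < 1)%R ->
  qpoch_inf a q = qpoch_inf a (q * q) * qpoch_inf (a * RtoC q) (q * q).
Proof.
  intros hq.
  assert (hqq : (0 < q * q < 1)%R) by nra.
  apply Ccv_unique with (fun n => qpoch a q (2 * n)).
  - assert (HC := qpoch_cv q a hq). unfold Ccv in *.
    apply (is_lim_seq_subseq (fun n => Cmod (qpoch a q n - qpoch_inf a q)) 0%R
             (fun n => (2 * n)%nat)); auto.
    apply eventually_subseq. intros n. lia.
  - apply Ccv_ext
      with (fun n => qpoch a (q * q) n * qpoch (a * RtoC q) (q * q) n).
    + induction n as [|n IH]; [simpl; ring|].
      replace (2 * S n)%nat with (S (S (2 * n))) by lia.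
      cbn [qpoch]. rewrite <- IH, Cpow_S, Cpow_mult_r, RtoC_mult.
      replace (RtoC q ^ 2) with (RtoC q * RtoC q) by (simpl; ring). ring.
    + apply Ccv_mult; now apply qpoch_cv.
Qed.

(** * The limiting 6phi5 sum *)

Lemma triangle_S (n : nat) :
  (S n * (S n - 1) / 2 = n * (n - 1) / 2 + n)%nat.
Proof.
  replace (S n * (S n - 1))%nat with (n * (n - 1) + n * 2)%nat by nia.
  now rewrite Nat.div_add.
Qed.

Lemma qtri_S (q : R) (n : nat) :
  RtoC q ^ (S n * (S n - 1) / 2) = RtoC q ^ (n * (n - 1) / 2) * RtoC q ^ n.
Proof. now rewrite triangle_S, Cpow_add_r. Qed.

Lemma Cpow_double (x : C) (n : nat) : x ^ (2 * n) = x ^ n * x ^ n.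
Proof. replace (2 * n)%nat with (n + n)%nat by lia. apply Cpow_add_r. Qed.

Lemma qpoch_shift (a : C) (q : R) (n : nat) :
  1 - a <> 0 ->
  qpoch (a * RtoC q) q n = qpoch a q n * (1 - a * RtoC q ^ n) / (1 - a).
Proof.
  intros H. change (qpoch a q n * (1 - a * RtoC q ^ n)) with (qpoch a q (S n)).
  rewrite qpoch_Sl. field. auto.
Qed.

(** Term of the very-well-poised 6phi5 series in α, X, Y whose last numerator parameter is sent to
    infinity; that limit produces the sign and the quadratic power of q. When α q = XYs, the
    denominators Xs and Ys are the usual α q / Y and α q / X. *)
Definition jackson_term (q : R) (alpha X Y s : C) (n : nat) : C :=
  (1 - alpha * RtoC q ^ (2 * n)) * (qpoch alpha q n / (1 - alpha))
  * (qpoch X q n * qpoch Y q n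
     * (/ qpoch q q n * (/ qpoch (X * s) q n * / qpoch (Y * s) q n)))
  * ((- s) ^ n * RtoC q ^ (n * (n - 1) / 2)).

(** Replacing (α, s) by (α q, s q) with X and Y fixed preserves α q = XYs. The terms of this
    combination of the two series are increments of the right-hand side, so the induction reduces to
    one rational identity. *)
Lemma jackson_telescope (q : R) (alpha X Y s : C) (n : nat) :
  (0 < q < 1)%R -> alpha = X * Y * s / RtoC q ->
  (forall k, 1 - alpha * RtoC q ^ k <> 0) ->
  (forall k, 1 - X * s * RtoC q ^ k <> 0) ->
  (forall k, 1 - Y * s * RtoC q ^ k <> 0) ->
  (1 - X * s) * (1 - Y * s) * csum (jackson_term q alpha X Y s) (S n)
  - (1 - X * Y * s) * (1 - s)
    * csum (jackson_term q (alpha * RtoC q) X Y (s * RtoC q)) (S n)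
  = - ((1 - X * s) * (1 - Y * s) * (qpoch alpha q (S n) / (1 - alpha))
       * (qpoch X q (S n) * qpoch Y q (S n)
          * (/ qpoch q q n
             * (/ qpoch (X * s) q (S n) * / qpoch (Y * s) q (S n))))
       * ((- s) ^ S n * RtoC q ^ (S n * (S n - 1) / 2))).
Proof.
  intros hq halpha Ha HX HY.
  assert (q0 : RtoC q <> 0) by (apply RtoC_neq0; lra).
  assert (H0 : forall a : C, (forall k, 1 - a * RtoC q ^ k <> 0) -> 1 - a <> 0).
  { intros a H. specialize (H O). simpl in H. now rewrite Cmult_1_r in H. }
  assert (H1 : forall a : C,
             (forall k, 1 - a * RtoC q ^ k <> 0) -> 1 - a * RtoC q <> 0).
  { intros a H. specialize (H 1%nat). now rewrite Cpow_1_r in H. }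
  pose proof (H0 _ Ha) as Ha0. pose proof (H1 _ Ha) as Ha1.
  pose proof (H0 _ HX) as HX0. pose proof (H1 _ HX) as HX1.
  pose proof (H0 _ HY) as HY0. pose proof (H1 _ HY) as HY1.
  assert (one0 : RtoC 1 <> 0) by (apply RtoC_neq0; lra).
  assert (q1 : 1 - RtoC q <> 0).
  { apply one_minus_neq0. rewrite Cmod_R, Rabs_pos_eq; lra. }
  induction n as [|n IH].
  - cbn [csum]. unfold jackson_term. simpl.
    rewrite halpha in *.
    field. repeat split; auto.
    + intros E. apply Ha0. rewrite <- (Cmult_0_r (/ RtoC q)), <- E. field. auto.
    + intros E. apply Ha1. rewrite <- E. field. auto.
  - change (csum (jackson_term q alpha X Y s) (S (S n)))
      with (csum (jackson_term q alpha X Y s) (S n)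
            + jackson_term q alpha X Y s (S n)).
    change (csum (jackson_term q (alpha * RtoC q) X Y (s * RtoC q)) (S (S n)))
      with (csum (jackson_term q (alpha * RtoC q) X Y (s * RtoC q)) (S n)
            + jackson_term q (alpha * RtoC q) X Y (s * RtoC q) (S n)).
    match type of IH with ?a * ?x - ?b * ?y = ?c =>
      set (x0 := x) in *; set (y0 := y) in *;
      transitivity ((a * x0 - b * y0) + (a * jackson_term q alpha X Y s (S n)
         - b * jackson_term q (alpha * RtoC q) X Y (s * RtoC q) (S n)));
      [ring|]; rewrite IH; clear IH end.
    assert (HP : qpoch q q n <> 0).
    { apply qpoch_small_neq0; auto. rewrite Cmod_R, Rabs_pos_eq; lra. }
    pose proof (qpoch_neq0 _ q n HX) as HPX.
    pose proof (qpoch_neq0 _ q n HY) as HPY.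
    unfold jackson_term.
    replace (X * (s * RtoC q)) with (X * s * RtoC q) by ring.
    replace (Y * (s * RtoC q)) with (Y * s * RtoC q) by ring.
    replace (- (s * RtoC q)) with (- s * RtoC q) by ring.
    rewrite !Cpow_mult_l, !qpoch_shift by auto.
    rewrite !qtri_S, !Cpow_double.
    cbn [qpoch]. rewrite !Cpow_S.
    assert (hq1 : 1 - RtoC q * RtoC q ^ n <> 0).
    { apply qfactor_neq0; auto. rewrite Cmod_R, Rabs_pos_eq; lra. }
    pose proof (HX n) as HXn. pose proof (HX (S n)) as HXSn.
    pose proof (HY n) as HYn. pose proof (HY (S n)) as HYSn.
    rewrite Cpow_S in HXSn, HYSn.
    revert HP HPX HPY.
    (* Factorials and powers become free variables, with y standing for q^n; the remaining rational
       identity holds once α is replaced by XYs / q. *)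
    generalize (qpoch alpha q n) (qpoch X q n) (qpoch Y q n)
      (qpoch q q n) (qpoch (X * s) q n) (qpoch (Y * s) q n)
      (RtoC q ^ (n * (n - 1) / 2)) ((- s) ^ n).
    intros Pa PX PY Pq PXs PYs tri sn HP HPX HPY.
    revert hq1 HXn HXSn HYn HYSn.
    generalize (RtoC q ^ n). intros y hq1 HXn HXSn HYn HYSn.
    clear H0 H1 Ha HX HY x0 y0.
    rewrite halpha in *.
    field. repeat split; auto.
    + intros E. apply Ha0. rewrite <- (Cmult_0_r (/ RtoC q)), <- E. field. auto.
    + intros E. apply Ha1. rewrite <- E. field. auto.
Qed.

Lemma Cmod_mult_le (x y : C) (A B : R) :
  (Cmod x <= A)%R -> (Cmod y <= B)%R -> (Cmod (x * y) <= A * B)%R.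
Proof.
  intros. rewrite Cmod_mult. apply Rmult_le_compat; auto using Cmod_ge_0.
Qed.

Lemma Cmod_mult_small (x y : C) (A B : R) :
  (Cmod x <= A)%R -> (Cmod y <= B)%R -> (B <= 1)%R -> (Cmod (x * y) <= A)%R.
Proof.
  intros. rewrite Cmod_mult. pose proof (Cmod_ge_0 x). pose proof (Cmod_ge_0 y).
  nra.
Qed.

Lemma qpoch_small_inv_le (q rho : R) (a : C) (n : nat) :
  (0 < q < 1)%R -> (Cmod a <= rho < 1)%R ->
  (Cmod (/ qpoch a q n) <= exp (/ ((1 - rho) * (1 - q))))%R.
Proof.
  intros hq ha.
  rewrite <- (Rinv_inv (exp (/ _))), <- exp_Ropp.
  apply Cmod_inv_le; [apply exp_pos | now apply qpoch_ge].
Qed.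

Lemma Cmod_RtoC_q (q : R) : (0 < q < 1)%R -> Cmod (RtoC q) = q.
Proof. intros hq. rewrite Cmod_R, Rabs_pos_eq; lra. Qed.

Lemma Cmod_pow_q_le1 (q : R) (n : nat) :
  (0 < q < 1)%R -> (Cmod (RtoC q ^ n) <= 1)%R.
Proof. intros hq. rewrite Cmod_pow_q by auto. now apply pow_q_bound. Qed.

(** The factors bound, in order, 1 - α q^(2n), (α q; q)_(n-1), (X; q)_n and (Y; q)_n, 1 / (q; q)_n,
    and the last two reciprocals. Neither α, X nor Y appears and s enters only through rho, so one
    constant serves all shifts s q^j. *)
Definition jackson_bound (q rho : R) : R :=
  let E := exp (1 / (1 - q)) in
  let B := exp (/ ((1 - rho) * (1 - q))) in
  (2 * E * (E * E * (exp (/ ((1 - q) * (1 - q))) * (B * B))))%R.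

(** The index is positive because |α| may exceed 1: a spare q turns α q^(2n) into a multiple of α q
    = XYs, and (α; q)_n / (1 - α) is (α q; q)_(n-1), so both are controlled without reference to
    α. *)
Lemma jackson_term_le (q rho : R) (alpha X Y s : C) (n : nat) :
  (0 < q < 1)%R -> (Cmod X <= 1)%R -> (Cmod Y <= 1)%R ->
  (Cmod s <= rho < 1)%R -> alpha = X * Y * s / RtoC q -> 1 - alpha <> 0 ->
  (Cmod (jackson_term q alpha X Y s (S n))
     <= jackson_bound q rho * Cmod s ^ S n)%R.
Proof.
  intros hq hX hY hs halpha Ha0.
  assert (q0 : RtoC q <> 0) by (apply RtoC_neq0; lra).
  assert (haq : (Cmod (alpha * RtoC q) <= 1)%R).
  { replace (alpha * RtoC q) with (X * Y * s) by (rewrite halpha; field; auto).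
    apply Cmod_mult_small with rho; [|lra|lra].
    now apply Cmod_mult_small with 1%R; [| |lra]. }
  unfold jackson_term, jackson_bound.
  apply Cmod_mult_le; [apply Cmod_mult_le; [apply Cmod_mult_le|apply Cmod_mult_le]|].
  - eapply Rle_trans; [apply Cmod_triangle|]. rewrite Cmod_1, Cmod_opp.
    replace (2 * S n)%nat with (S (2 * n + 1)) by lia. rewrite Cpow_S.
    rewrite Cmult_assoc.
    assert (Cmod (alpha * RtoC q * RtoC q ^ (2 * n + 1)) <= 1)%R; [|lra].
    apply Cmod_mult_small with 1%R; auto; [|lra]. now apply Cmod_pow_q_le1.
  - rewrite qpoch_Sl.
    replace ((1 - alpha) * qpoch (alpha * q) q n / (1 - alpha))
      with (qpoch (alpha * q) q n) by (field; auto).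
    now apply qpoch_le.
  - apply Cmod_mult_le; now apply qpoch_le.
  - apply Cmod_mult_le; [|apply Cmod_mult_le].
    + apply qpoch_small_inv_le; auto. rewrite Cmod_RtoC_q; lra.
    + apply qpoch_small_inv_le; auto. split; [|lra].
      rewrite Cmult_comm. now apply Cmod_mult_small with 1%R; [| |lra].
    + apply qpoch_small_inv_le; auto. split; [|lra].
      rewrite Cmult_comm. now apply Cmod_mult_small with 1%R; [| |lra].
  - rewrite Cmod_mult, Cmod_pow, Cmod_opp.
    pose proof (Cmod_pow_q_le1 q (S n * (S n - 1) / 2) hq).
    pose proof (Cmod_ge_0 (RtoC q ^ (S n * (S n - 1) / 2))).
    pose proof (pow_le (Cmod s) (S n) (Cmod_ge_0 s)). nra.
Qed.

Lemma jackson_bound_ge1 (q rho : R) :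
  (0 < q < 1)%R -> (0 <= rho < 1)%R -> (1 <= jackson_bound q rho)%R.
Proof.
  intros hq hr. unfold jackson_bound.
  assert (He : forall x, (0 <= x)%R -> (1 <= exp x)%R).
  { intros x Hx. pose proof (exp_ineq1_le x). lra. }
  assert (HE : (1 <= exp (1 / (1 - q)))%R).
  { apply He. apply Rdiv_le_0_compat; lra. }
  assert (HB : (1 <= exp (/ ((1 - rho) * (1 - q))))%R).
  { apply He. left. apply Rinv_0_lt_compat. nra. }
  assert (HB' : (1 <= exp (/ ((1 - q) * (1 - q))))%R).
  { apply He. left. apply Rinv_0_lt_compat. nra. }
  assert (Hm : forall x y, (1 <= x -> 1 <= y -> 1 <= x * y)%R) by (intros; nra).
  repeat apply Hm; auto; lra.
Qed.

Lemma jackson_term_0 (q : R) (alpha X Y s : C) :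
  1 - alpha <> 0 -> jackson_term q alpha X Y s 0 = 1.
Proof.
  intros H. unfold jackson_term. simpl. now field.
Qed.

Lemma jackson_term_le_geom (q rho : R) (alpha X Y s : C) (n : nat) :
  (0 < q < 1)%R -> (Cmod X <= 1)%R -> (Cmod Y <= 1)%R ->
  (Cmod s <= rho < 1)%R -> alpha = X * Y * s / RtoC q -> 1 - alpha <> 0 ->
  (Cmod (jackson_term q alpha X Y s n) <= jackson_bound q rho * Cmod s ^ n)%R.
Proof.
  intros hq hX hY hs halpha Ha0. destruct n as [|n].
  - rewrite jackson_term_0, Cmod_1 by auto. simpl.
    assert (0 <= rho < 1)%R by (pose proof (Cmod_ge_0 s); lra).
    pose proof (jackson_bound_ge1 q rho hq). lra.
  - now apply jackson_term_le.
Qed.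

(** The boundary term of [jackson_telescope] is O(|s|^n) and disappears in the limit. *)
Lemma jackson_step (q : R) (alpha X Y s S0 S1 : C) :
  (0 < q < 1)%R -> (Cmod X <= 1)%R -> (Cmod Y <= 1)%R ->
  (Cmod s < 1)%R -> alpha = X * Y * s / RtoC q ->
  (forall k, 1 - alpha * RtoC q ^ k <> 0) ->
  Ccv (csum (jackson_term q alpha X Y s)) S0 ->
  Ccv (csum (jackson_term q (alpha * RtoC q) X Y (s * RtoC q))) S1 ->
  (1 - X * s) * (1 - Y * s) * S0 = (1 - X * Y * s) * (1 - s) * S1.
Proof.
  intros hq hX hY hs halpha Ha H0 H1.
  assert (hXs : (Cmod (X * s) < 1)%R).
  { rewrite Cmod_mult. pose proof (Cmod_ge_0 s). pose proof (Cmod_ge_0 X). nra. }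
  assert (hYs : (Cmod (Y * s) < 1)%R).
  { rewrite Cmod_mult. pose proof (Cmod_ge_0 s). pose proof (Cmod_ge_0 Y). nra. }
  assert (Ha0 : 1 - alpha <> 0).
  { specialize (Ha O). simpl in Ha. now rewrite Cmult_1_r in Ha. }
  assert (E : (1 - X * s) * (1 - Y * s) * S0
              + - (1) * ((1 - X * Y * s) * (1 - s) * S1) = 0).
  { eapply Ccv_unique.
    - apply Ccv_plus; [apply Ccv_scal, (proj2 (Ccv_incr_n _ 1 _) H0)|].
      apply Ccv_scal, Ccv_scal, (proj2 (Ccv_incr_n _ 1 _) H1).
    - eapply Ccv_bound; cycle 1.
      { apply (proj1 (is_lim_seq_incr_1
                 (fun n => (8 * jackson_bound q (Cmod s) * Cmod s ^ n)%R) _)).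
        apply is_lim_seq_geom0. split; [apply Cmod_ge_0 | auto]. }
      intros n. cbv beta. rewrite Nat.add_1_r.
      assert (Hr : forall x y : C, x + - (1) * y - 0 = x - y) by (intros; ring).
      rewrite Hr.
      rewrite (jackson_telescope q alpha X Y s n); auto;
        try (intros k; now apply qfactor_neq0).
      rewrite Cmod_opp.
      unfold jackson_bound.
      set (E := exp (1 / (1 - q))). set (B := exp (/ ((1 - Cmod s) * (1 - q)))).
      (* The factors 1 - Xs and 1 - Ys are at most 2 each; the remaining factor 4 in 4E is slack. *)
      replace (8 * (2 * E * (E * E * (exp (/ ((1 - q) * (1 - q))) * (B * B))))
                 * Cmod s ^ S n)%R
        with (2 * 2 * (4 * E)
              * (E * E * (exp (/ ((1 - q) * (1 - q))) * (B * B)))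
              * Cmod s ^ S n)%R by ring.
      assert (q0 : RtoC q <> 0) by (apply RtoC_neq0; lra).
      assert (haq : (Cmod (alpha * RtoC q) <= 1)%R).
      { replace (alpha * RtoC q) with (X * Y * s)
          by (rewrite halpha; field; auto).
        apply Cmod_mult_small with (Cmod s); [|lra|lra].
        now apply Cmod_mult_small with 1%R; [| |lra]. }
      apply Cmod_mult_le; [apply Cmod_mult_le; [apply Cmod_mult_le;
        [apply Cmod_mult_le|]|apply Cmod_mult_le]|].
      + eapply Rle_trans; [apply Cmod_triangle|]. rewrite Cmod_1, Cmod_opp. lra.
      + eapply Rle_trans; [apply Cmod_triangle|]. rewrite Cmod_1, Cmod_opp. lra.
      + rewrite qpoch_Sl.
        replace ((1 - alpha) * qpoch (alpha * q) q n / (1 - alpha))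
          with (qpoch (alpha * q) q n) by (field; auto).
        eapply Rle_trans; [now apply (qpoch_le q 1)|].
        fold E. pose proof (exp_pos (1 / (1 - q))) as HE. fold E in HE. lra.
      + apply Cmod_mult_le; now apply qpoch_le.
      + apply Cmod_mult_le; [|apply Cmod_mult_le].
        * apply qpoch_small_inv_le; auto. rewrite Cmod_RtoC_q; lra.
        * apply qpoch_small_inv_le; auto. split; [|lra].
          rewrite Cmult_comm. apply Cmod_mult_small with 1%R; auto; lra.
        * apply qpoch_small_inv_le; auto. split; [|lra].
          rewrite Cmult_comm. apply Cmod_mult_small with 1%R; auto; lra.
      + rewrite Cmod_mult, Cmod_pow, Cmod_opp.
        pose proof (Cmod_pow_q_le1 q (S n * (S n - 1) / 2) hq).
        pose proof (Cmod_ge_0 (RtoC q ^ (S n * (S n - 1) / 2))).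
        pose proof (pow_le (Cmod s) (S n) (Cmod_ge_0 s)). nra. }
  replace ((1 - X * s) * (1 - Y * s) * S0)
    with ((1 - X * s) * (1 - Y * s) * S0
          + - (1) * ((1 - X * Y * s) * (1 - s) * S1)
          + (1 - X * Y * s) * (1 - s) * S1) by ring.
  rewrite E. ring.
Qed.

(** Iterating [jackson_step] relates the sums at s and s q^j by finite products. As j grows, s q^j
    tends to 0, where only the term of index 0, equal to 1, survives. *)
Lemma jackson_sum (q : R) (alpha X Y s : C) :
  (0 < q < 1)%R -> (Cmod X <= 1)%R -> (Cmod Y <= 1)%R ->
  (Cmod s < 1)%R -> alpha = X * Y * s / RtoC q ->
  (forall k, 1 - alpha * RtoC q ^ k <> 0) ->
  Ccv (csum (jackson_term q alpha X Y s))
    (qpoch_inf (X * Y * s) q * qpoch_inf s q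
     * (/ qpoch_inf (X * s) q * / qpoch_inf (Y * s) q)).
Proof.
  intros hq hX hY hs halpha Ha.
  assert (q0 : RtoC q <> 0) by (apply RtoC_neq0; lra).
  set (al := fun j : nat => alpha * RtoC q ^ j).
  set (sj := fun j : nat => s * RtoC q ^ j).
  set (rho := Cmod s).
  assert (hal : forall j, al j = X * Y * sj j / RtoC q).
  { intros j. unfold al, sj. rewrite halpha. field. auto. }
  assert (Haj : forall j k, 1 - al j * RtoC q ^ k <> 0).
  { intros j k. unfold al. rewrite <- Cmult_assoc, <- Cpow_add_r. apply Ha. }
  assert (Haj0 : forall j, 1 - al j <> 0).
  { intros j. specialize (Haj j O). simpl in Haj. now rewrite Cmult_1_r in Haj. }
  assert (hrho : (0 <= rho < 1)%R) by (split; [apply Cmod_ge_0 | auto]).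
  assert (hsj : forall j, Cmod (sj j) = (rho * q ^ j)%R).
  { intros j. unfold sj. now rewrite Cmod_mult, Cmod_pow_q. }
  assert (hsj' : forall j, (Cmod (sj j) <= rho < 1)%R).
  { intros j. rewrite hsj. pose proof (pow_q_bound q j hq). nra. }
  assert (Hcv : forall j, exists l, Ccv (csum (jackson_term q (al j) X Y (sj j))) l).
  { intros j. destruct (csum_geom (jackson_term q (al j) X Y (sj j))
                          (jackson_bound q rho) (Cmod (sj j))) as [l [Hl _]].
    - split; [apply Cmod_ge_0 | specialize (hsj' j); lra].
    - intros n. now apply jackson_term_le_geom.
    - now exists l. }
  (* [CLim_seq] turns the existence of each limit into a function of j. *)
  assert (HS : exists S : nat -> C,
             forall j, Ccv (csum (jackson_term q (al j) X Y (sj j))) (S j)).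
  { exists (fun j => CLim_seq (csum (jackson_term q (al j) X Y (sj j)))).
    intros j. destruct (Hcv j) as [l Hl]. now rewrite (CLim_seq_Ccv _ _ Hl). }
  destruct HS as [S HS].
  assert (Hstep : forall j, qpoch (X * s) q j * qpoch (Y * s) q j * S O
                            = qpoch (X * Y * s) q j * qpoch s q j * S j).
  { induction j as [|j IH]; [simpl; ring|].
    assert (Hj : (1 - X * sj j) * (1 - Y * sj j) * S j
                 = (1 - X * Y * sj j) * (1 - sj j) * S (1 + j)%nat).
    { apply (jackson_step q (al j)); auto.
      - specialize (hsj' j). lra.
      - replace (al j * RtoC q) with (al (1 + j)%nat)
          by (unfold al; simpl; ring).
        replace (sj j * RtoC q) with (sj (1 + j)%nat)
          by (unfold sj; simpl; ring).
        apply HS. }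
    cbn [qpoch]. simpl in Hj. unfold sj in Hj.
    transitivity ((1 - X * s * RtoC q ^ j) * (1 - Y * s * RtoC q ^ j)
                  * (qpoch (X * s) q j * qpoch (Y * s) q j * S O)); [ring|].
    rewrite IH.
    transitivity (qpoch (X * Y * s) q j * qpoch s q j
      * ((1 - X * (s * RtoC q ^ j)) * (1 - Y * (s * RtoC q ^ j)) * S j));
      [ring|].
    rewrite Hj. ring. }
  (* After the leading 1, every term carries at least one factor s q^j, so the rest is O(q^j). *)
  assert (Hlim : Ccv S 1).
  { apply Ccv_bound
      with (fun j => ((jackson_bound q rho * rho / (1 - rho)) * q ^ j)%R);
      [|apply is_lim_seq_geom0; lra].
    intros j. apply Ccv_le
      with (fun n => csum (jackson_term q (al j) X Y (sj j)) (n + 1) + - (1)).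
    - apply Ccv_plus; [|apply Ccv_const]. apply (Ccv_incr_n _ 1), HS.
    - intros n. rewrite Nat.add_1_r, csum_Sl, jackson_term_0 by auto.
      set (w := csum _ n). replace (1 + w + - (1)) with w by ring. unfold w.
      assert (Ht : forall m, (Cmod (jackson_term q (al j) X Y (sj j) (Datatypes.S m))
                     <= (jackson_bound q rho * rho * q ^ j) * rho ^ m)%R).
      { intros m. eapply Rle_trans; [now apply (jackson_term_le q rho)|].
        pose proof (jackson_bound_ge1 q rho hq hrho).
        rewrite !Rmult_assoc. apply Rmult_le_compat_l; [lra|].
        change (Cmod (sj j) ^ Datatypes.S m)%R
          with (Cmod (sj j) * Cmod (sj j) ^ m)%R.
        rewrite <- Rmult_assoc.
        apply Rmult_le_compat; [apply Cmod_ge_0| |rewrite hsj; lra|].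
        - apply pow_le, Cmod_ge_0.
        - apply pow_incr. split; [apply Cmod_ge_0 | apply hsj']. }
      pose proof (csum_geom_tail _ _ rho 0 n hrho Ht) as HT.
      replace (csum _ 0 - csum _ (0 + n)) with
        (- csum (fun m => jackson_term q (al j) X Y (sj j) (Datatypes.S m)) n)
        in HT by (simpl; ring).
      rewrite Cmod_opp in HT. eapply Rle_trans; [apply HT|].
      right. simpl. field. lra. }
  assert (hXs : (Cmod (X * s) < 1)%R).
  { rewrite Cmod_mult. pose proof (Cmod_ge_0 s). pose proof (Cmod_ge_0 X). nra. }
  assert (hYs : (Cmod (Y * s) < 1)%R).
  { rewrite Cmod_mult. pose proof (Cmod_ge_0 s). pose proof (Cmod_ge_0 Y). nra. }
  assert (E : qpoch_inf (X * s) q * qpoch_inf (Y * s) q * S O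
              = qpoch_inf (X * Y * s) q * qpoch_inf s q * 1).
  { eapply Ccv_unique.
    - apply Ccv_mult; [|apply (Ccv_const (S O))].
      apply Ccv_mult; now apply qpoch_cv.
    - eapply Ccv_ext; [intros j; symmetry; apply Hstep|].
      apply Ccv_mult; auto. apply Ccv_mult; now apply qpoch_cv. }
  assert (E0 : S O = qpoch_inf (X * Y * s) q * qpoch_inf s q
                     * (/ qpoch_inf (X * s) q * / qpoch_inf (Y * s) q)).
  { pose proof (qpoch_inf_neq0 q _ hq hXs). pose proof (qpoch_inf_neq0 q _ hq hYs).
    transitivity (qpoch_inf (X * s) q * qpoch_inf (Y * s) q * S O
                  * (/ qpoch_inf (X * s) q * / qpoch_inf (Y * s) q));
      [field; auto | rewrite E; ring]. }
  rewrite <- E0. specialize (HS O). unfold al, sj in HS. simpl in HS.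
  now rewrite !Cmult_1_r in HS.
Qed.

(** * The q-Saalschuetz sum and Watson's transformation *)

(** Term of the balanced terminating 3phi2 with numerators q^-N, α q^N, α u v / q, denominators α u,
    α v and argument q. *)
Definition saal_term (q : R) (alpha u v : C) (N k : nat) : C :=
  qpoch (/ RtoC q ^ N) q k * qpoch (alpha * RtoC q ^ N) q k
  * qpoch (alpha * u * v / RtoC q) q k * RtoC q ^ k
  * (/ qpoch q q k * (/ qpoch (alpha * u) q k * / qpoch (alpha * v) q k)).

(** A recurrence in N whose defect on partial sums is a single product. For K = N + 1 that product
    contains (q^-N; q)_(N+1) = 0. Writing the coefficient with u - q^(N+1) and v - q^(N+1) avoids
    division by u and v. *)
Lemma saal_telescope (q : R) (alpha u v : C) (N K : nat) :
  (0 < q < 1)%R ->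
  (forall n, 1 - alpha * u * RtoC q ^ n <> 0) ->
  (forall n, 1 - alpha * v * RtoC q ^ n <> 0) ->
  (1 - alpha * u * RtoC q ^ N) * (1 - alpha * v * RtoC q ^ N)
    * csum (saal_term q alpha u v (S N)) (S K)
  - alpha / RtoC q * (u - RtoC q ^ S N) * (v - RtoC q ^ S N)
    * csum (saal_term q alpha u v N) (S K)
  = (1 - alpha * RtoC q ^ N * RtoC q ^ S N)
    * qpoch (/ RtoC q ^ N) q K * qpoch (alpha * RtoC q ^ S N) q K
    * qpoch (alpha * u * v / RtoC q) q (S K)
    * (/ qpoch q q K * (/ qpoch (alpha * u) q K * / qpoch (alpha * v) q K)).
Proof.
  intros hq hu hv.
  assert (q0 : RtoC q <> 0) by (apply RtoC_neq0; lra).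
  assert (qN0 : RtoC q ^ N <> 0) by (now apply Cpow_nz).
  induction K as [|K IH].
  - cbn [csum]. unfold saal_term. simpl.
    field. repeat split; auto; apply RtoC_neq0; lra.
  - change (csum (saal_term q alpha u v (S N)) (S (S K)))
      with (csum (saal_term q alpha u v (S N)) (S K)
            + saal_term q alpha u v (S N) (S K)).
    change (csum (saal_term q alpha u v N) (S (S K)))
      with (csum (saal_term q alpha u v N) (S K) + saal_term q alpha u v N (S K)).
    match type of IH with ?a * ?x - ?b * ?y = ?c =>
      transitivity ((a * x - b * y) + (a * saal_term q alpha u v (S N) (S K)
         - b * saal_term q alpha u v N (S K))); [ring|]; rewrite IH; clear IH end.
    unfold saal_term.
    rewrite (qpoch_Sl (/ RtoC q ^ S N)), (qpoch_Sl (alpha * RtoC q ^ N)).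
    replace (/ RtoC q ^ S N * RtoC q) with (/ RtoC q ^ N)
      by (rewrite Cpow_S; field; auto).
    replace (alpha * RtoC q ^ N * RtoC q) with (alpha * RtoC q ^ S N)
      by (rewrite Cpow_S; ring).
    cbn [qpoch]. rewrite !Cpow_S.
    assert (HP : qpoch q q K <> 0).
    { apply qpoch_small_neq0; auto. rewrite Cmod_RtoC_q; lra. }
    assert (hq1 : 1 - RtoC q * RtoC q ^ K <> 0).
    { apply qfactor_neq0; auto. rewrite Cmod_RtoC_q; lra. }
    pose proof (qpoch_neq0 _ q K hu) as HU.
    pose proof (qpoch_neq0 _ q K hv) as HV.
    pose proof (hu K) as huK. pose proof (hv K) as hvK.
    field. repeat split; auto.
Qed.

Lemma qpoch_inv_pow_vanish (q : R) (N : nat) :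
  (0 < q < 1)%R -> qpoch (/ RtoC q ^ N) q (S N) = 0.
Proof.
  intros hq. cbn [qpoch].
  replace (1 - / RtoC q ^ N * RtoC q ^ N) with (RtoC 0); [ring|].
  field. apply Cpow_nz, RtoC_neq0. lra.
Qed.

Lemma saalschutz (q : R) (alpha u v : C) (N : nat) :
  (0 < q < 1)%R -> u <> 0 -> v <> 0 ->
  (forall n, 1 - alpha * u * RtoC q ^ n <> 0) ->
  (forall n, 1 - alpha * v * RtoC q ^ n <> 0) ->
  csum (saal_term q alpha u v N) (S N)
  = (alpha * u * v / RtoC q) ^ N
    * (qpoch (RtoC q / u) q N * qpoch (RtoC q / v) q N
       * (/ qpoch (alpha * u) q N * / qpoch (alpha * v) q N)).
Proof.
  intros hq hu0 hv0 hu hv.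
  assert (q0 : RtoC q <> 0) by (apply RtoC_neq0; lra).
  induction N as [|N IH].
  - cbn [csum]. unfold saal_term. simpl. now field.
  - pose proof (saal_telescope q alpha u v N (S N) hq hu hv) as H.
    rewrite qpoch_inv_pow_vanish in H by auto.
    change (csum (saal_term q alpha u v N) (S (S N)))
      with (csum (saal_term q alpha u v N) (S N)
            + saal_term q alpha u v N (S N)) in H.
    assert (E0 : saal_term q alpha u v N (S N) = 0).
    { unfold saal_term. rewrite qpoch_inv_pow_vanish by auto. ring. }
    rewrite E0, IH in H. clear E0 IH.
    generalize dependent (csum (saal_term q alpha u v (S N)) (S (S N))).
    intros L H.
    pose proof (hu N) as huN. pose proof (hv N) as hvN.
    pose proof (qpoch_neq0 _ q N hu) as HU.
    pose proof (qpoch_neq0 _ q N hv) as HV.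
    assert (Hz : forall x y z w : C, x * 0 * y * z * w = 0) by (intros; ring).
    rewrite Hz in H. clear Hz.
    transitivity (/ ((1 - alpha * u * RtoC q ^ N) * (1 - alpha * v * RtoC q ^ N))
      * ((1 - alpha * u * RtoC q ^ N) * (1 - alpha * v * RtoC q ^ N) * L)).
    { field. auto. }
    match type of H with ?x - ?y = ?z =>
      replace x with (y + (x - y)) by ring; rewrite H end.
    cbn [qpoch]. rewrite !Cpow_S. field. repeat split; auto.
Qed.

(** Reversal of (q^-N; q)_k for N = k + m. It trades 1 / (q; q)_m in the double series for (q^-N;
    q)_k / (q; q)_N, the shape that the q-Saalschuetz sum needs. *)
Lemma qtri_reflect (q : R) (k m : nat) :
  (0 < q < 1)%R ->
  RtoC q ^ (m * (m - 1) / 2) * qpoch q q (k + m) * (- (1)) ^ k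
  = qpoch (/ RtoC q ^ (k + m)) q k * RtoC q ^ k
    * RtoC q ^ ((k + m) * ((k + m) - 1) / 2) * qpoch q q m.
Proof.
  intros hq.
  assert (q0 : RtoC q <> 0) by (apply RtoC_neq0; lra).
  induction k as [|k IH]; [simpl; ring|].
  rewrite qpoch_Sl.
  replace (/ RtoC q ^ (S k + m) * RtoC q) with (/ RtoC q ^ (k + m))
    by (simpl; field; split; auto; now apply Cpow_nz).
  change (S k + m)%nat with (S (k + m)).
  rewrite qtri_S. cbn [qpoch].
  replace (RtoC q ^ (m * (m - 1) / 2)
           * (qpoch q q (k + m) * (1 - RtoC q * RtoC q ^ (k + m)))
           * (- (1)) ^ S k)
    with (RtoC q ^ (m * (m - 1) / 2) * qpoch q q (k + m) * (- (1)) ^ k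
          * - (1 - RtoC q * RtoC q ^ (k + m))) by (simpl; ring).
  rewrite IH, !Cpow_S. field. split; auto. now apply Cpow_nz.
Qed.

(** * Double series: rows against diagonals *)

Lemma is_lim_seq_n_geom (rho : R) :
  (0 <= rho < 1)%R -> is_lim_seq (fun n => (INR n * rho ^ n)%R) 0%R.
Proof.
  intros hr. destruct (Req_dec rho 0) as [->|h0].
  - apply is_lim_seq_ext with (fun _ => 0%R); [|apply is_lim_seq_const].
    intros [|n]; simpl; ring.
  - apply (is_lim_seq_incr_1 (fun n => (INR n * rho ^ n)%R)).
    apply ex_series_lim_0.
    apply ex_series_Rabs, ex_series_DAlembert with rho; [lra| |].
    + intros n. apply Rmult_integral_contrapositive_currified.
      * apply not_0_INR. lia.
      * apply pow_nonzero. auto.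
    + apply is_lim_seq_ext with (fun n => (rho + rho * / INR (S n))%R).
      * intros n.
        assert (hn : (0 < INR (S n))%R) by (apply lt_0_INR; lia).
        rewrite (S_INR (S n)).
        replace ((INR (S n) + 1) * rho ^ S (S n) / (INR (S n) * rho ^ S n))%R
          with (rho + rho * / INR (S n))%R.
        -- rewrite Rabs_pos_eq; auto.
           apply Rplus_le_le_0_compat; [lra|]. apply Rmult_le_pos; [lra|].
           left. now apply Rinv_0_lt_compat.
        -- simpl (rho ^ S (S n))%R. simpl (rho ^ S n)%R.
           field. repeat split; auto; [apply pow_nonzero; auto | lra].
      * replace (Finite rho) with (Finite (rho + rho * 0)) by (f_equal; ring).
        apply is_lim_seq_plus'; [apply is_lim_seq_const|].
        apply is_lim_seq_mult'; [apply is_lim_seq_const|].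
        apply (is_lim_seq_incr_1 (fun n => / INR n)%R).
        replace (Finite 0) with (Rbar_inv p_infty) by reflexivity.
        apply is_lim_seq_inv; [apply is_lim_seq_INR | discriminate].
Qed.

Lemma csum_diagonal (F : nat -> nat -> C) (n : nat) :
  csum (fun N => csum (fun k => F k (N - k)%nat) (S N)) n
  = csum (fun k => csum (F k) (n - k)%nat) n.
Proof.
  induction n as [|n IH]; [reflexivity|].
  cbn [csum] in *. rewrite IH.
  replace (S n - n)%nat with 1%nat by lia. rewrite Nat.sub_diag. cbn [csum].
  rewrite (csum_ext (fun k => csum (F k) (S n - k))
             (fun k => csum (F k) (n - k) + F k (n - k)%nat) n).
  - assert (Hp : forall (f g : nat -> C) m,
               csum (fun k => f k + g k) m = csum f m + csum g m).
    { intros f g m. induction m as [|m IHm]; simpl; [ring|rewrite IHm; ring]. }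
    rewrite Hp. ring.
  - intros k Hk. replace (S n - k)%nat with (S (n - k)) by lia. reflexivity.
Qed.

(** The triangle k + m < n cuts from each of its n rows a tail of size at most M rho^n / (1 - rho),
    so the defect against the sum of the first n full rows is O(n rho^n). *)
Lemma Ccv_diagonal (F : nat -> nat -> C) (Rw : nat -> C) (l : C) (M rho : R) :
  (0 <= rho < 1)%R ->
  (forall k m, Cmod (F k m) <= M * rho ^ (k + m))%R ->
  (forall k, Ccv (csum (F k)) (Rw k)) ->
  Ccv (csum Rw) l ->
  Ccv (csum (fun N => csum (fun k => F k (N - k)%nat) (S N))) l.
Proof.
  intros hr HF HR Hl.
  assert (HT : forall k m, (Cmod (csum (F k) m - Rw k)
                              <= M * rho ^ (k + m) / (1 - rho))%R).
  { intros k m. destruct (csum_geom (F k) (M * rho ^ k) rho hr) as [l' [Hl' Hb]].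
    - intros j. rewrite Rmult_assoc, <- pow_add. apply HF.
    - rewrite (Ccv_unique _ _ _ (HR k) Hl'). eapply Rle_trans; [apply Hb|].
      right. rewrite pow_add. field. lra. }
  assert (HD : forall n p, (p <= n)%nat ->
     (Cmod (csum (fun k => (csum (F k) (n - k)%nat - Rw k)%C) p)
        <= INR p * (M * rho ^ n / (1 - rho)))%R).
  { intros n p. induction p as [|p IH]; intros Hp.
    - simpl. rewrite Cmod_0. lra.
    - cbn [csum]. rewrite S_INR.
      eapply Rle_trans; [apply Cmod_triangle|].
      specialize (HT p (n - p)%nat).
      replace (p + (n - p))%nat with n in HT by lia.
      assert (Hp' : (p <= n)%nat) by lia. specialize (IH Hp'). lra. }
  apply Ccv_ext with (fun n => csum (fun k => csum (F k) (n - k)%nat - Rw k) n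
                               + csum Rw n).
  { intros n. rewrite csum_diagonal, csum_minus. ring. }
  replace l with (0 + l) by ring.
  apply Ccv_plus; auto.
  apply Ccv_bound with (fun n => (M / (1 - rho) * (INR n * rho ^ n))%R).
  - intros n.
    replace (csum (fun k => csum (F k) (n - k)%nat - Rw k) n - 0)
      with (csum (fun k => csum (F k) (n - k)%nat - Rw k) n) by ring.
    eapply Rle_trans; [apply HD; lia|]. right. field. lra.
  - replace (Finite 0) with (Rbar_mult (M / (1 - rho))%R 0%R)
      by (simpl; f_equal; ring).
    now apply is_lim_seq_scal_l, is_lim_seq_n_geom.
Qed.

(** Term of the very-well-poised 8phi7 of Watson's transformation in α, X, Y, q/u, q/v, its last
    numerator parameter sent to infinity. *)
Definition watson_term (q : R) (alpha X Y s u v : C) (n : nat) : C :=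
  (1 - alpha * RtoC q ^ (2 * n)) * (qpoch alpha q n / (1 - alpha))
  * (qpoch X q n * qpoch Y q n
     * (/ qpoch (X * s) q n * / qpoch (Y * s) q n))
  * (qpoch (RtoC q / u) q n * qpoch (RtoC q / v) q n
     * (/ qpoch q q n * (/ qpoch (alpha * u) q n * / qpoch (alpha * v) q n)))
  * ((- (alpha * s * u * v / RtoC q)) ^ n * RtoC q ^ (n * (n - 1) / 2)).

(** A row (k fixed) is a limiting 6phi5 series and sums to a multiple of the k-th term of the 3phi2;
    a diagonal k + m = N is a q-Saalschuetz sum and gives [watson_term]. The factor (α; q)_(k+m+k)
    is (α; q)_N (α q^N; q)_k. *)
Definition watson_double (q : R) (alpha X Y s u v : C) (k m : nat) : C :=
  (1 - alpha * RtoC q ^ (2 * (k + m)))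
  * (qpoch alpha q (k + m + k) * / (1 - alpha))
  * (qpoch X q (k + m) * qpoch Y q (k + m)
     * (/ qpoch (X * s) q (k + m) * / qpoch (Y * s) q (k + m)))
  * (qpoch (alpha * u * v / RtoC q) q k
     * (/ qpoch q q k * (/ qpoch (alpha * u) q k * / qpoch (alpha * v) q k)))
  * (s ^ k * ((- s) ^ m * RtoC q ^ (m * (m - 1) / 2)) * / qpoch q q m).

Lemma watson_double_le (q : R) (alpha X Y s u v : C) :
  (0 < q < 1)%R -> (Cmod X <= 1)%R -> (Cmod Y <= 1)%R -> (Cmod s < 1)%R ->
  (forall n, 1 - alpha * u * RtoC q ^ n <> 0) ->
  (forall n, 1 - alpha * v * RtoC q ^ n <> 0) ->
  exists M : R, forall k m,
    (Cmod (watson_double q alpha X Y s u v k m) <= M * Cmod s ^ (k + m))%R.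
Proof.
  intros hq hX hY hs hu hv.
  destruct (qpoch_inv_le q _ hq hu) as [Bu HBu].
  destruct (qpoch_inv_le q _ hq hv) as [Bv HBv].
  set (E := exp (1 / (1 - q))). set (B := exp (/ ((1 - Cmod s) * (1 - q)))).
  set (Bq := exp (/ ((1 - q) * (1 - q)))).
  assert (HBq : forall n, (Cmod (/ qpoch q q n) <= Bq)%R).
  { intros n. apply qpoch_small_inv_le; auto. rewrite Cmod_RtoC_q; lra. }
  exists ((1 + Cmod alpha)
      * (exp (Cmod alpha / (1 - q)) * Cmod (/ (1 - alpha)))
      * (E * E * (B * B))
      * (exp (Cmod (alpha * u * v / RtoC q) / (1 - q)) * (Bq * (Bu * Bv)))
      * Bq)%R.
  intros k m. unfold watson_double.
  match goal with |- (_ <= ?a * ?b * ?c * ?d * ?e * ?f)%R =>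
    replace (a * b * c * d * e * f)%R with (a * b * c * d * (f * e))%R by ring end.
  apply Cmod_mult_le; [apply Cmod_mult_le; [apply Cmod_mult_le;
    [apply Cmod_mult_le|apply Cmod_mult_le]|apply Cmod_mult_le]|apply Cmod_mult_le];
    auto.
  - eapply Rle_trans; [apply Cmod_triangle|]. rewrite Cmod_1, Cmod_opp.
    apply Rplus_le_compat_l. apply Cmod_mult_small with 1%R; try lra.
    now apply Cmod_pow_q_le1.
  - apply Cmod_mult_le; [apply qpoch_le; auto; lra | lra].
  - apply Cmod_mult_le; now apply qpoch_le.
  - apply Cmod_mult_le.
    + apply qpoch_small_inv_le; auto. split; [|lra].
      rewrite Cmult_comm. apply Cmod_mult_small with 1%R; auto; lra.
    + apply qpoch_small_inv_le; auto. split; [|lra].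
      rewrite Cmult_comm. apply Cmod_mult_small with 1%R; auto; lra.
  - apply qpoch_le; auto. lra.
  - apply Cmod_mult_le; [auto | apply Cmod_mult_le; auto].
  - rewrite !Cmod_mult, (Cmod_pow s), (Cmod_pow (- s)), Cmod_opp, pow_add.
    apply Rmult_le_compat_l; [apply pow_le, Cmod_ge_0|].
    pose proof (Cmod_pow_q_le1 q (m * (m - 1) / 2) hq).
    pose proof (Cmod_ge_0 (RtoC q ^ (m * (m - 1) / 2))).
    pose proof (pow_le (Cmod s) m (Cmod_ge_0 s)). nra.
Qed.

(** The parameters α q^(2k), X q^k, Y q^k, s satisfy the same balance, so [jackson_sum] applies. The
    left-over factor (α; q)_(2k) (1 - α q^(2k)) / (1 - α) is (XYs; q)_(2k) and completes the shifted
    infinite product to (XYs; q)_oo. *)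
Lemma watson_row (q : R) (alpha X Y s u v : C) (k : nat) :
  (0 < q < 1)%R -> (Cmod X <= 1)%R -> (Cmod Y <= 1)%R -> (Cmod s < 1)%R ->
  alpha = X * Y * s / RtoC q ->
  (forall n, 1 - alpha * RtoC q ^ n <> 0) ->
  Ccv (csum (watson_double q alpha X Y s u v k))
    (qpoch_inf (X * Y * s) q * qpoch_inf s q
     * (/ qpoch_inf (X * s) q * / qpoch_inf (Y * s) q)
     * (qpoch X q k * qpoch Y q k * qpoch (alpha * u * v / RtoC q) q k
        * (/ qpoch q q k * (/ qpoch (alpha * u) q k * / qpoch (alpha * v) q k))
        * s ^ k)).
Proof.
  intros hq hX hY hs halpha Ha.
  assert (q0 : RtoC q <> 0) by (apply RtoC_neq0; lra).
  pose proof (Cmod_pow_q_le1 q k hq) as hqk.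
  assert (Ha0 : 1 - alpha <> 0).
  { specialize (Ha O). simpl in Ha. now rewrite Cmult_1_r in Ha. }
  set (ak := alpha * RtoC q ^ (k + k)).
  assert (Hak : forall n, 1 - ak * RtoC q ^ n <> 0).
  { intros n. unfold ak. rewrite <- Cmult_assoc, <- Cpow_add_r. apply Ha. }
  assert (Hak0 : 1 - ak <> 0).
  { specialize (Hak O). simpl in Hak. now rewrite Cmult_1_r in Hak. }
  assert (hXs : (Cmod (X * s) < 1)%R).
  { rewrite Cmod_mult. pose proof (Cmod_ge_0 s). pose proof (Cmod_ge_0 X). nra. }
  assert (hYs : (Cmod (Y * s) < 1)%R).
  { rewrite Cmod_mult. pose proof (Cmod_ge_0 s). pose proof (Cmod_ge_0 Y). nra. }
  assert (HJ : Ccv (csum (jackson_term q ak (X * RtoC q ^ k) (Y * RtoC q ^ k) s))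
     (qpoch_inf (X * RtoC q ^ k * (Y * RtoC q ^ k) * s) q * qpoch_inf s q
      * (/ qpoch_inf (X * RtoC q ^ k * s) q
         * / qpoch_inf (Y * RtoC q ^ k * s) q))).
  { apply jackson_sum; auto.
    - apply Cmod_mult_small with 1%R; auto; lra.
    - apply Cmod_mult_small with 1%R; auto; lra.
    - unfold ak. rewrite halpha, Cpow_add_r. field. auto. }
  set (kap := qpoch alpha q (k + k) * (1 - ak) * / (1 - alpha)
       * (qpoch X q k * qpoch Y q k
          * (/ qpoch (X * s) q k * / qpoch (Y * s) q k))
       * (qpoch (alpha * u * v / RtoC q) q k
          * (/ qpoch q q k * (/ qpoch (alpha * u) q k * / qpoch (alpha * v) q k)))
       * s ^ k).
  assert (HE : forall m, watson_double q alpha X Y s u v k m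
     = kap * jackson_term q ak (X * RtoC q ^ k) (Y * RtoC q ^ k) s m).
  { intros m. unfold watson_double, jackson_term, kap.
    replace (k + m + k)%nat with (k + k + m)%nat by lia.
    replace (X * RtoC q ^ k * s) with (X * s * RtoC q ^ k) by ring.
    replace (Y * RtoC q ^ k * s) with (Y * s * RtoC q ^ k) by ring.
    replace (2 * (k + m))%nat with (k + k + 2 * m)%nat by lia.
    rewrite (Cpow_add_r _ (k + k)), (Cmult_assoc alpha). fold ak.
    rewrite !qpoch_add. fold ak.
    assert (HI : forall a : C, (Cmod a < 1)%R ->
       / (qpoch a q k * qpoch (a * RtoC q ^ k) q m)
       = / qpoch a q k * / qpoch (a * RtoC q ^ k) q m).
    { intros a ha. field. split.
      - apply qpoch_neq0. intros n.
        rewrite <- Cmult_assoc, <- Cpow_add_r. now apply qfactor_neq0.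
      - now apply qpoch_small_neq0. }
    rewrite !HI by auto.
    generalize (/ qpoch (X * s) q k) (/ qpoch (Y * s) q k)
      (/ qpoch (X * s * RtoC q ^ k) q m) (/ qpoch (Y * s * RtoC q ^ k) q m)
      (/ qpoch q q k) (/ qpoch (alpha * u) q k) (/ qpoch (alpha * v) q k)
      (/ qpoch q q m).
    intros. field. auto. }
  eapply Ccv_ext; [intros n; symmetry; apply csum_ext; intros m _; apply HE|].
  eapply Ccv_ext; [intros n; symmetry; apply csum_scal|].
  match goal with |- Ccv _ ?l =>
    replace l with (kap * (qpoch_inf (X * RtoC q ^ k * (Y * RtoC q ^ k) * s) q
      * qpoch_inf s q * (/ qpoch_inf (X * RtoC q ^ k * s) q
         * / qpoch_inf (Y * RtoC q ^ k * s) q))) end.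
  { apply Ccv_scal, HJ. }
  unfold kap.
  replace (X * RtoC q ^ k * (Y * RtoC q ^ k) * s)
    with (X * Y * s * RtoC q ^ (k + k)) by (rewrite Cpow_add_r; ring).
  replace (X * RtoC q ^ k * s) with (X * s * RtoC q ^ k) by ring.
  replace (Y * RtoC q ^ k * s) with (Y * s * RtoC q ^ k) by ring.
  rewrite (qpoch_inf_split q (X * Y * s) (k + k) hq).
  rewrite (qpoch_inf_split q (X * s) k hq), (qpoch_inf_split q (Y * s) k hq).
  replace (qpoch alpha q (k + k) * (1 - ak) * / (1 - alpha))
    with (qpoch (X * Y * s) q (k + k)).
  2:{ replace (X * Y * s) with (alpha * RtoC q) by (rewrite halpha; field; auto).
      rewrite qpoch_shift by auto. reflexivity. }
  assert (HI : forall a : C, (Cmod a < 1)%R ->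
     / (qpoch a q k * qpoch_inf (a * RtoC q ^ k) q)
     = / qpoch a q k * / qpoch_inf (a * RtoC q ^ k) q).
  { intros a ha. field. split.
    - apply qpoch_inf_neq0; auto. eapply Rle_lt_trans; [|apply ha].
      apply Cmod_mult_small with 1%R; auto; lra.
    - now apply qpoch_small_neq0. }
  rewrite !HI by auto. ring.
Qed.

Lemma watson_diagonal (q : R) (alpha X Y s u v : C) (N : nat) :
  (0 < q < 1)%R -> u <> 0 -> v <> 0 ->
  (forall n, 1 - alpha * u * RtoC q ^ n <> 0) ->
  (forall n, 1 - alpha * v * RtoC q ^ n <> 0) ->
  csum (fun k => watson_double q alpha X Y s u v k (N - k)) (S N)
  = watson_term q alpha X Y s u v N.
Proof.
  intros hq hu0 hv0 hu hv.
  assert (q0 : RtoC q <> 0) by (apply RtoC_neq0; lra).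
  assert (hqq : forall n, qpoch q q n <> 0).
  { intros n. apply qpoch_small_neq0; auto. rewrite Cmod_RtoC_q; lra. }
  set (kap := (1 - alpha * RtoC q ^ (2 * N)) * (qpoch alpha q N / (1 - alpha))
    * (qpoch X q N * qpoch Y q N
       * (/ qpoch (X * s) q N * / qpoch (Y * s) q N))
    * ((- s) ^ N * RtoC q ^ (N * (N - 1) / 2) * / qpoch q q N)).
  rewrite (csum_ext _ (fun k => kap * saal_term q alpha u v N k)).
  - rewrite csum_scal, saalschutz by auto. unfold kap, watson_term.
    replace (- (alpha * s * u * v / RtoC q))
      with (- s * (alpha * u * v / RtoC q)) by (field; auto).
    rewrite Cpow_mult_l. ring.
  - intros k Hk.
    assert (HN : exists m, N = (k + m)%nat) by (exists (N - k)%nat; lia).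
    destruct HN as [m HN]. unfold kap. clear kap.
    replace (N - k)%nat with m by lia. subst N.
    unfold watson_double, saal_term. rewrite (qpoch_add alpha q (k + m) k).
    pose proof (qtri_reflect q k m hq) as HT.
    assert (HT' : s ^ k * ((- s) ^ m * RtoC q ^ (m * (m - 1) / 2)) * / qpoch q q m
       = (- s) ^ (k + m) * RtoC q ^ ((k + m) * (k + m - 1) / 2)
         * / qpoch q q (k + m) * (qpoch (/ RtoC q ^ (k + m)) q k * RtoC q ^ k)).
    { rewrite Cpow_add_r.
      replace (s ^ k) with ((- s) ^ k * (- (1)) ^ k).
      2:{ rewrite <- Cpow_mult_l. f_equal. ring. }
      transitivity ((- s) ^ k * (- s) ^ m * (/ qpoch q q m * / qpoch q q (k + m))
        * (RtoC q ^ (m * (m - 1) / 2) * qpoch q q (k + m) * (- (1)) ^ k)).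
      - field. auto.
      - rewrite HT. field. auto. }
    rewrite HT'.
    generalize (/ qpoch (X * s) q (k + m)) (/ qpoch (Y * s) q (k + m))
      (/ qpoch q q (k + m)) (/ qpoch q q k) (/ qpoch (alpha * u) q k)
      (/ qpoch (alpha * v) q k). intros. unfold Cdiv. ring.
Qed.

Lemma watson_limit (q : R) (alpha X Y s u v : C) :
  (0 < q < 1)%R -> (Cmod X <= 1)%R -> (Cmod Y <= 1)%R -> (Cmod s < 1)%R ->
  alpha = X * Y * s / RtoC q ->
  (forall n, 1 - alpha * RtoC q ^ n <> 0) -> u <> 0 -> v <> 0 ->
  (forall n, 1 - alpha * u * RtoC q ^ n <> 0) ->
  (forall n, 1 - alpha * v * RtoC q ^ n <> 0) ->
  Ccv (csum (watson_term q alpha X Y s u v))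
    (qpoch_inf (X * Y * s) q * qpoch_inf s q
     * (/ qpoch_inf (X * s) q * / qpoch_inf (Y * s) q)
     * phi32 X Y (alpha * u * v / RtoC q) (alpha * u) (alpha * v) q s).
Proof.
  intros hq hX hY hs halpha Ha hu0 hv0 hu hv.
  destruct (watson_double_le q alpha X Y s u v hq hX hY hs hu hv) as [M HM].
  set (t := fun k : nat =>
    qpoch X q k * qpoch Y q k * qpoch (alpha * u * v / RtoC q) q k
    * (/ qpoch q q k * (/ qpoch (alpha * u) q k * / qpoch (alpha * v) q k))
    * s ^ k).
  assert (hqq : forall n, qpoch q q n <> 0).
  { intros n. apply qpoch_small_neq0; auto. rewrite Cmod_RtoC_q; lra. }
  assert (Ht : exists l, Ccv (csum t) l).
  { destruct (qpoch_inv_le q _ hq hu) as [Bu HBu].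
    destruct (qpoch_inv_le q _ hq hv) as [Bv HBv].
    destruct (csum_geom t
      (exp (1 / (1 - q)) * exp (1 / (1 - q))
       * exp (Cmod (alpha * u * v / RtoC q) / (1 - q))
       * (exp (/ ((1 - q) * (1 - q))) * (Bu * Bv))) (Cmod s)) as [l [Hl _]].
    - split; [apply Cmod_ge_0 | auto].
    - intros j. unfold t. rewrite <- Cmod_pow.
      apply Cmod_mult_le; [|lra].
      apply Cmod_mult_le; [apply Cmod_mult_le; [apply Cmod_mult_le|]|
        apply Cmod_mult_le; [|apply Cmod_mult_le]]; auto;
        try (apply qpoch_le; auto; lra).
      apply qpoch_small_inv_le; auto. rewrite Cmod_RtoC_q; lra.
    - now exists l. }
  destruct Ht as [l Hl].
  assert (Hphi : phi32 X Y (alpha * u * v / RtoC q) (alpha * u) (alpha * v) q s = l).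
  { apply CSeries_Ccv. eapply Ccv_ext; [|apply Hl].
    intros n. apply csum_ext. intros k _. unfold t. cbn [qpochs fold_right].
    pose proof (qpoch_neq0 _ q k hu). pose proof (qpoch_neq0 _ q k hv).
    field. repeat split; auto. }
  rewrite Hphi.
  eapply Ccv_ext.
  { intros n. apply csum_ext. intros N _. now apply watson_diagonal. }
  eapply Ccv_diagonal with (rho := Cmod s).
  - split; [apply Cmod_ge_0 | auto].
  - apply HM.
  - intros k. now apply watson_row.
  - eapply Ccv_ext; [intros n; symmetry; apply csum_scal|].
    now apply Ccv_scal.
Qed.

(** * Integrals over the unit circle *)

Definition cint (f : R -> C) (l : C) : Prop :=
  is_RInt (V := C_R_NormedModule) f (- PI) PI l.

Lemma cint_ext (f g : R -> C) (l : C) :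
  (forall t, f t = g t) -> cint f l -> cint g l.
Proof. intros H. apply is_RInt_ext. intros t _. apply H. Qed.

Lemma cint_unique (f : R -> C) (l l' : C) : cint f l -> cint f l' -> l = l'.
Proof.
  intros H H'.
  rewrite <- (is_RInt_unique (V := C_R_CompleteNormedModule) f _ _ l H).
  now apply (is_RInt_unique (V := C_R_CompleteNormedModule)).
Qed.

Lemma cint_plus (f g : R -> C) (l m : C) :
  cint f l -> cint g m -> cint (fun t => f t + g t) (l + m).
Proof. intros. now apply (is_RInt_plus (V := C_R_NormedModule)). Qed.

(** The module [C_R_NormedModule] has real scalars, so a complex factor is treated through real and
    imaginary parts. *)
Lemma is_RInt_Cscal (f : R -> C) (x y : R) (k l : C) :
  is_RInt (V := C_R_NormedModule) f x y l ->
  is_RInt (V := C_R_NormedModule) (fun t => k * f t) x y (k * l).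
Proof.
  intros H.
  pose proof (is_RInt_fct_extend_fst (U := R_NormedModule) (V := R_NormedModule)
                f x y l H) as H1.
  pose proof (is_RInt_fct_extend_snd (U := R_NormedModule) (V := R_NormedModule)
                f x y l H) as H2.
  destruct k as [k1 k2], l as [l1 l2].
  apply (is_RInt_fct_extend_pair (U := R_NormedModule) (V := R_NormedModule)).
  - apply (is_RInt_minus (V := R_NormedModule)
             (fun t => k1 * fst (f t))%R (fun t => k2 * snd (f t))%R);
      now apply (is_RInt_scal (V := R_NormedModule)).
  - apply (is_RInt_plus (V := R_NormedModule)
             (fun t => k1 * snd (f t))%R (fun t => k2 * fst (f t))%R);
      now apply (is_RInt_scal (V := R_NormedModule)).
Qed.

Lemma cint_scal (f : R -> C) (k l : C) :
  cint f l -> cint (fun t => k * f t) (k * l).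
Proof. apply is_RInt_Cscal. Qed.

Lemma is_RInt_opp_var_R (f : R -> R) (x y l : R) :
  is_RInt f x y l -> is_RInt (fun t => f (- t)%R) (- y) (- x) l.
Proof.
  intros H. apply is_RInt_swap in H.
  rewrite <- (Ropp_involutive x), <- (Ropp_involutive y) in H.
  apply is_RInt_comp_opp, is_RInt_opp in H.
  replace l with (opp (opp l)) by apply Ropp_involutive.
  eapply is_RInt_ext; [|apply H].
  intros t _. apply Ropp_involutive.
Qed.

Lemma is_RInt_opp_var (f : R -> C) (x y : R) (l : C) :
  is_RInt (V := C_R_NormedModule) f x y l ->
  is_RInt (V := C_R_NormedModule) (fun t => f (- t)%R) (- y) (- x) l.
Proof.
  intros H.
  pose proof (is_RInt_fct_extend_fst (U := R_NormedModule) (V := R_NormedModule)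
                f x y l H) as H1.
  pose proof (is_RInt_fct_extend_snd (U := R_NormedModule) (V := R_NormedModule)
                f x y l H) as H2.
  destruct l as [l1 l2].
  apply (is_RInt_fct_extend_pair (U := R_NormedModule) (V := R_NormedModule)).
  - apply (is_RInt_opp_var_R (fun t => fst (f t)) x y l1 H1).
  - apply (is_RInt_opp_var_R (fun t => snd (f t)) x y l2 H2).
Qed.

Lemma cint_opp_var (f : R -> C) (l : C) :
  cint f l -> cint (fun t => f (- t)%R) l.
Proof.
  intros H. apply is_RInt_opp_var in H. now rewrite Ropp_involutive in H.
Qed.

Lemma cint_half (f : R -> C) (l : C) :
  (forall t, f (- t)%R = f t) -> cint f l ->
  is_RInt (V := C_R_NormedModule) f 0%R PI (/ 2 * l).
Proof.
  intros Hev H. pose proof PI_RGT_0 as Hpi.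
  assert (Hex : exists m : C, is_RInt (V := C_R_NormedModule) f 0%R PI m).
  { apply (ex_RInt_Chasles_2 (V := C_R_CompleteNormedModule) f (- PI)).
    - lra.
    - now exists l. }
  destruct Hex as [m Hm].
  assert (Hm' : is_RInt (V := C_R_NormedModule) f (- PI) 0%R m).
  { apply is_RInt_opp_var in Hm. rewrite Ropp_0 in Hm.
    eapply is_RInt_ext; [|apply Hm]. intros t _. apply Hev. }
  pose proof (is_RInt_Chasles (V := C_R_NormedModule) f _ _ _ _ _ Hm' Hm) as Hc.
  assert (E : l = m + m) by (now apply (cint_unique f)).
  replace (/ 2 * l) with m; auto. rewrite E. now field.
Qed.

(** A geometric rate independent of t is uniform convergence, which carries both integrability and
    the values to the limit. *)
Lemma cint_limit (fn : nat -> R -> C) (f : R -> C) (In : nat -> C) (M rho : R) :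
  (0 <= rho < 1)%R -> (forall n, cint (fn n) (In n)) ->
  (forall n t, Cmod (fn n t - f t) <= M * rho ^ n)%R ->
  exists l, Ccv In l /\ cint f l.
Proof.
  intros hr HI HM.
  destruct (filterlim_RInt (V := C_R_CompleteNormedModule) fn (- PI) PI
              eventually _ f In HI) as [l [Hl Hf]].
  - apply filterlim_locally. intros eps.
    pose proof (is_lim_seq_geom0 M rho hr) as H0.
    apply is_lim_seq_spec in H0. destruct (H0 eps) as [N HN].
    exists N. intros n hn t.
    apply (C_NormedModule_mixin_compat1 (f t) (fn n t) eps).
    specialize (HN n hn). rewrite Rminus_0_r in HN.
    eapply Rle_lt_trans; [apply HM|]. eapply Rle_lt_trans; [apply Rle_abs|].
    apply HN.
  - exists l. split; auto.
    apply is_lim_seq_spec. intros eps.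
    (* Passing from [ball] to [Cmod] costs a factor sqrt 2, which is below 2; eps / 4 leaves room
       for it. *)
    assert (he : (0 < eps / 4)%R) by (destruct eps; simpl; lra).
    destruct (proj1 (filterlim_locally In l) Hl (mkposreal _ he)) as [N HN].
    exists N. intros n hn. specialize (HN n hn).
    pose proof (C_NormedModule_mixin_compat2 l (In n) (mkposreal _ he) HN) as H.
    rewrite Rminus_0_r, Rabs_pos_eq by apply Cmod_ge_0.
    change (minus (In n) l) with (In n - l) in H. simpl in H.
    pose proof (sqrt_sqrt 2 ltac:(lra)) as Hs2.
    pose proof (sqrt_pos 2).
    assert (sqrt 2 < 2)%R by nra. destruct eps as [eps hep]; simpl in *. nra.
Qed.

(** * Exponentials and their means *)

Lemma Cexpi_add (s t : R) : Cexpi (s + t) = Cexpi s * Cexpi t.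
Proof.
  unfold Cexpi, Cmult; simpl. rewrite cos_plus, sin_plus. f_equal; ring.
Qed.

Lemma Cexpi_0 : Cexpi 0 = 1.
Proof. unfold Cexpi. now rewrite cos_0, sin_0. Qed.

Lemma Cexpi_opp_mult (t : R) : Cexpi t * Cexpi (- t) = 1.
Proof. rewrite <- Cexpi_add, Rplus_opp_r. apply Cexpi_0. Qed.

Lemma Cmod_Cexpi (t : R) : Cmod (Cexpi t) = 1%R.
Proof.
  unfold Cmod, Cexpi; simpl. transitivity (sqrt 1); [f_equal | apply sqrt_1].
  pose proof (sin2_cos2 t) as H. unfold Rsqr in H. lra.
Qed.

Lemma Cexpi_neq0 (t : R) : Cexpi t <> 0.
Proof. apply Cmod_gt_0. rewrite Cmod_Cexpi. lra. Qed.

Lemma Cexpi_opp (t : R) : Cexpi (- t) = / Cexpi t.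
Proof.
  pose proof (Cexpi_neq0 t).
  transitivity (/ Cexpi t * (Cexpi t * Cexpi (- t))); [field; auto|].
  rewrite Cexpi_opp_mult. ring.
Qed.

Lemma Cexpi_INR (n : nat) (t : R) : Cexpi (INR n * t) = Cexpi t ^ n.
Proof.
  induction n as [|n IH].
  - simpl. rewrite Rmult_0_l. apply Cexpi_0.
  - rewrite S_INR, Cpow_S, <- IH, <- Cexpi_add. f_equal. ring.
Qed.

Lemma cint_const (k : C) : cint (fun _ => k) (2 * RtoC PI * k).
Proof.
  unfold cint.
  pose proof (is_RInt_const (V := C_R_NormedModule) (- PI) PI k) as H.
  replace (2 * RtoC PI * k) with (scal (V := C_R_NormedModule) (PI - - PI)%R k);
    auto.
  destruct k as [x y]. unfold scal; simpl. unfold prod_scal; simpl.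
  unfold scal; simpl. unfold mult; simpl. unfold Cmult, RtoC; simpl.
  f_equal; ring.
Qed.

Lemma cint_Cexpi (m : R) :
  m <> 0%R -> sin (m * PI) = 0%R -> cint (fun t => Cexpi (m * t)) 0.
Proof.
  intros hm hs.
  apply (is_RInt_fct_extend_pair (U := R_NormedModule) (V := R_NormedModule)).
  - simpl.
    replace 0%R with (minus (sin (m * PI) / m) (sin (m * (- PI)) / m))%R.
    + apply (is_RInt_derive (V := R_CompleteNormedModule)
               (fun t => sin (m * t) / m)%R).
      * intros t _. auto_derive; auto. field. auto.
      * intros t _. apply continuity_pt_filterlim. apply derivable_continuous_pt.
        exists (- (m * sin (m * t)))%R. apply is_derive_Reals.
        auto_derive; auto. ring.
    + unfold minus, plus, opp; simpl.
      replace (m * - PI)%R with (- (m * PI))%R by ring.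
      rewrite sin_neg, hs. field. auto.
  - simpl.
    replace 0%R with (minus (- cos (m * PI) / m) (- cos (m * (- PI)) / m))%R.
    + apply (is_RInt_derive (V := R_CompleteNormedModule)
               (fun t => - cos (m * t) / m)%R).
      * intros t _. auto_derive; auto. field. auto.
      * intros t _. apply continuity_pt_filterlim. apply derivable_continuous_pt.
        exists (m * cos (m * t))%R. apply is_derive_Reals.
        auto_derive; auto. ring.
    + unfold minus, plus, opp; simpl.
      replace (m * - PI)%R with (- (m * PI))%R by ring.
      rewrite cos_neg. field. auto.
Qed.

Lemma sin_INR_PI (n : nat) : sin (INR n * PI) = 0%R.
Proof.
  induction n as [|n IH].
  - simpl. rewrite Rmult_0_l. apply sin_0.
  - rewrite S_INR, Rmult_plus_distr_r, Rmult_1_l, neg_sin, IH. ring.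
Qed.

Lemma cint_pow (n : nat) : cint (fun t => Cexpi t ^ S n) 0.
Proof.
  apply cint_ext with (fun t => Cexpi (INR (S n) * t)).
  - intros t. apply Cexpi_INR.
  - apply cint_Cexpi; [apply not_0_INR; lia | apply sin_INR_PI].
Qed.

Lemma cint_inv_pow (n : nat) : cint (fun t => (/ Cexpi t) ^ S n) 0.
Proof.
  apply cint_ext with (fun t => Cexpi (- t) ^ S n).
  - intros t. now rewrite Cexpi_opp.
  - apply (cint_opp_var (fun t => Cexpi t ^ S n)), cint_pow.
Qed.

(* Uniform limits, on the two circles of radius 1 and rho, of Laurent
   polynomials: the functions for which the mean over both circles agrees
   without appealing to Cauchy's theorem. *)
Inductive laurent (rho : R) : (C -> C) -> Prop :=
| laurent_pos (k : C) (n : nat) : laurent rho (fun z => k * z ^ n)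
| laurent_neg (k : C) (n : nat) : laurent rho (fun z => k * (/ z) ^ n)
| laurent_plus (F G : C -> C) :
    laurent rho F -> laurent rho G -> laurent rho (fun z => F z + G z)
| laurent_lim (Fn : nat -> C -> C) (F : C -> C) (M e : R) :
    (0 <= e < 1)%R -> (forall n, laurent rho (Fn n)) ->
    (forall n z, Cmod z = 1%R \/ Cmod z = rho ->
       Cmod (Fn n z - F z) <= M * e ^ n)%R ->
    laurent rho F.

Lemma circle_neq0 (rho : R) (z : C) :
  (0 < rho)%R -> Cmod z = 1%R \/ Cmod z = rho -> z <> 0.
Proof. intros hr hz. apply Cmod_gt_0. destruct hz as [-> | ->]; lra. Qed.

(** Agreement on the two circles is enough, because the limit constructor looks at nothing else: the
    constant sequence F converges to G with error 0. *)
Lemma laurent_ext (rho : R) (F G : C -> C) :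
  (forall z, Cmod z = 1%R \/ Cmod z = rho -> F z = G z) ->
  laurent rho F -> laurent rho G.
Proof.
  intros H HF. apply laurent_lim with (fun _ => F) 0%R 0%R; [lra|auto|].
  intros n z hz. rewrite (H z hz).
  replace (G z - G z) with (RtoC 0) by ring. rewrite Cmod_0. lra.
Qed.

Lemma laurent_bounded (rho : R) (F : C -> C) :
  (0 < rho)%R -> laurent rho F ->
  exists B : R, forall z, Cmod z = 1%R \/ Cmod z = rho -> (Cmod (F z) <= B)%R.
Proof.
  intros hr HF.
  induction HF as [k n|k n|F G _ [B1 H1] _ [B2 H2]|Fn F M e he _ IH HM].
  - exists (Cmod k * (1 + rho ^ n))%R. intros z hz.
    rewrite Cmod_mult, Cmod_pow. apply Rmult_le_compat_l; [apply Cmod_ge_0|].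
    pose proof (pow_lt rho n hr).
    destruct hz as [-> | ->]; rewrite ?pow1; lra.
  - exists (Cmod k * (1 + (/ rho) ^ n))%R. intros z hz.
    rewrite Cmod_mult, Cmod_pow, Cmod_inv by (eapply circle_neq0; eauto).
    apply Rmult_le_compat_l; [apply Cmod_ge_0|].
    pose proof (pow_lt (/ rho) n (Rinv_0_lt_compat _ hr)).
    destruct hz as [-> | ->]; rewrite ?Rinv_1, ?pow1; lra.
  - exists (B1 + B2)%R. intros z hz. eapply Rle_trans; [apply Cmod_triangle|].
    apply Rplus_le_compat; auto.
  - destruct (IH O) as [B HB]. exists (B + M)%R. intros z hz.
    replace (F z) with (Fn O z + - (Fn O z - F z)) by ring.
    eapply Rle_trans; [apply Cmod_triangle|]. rewrite Cmod_opp.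
    specialize (HB z hz). specialize (HM O z hz). simpl in HM. lra.
Qed.

Lemma laurent_scal (rho : R) (k : C) (F : C -> C) :
  laurent rho F -> laurent rho (fun z => k * F z).
Proof.
  intros HF. induction HF as [k' n|k' n|F G _ H1 _ H2|Fn F M e he _ IH HM].
  - apply laurent_ext with (fun z => (k * k') * z ^ n); [intros; ring|].
    apply laurent_pos.
  - apply laurent_ext with (fun z => (k * k') * (/ z) ^ n); [intros; ring|].
    apply laurent_neg.
  - apply laurent_ext with (fun z => k * F z + k * G z); [intros; ring|].
    now apply laurent_plus.
  - apply laurent_lim with (fun n z => k * Fn n z) (Cmod k * M)%R e; auto.
    intros n z hz. replace (k * Fn n z - k * F z) with (k * (Fn n z - F z)) by ring.
    rewrite Cmod_mult, Rmult_assoc.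
    apply Rmult_le_compat_l; [apply Cmod_ge_0 | auto].
Qed.

Lemma laurent_shift (rho : R) (F : C -> C) :
  (0 < rho)%R -> laurent rho F ->
  laurent rho (fun z => z * F z) /\ laurent rho (fun z => / z * F z).
Proof.
  intros hr HF.
  induction HF as [k n|k n|F G _ [H1 H1'] _ [H2 H2']|Fn F M e he _ IH HM].
  - split.
    + apply laurent_ext with (fun z => k * z ^ S n); [|apply laurent_pos].
      intros z _. simpl. ring.
    + destruct n as [|n].
      * apply laurent_ext with (fun z => k * (/ z) ^ 1); [|apply laurent_neg].
        intros z _. simpl. ring.
      * apply laurent_ext with (fun z => k * z ^ n); [|apply laurent_pos].
        intros z hz. simpl. field. eapply circle_neq0; eauto.
  - split.
    + destruct n as [|n].
      * apply laurent_ext with (fun z => k * z ^ 1); [|apply laurent_pos].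
        intros z _. simpl. ring.
      * apply laurent_ext with (fun z => k * (/ z) ^ n); [|apply laurent_neg].
        intros z hz. simpl. generalize ((/ z) ^ n). intros w. field.
        eapply circle_neq0; eauto.
    + apply laurent_ext with (fun z => k * (/ z) ^ S n); [|apply laurent_neg].
      intros z _. simpl. ring.
  - split.
    + apply laurent_ext with (fun z => z * F z + z * G z); [intros; ring|].
      now apply laurent_plus.
    + apply laurent_ext with (fun z => / z * F z + / z * G z); [intros; ring|].
      now apply laurent_plus.
  - split.
    + apply laurent_lim with (fun n z => z * Fn n z) ((1 + rho) * M)%R e; auto.
      { intros n. apply IH. }
      intros n z hz. replace (z * Fn n z - z * F z) with (z * (Fn n z - F z)) by ring.
      rewrite Rmult_assoc. apply Cmod_mult_le; auto. destruct hz as [-> | ->]; lra.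
    + apply laurent_lim with (fun n z => / z * Fn n z) ((1 + / rho) * M)%R e; auto.
      { intros n. apply IH. }
      intros n z hz.
      replace (/ z * Fn n z - / z * F z) with (/ z * (Fn n z - F z)) by ring.
      rewrite Rmult_assoc. apply Cmod_mult_le; auto.
      rewrite Cmod_inv by (eapply circle_neq0; eauto).
      pose proof (Rinv_0_lt_compat _ hr).
      destruct hz as [-> | ->]; rewrite ?Rinv_1; lra.
Qed.

(** Induction on the first factor alone: a monomial acts by repeated [laurent_shift], and the limit
    case uses that G is bounded on both circles. *)
Lemma laurent_mult (rho : R) (F G : C -> C) :
  (0 < rho)%R -> laurent rho F -> laurent rho G ->
  laurent rho (fun z => F z * G z).
Proof.
  intros hr HF HG.
  induction HF as [k n|k n|F1 F2 _ H1 _ H2|Fn F M e he _ IH HM].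
  - apply laurent_ext with (fun z => k * (z ^ n * G z)); [intros; ring|].
    apply laurent_scal. induction n as [|n IHn].
    + apply laurent_ext with G; auto. intros z _. simpl. ring.
    + apply laurent_ext with (fun z => z * (z ^ n * G z)).
      * intros z _. simpl. ring.
      * now apply laurent_shift.
  - apply laurent_ext with (fun z => k * ((/ z) ^ n * G z)); [intros; ring|].
    apply laurent_scal. induction n as [|n IHn].
    + apply laurent_ext with G; auto. intros z _. simpl. ring.
    + apply laurent_ext with (fun z => / z * ((/ z) ^ n * G z)).
      * intros z _. simpl. ring.
      * now apply laurent_shift.
  - apply laurent_ext with (fun z => F1 z * G z + F2 z * G z); [intros; ring|].
    now apply laurent_plus.
  - destruct (laurent_bounded rho G hr HG) as [B HB].
    apply laurent_lim with (fun n z => Fn n z * G z) (M * B)%R e; auto.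
    intros n z hz.
    replace (Fn n z * G z - F z * G z) with ((Fn n z - F z) * G z) by ring.
    replace (M * B * e ^ n)%R with (M * e ^ n * B)%R by ring.
    apply Cmod_mult_le; auto.
Qed.

Lemma laurent_const (rho : R) (k : C) : laurent rho (fun _ => k).
Proof.
  apply laurent_ext with (fun z => k * z ^ 0); [|apply laurent_pos].
  intros z _. simpl. ring.
Qed.

Lemma laurent_scal_id (rho : R) (k : C) : laurent rho (fun z => k * z).
Proof.
  apply laurent_ext with (fun z => k * z ^ 1); [|apply laurent_pos].
  intros z _. simpl. ring.
Qed.

Lemma laurent_scal_inv (rho : R) (k : C) : laurent rho (fun z => k * / z).
Proof.
  apply laurent_ext with (fun z => k * (/ z) ^ 1); [|apply laurent_neg].
  intros z _. simpl. ring.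
Qed.

Lemma laurent_1minus (rho : R) (F : C -> C) :
  laurent rho F -> laurent rho (fun z => 1 - F z).
Proof.
  intros H. apply laurent_ext with (fun z => 1 + - (1) * F z).
  - intros z _. ring.
  - apply laurent_plus; [apply laurent_const | now apply laurent_scal].
Qed.

(** Partial sums of the geometric series in F converge at rate e^n, uniformly on both circles. *)
Lemma laurent_geom (rho e : R) (F : C -> C) :
  (0 < rho)%R -> (0 <= e < 1)%R -> laurent rho F ->
  (forall z, Cmod z = 1%R \/ Cmod z = rho -> Cmod (F z) <= e)%R ->
  laurent rho (fun z => / (1 - F z)).
Proof.
  intros hr he HF Hb.
  assert (Hpow : forall n, laurent rho (fun z => F z ^ n)).
  { induction n as [|n IH];
      [apply (laurent_const rho 1) | now apply laurent_mult]. }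
  apply laurent_lim with (fun n z => csum (fun k => F z ^ k) n) (/ (1 - e))%R e;
    auto.
  - induction n as [|n IH];
      [apply (laurent_const rho 0) | now apply laurent_plus].
  - intros n z hz. specialize (Hb z hz).
    assert (H1 : 1 - F z <> 0) by (apply one_minus_neq0; lra).
    replace (csum (fun k => F z ^ k) n - / (1 - F z))
      with (- (F z ^ n * / (1 - F z))).
    + rewrite Cmod_opp, Rmult_comm. apply Cmod_mult_le.
      * rewrite Cmod_pow. apply pow_incr. split; [apply Cmod_ge_0 | auto].
      * apply Cmod_inv_le; [lra|].
        pose proof (Cmod_triangle (1 - F z) (F z)) as HT.
        replace (1 - F z + F z) with (RtoC 1) in HT by ring.
        rewrite Cmod_1 in HT. lra.
    + assert (Hs : csum (fun k => F z ^ k) n * (1 - F z) = 1 - F z ^ n).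
      { induction n as [|n IH]; simpl; [ring|].
        replace ((csum (fun k => F z ^ k) n + F z ^ n) * (1 - F z))
          with (csum (fun k => F z ^ k) n * (1 - F z) + F z ^ n * (1 - F z))
          by ring. rewrite IH. ring. }
      replace (csum (fun k => F z ^ k) n)
        with (csum (fun k => F z ^ k) n * (1 - F z) * / (1 - F z))
        by (field; auto).
      rewrite Hs. field. auto.
Qed.

Lemma laurent_qpoch_inf (rho q : R) (F : C -> C) :
  (0 < rho)%R -> (0 < q < 1)%R -> laurent rho F ->
  laurent rho (fun z => qpoch_inf (F z) q).
Proof.
  intros hr hq HF.
  destruct (laurent_bounded rho F hr HF) as [B HB].
  apply laurent_lim
    with (fun n z => qpoch (F z) q n) (exp (B / (1 - q)) * B / (1 - q))%R q.
  - lra.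
  - induction n as [|n IH]; simpl; [apply laurent_const|].
    apply laurent_mult; auto. apply laurent_1minus.
    apply laurent_mult; auto. apply laurent_const.
  - intros n z hz. now apply qpoch_rate; auto.
Qed.

Lemma laurent_inv_qpoch_inf (rho q e : R) (F : C -> C) :
  (0 < rho)%R -> (0 < q < 1)%R -> (0 <= e < 1)%R -> laurent rho F ->
  (forall z, Cmod z = 1%R \/ Cmod z = rho -> Cmod (F z) <= e)%R ->
  laurent rho (fun z => / qpoch_inf (F z) q).
Proof.
  intros hr hq he HF HB.
  set (E := exp (/ ((1 - e) * (1 - q)))).
  apply laurent_lim with (fun n z => / qpoch (F z) q n)
    (exp (e / (1 - q)) * e / (1 - q) * (E * E))%R q.
  - lra.
  - induction n as [|n IH].
    + apply (laurent_const rho (/ 1)).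
    + apply laurent_ext
        with (fun z => / qpoch (F z) q n * / (1 - F z * RtoC q ^ n)).
      * intros z hz. cbn [qpoch]. specialize (HB z hz).
        field. split; [apply qfactor_neq0 | apply qpoch_small_neq0]; auto; lra.
      * apply laurent_mult; auto. apply laurent_geom with e; auto.
        -- apply laurent_mult; auto. apply laurent_const.
        -- intros z hz. apply Cmod_mult_small with 1%R; auto; [|lra].
           now apply Cmod_pow_q_le1.
  - intros n z hz. specialize (HB z hz).
    assert (H1 : qpoch (F z) q n <> 0) by (apply qpoch_small_neq0; auto; lra).
    assert (H2 : qpoch_inf (F z) q <> 0) by (apply qpoch_inf_neq0; auto; lra).
    replace (/ qpoch (F z) q n - / qpoch_inf (F z) q)
      with (- ((qpoch (F z) q n - qpoch_inf (F z) q)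
               * (/ qpoch (F z) q n * / qpoch_inf (F z) q))) by (field; auto).
    rewrite Cmod_opp.
    replace (exp (e / (1 - q)) * e / (1 - q) * (E * E) * q ^ n)%R
      with ((exp (e / (1 - q)) * e / (1 - q) * q ^ n) * (E * E))%R by ring.
    apply Cmod_mult_le; [now apply qpoch_rate|].
    apply Cmod_mult_le; [apply qpoch_small_inv_le | apply qpoch_inf_inv_le];
      auto; lra.
Qed.

Lemma cint_limit_ex (fn : nat -> R -> C) (f : R -> C) (M e : R) :
  (0 <= e < 1)%R -> (forall n, exists l, cint (fn n) l) ->
  (forall n t, Cmod (fn n t - f t) <= M * e ^ n)%R ->
  exists In l, (forall n, cint (fn n) (In n)) /\ Ccv In l /\ cint f l.
Proof.
  intros he HI HM.
  set (In := fun n =>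
    RInt (V := C_R_CompleteNormedModule) (fn n) (- PI) PI : C).
  assert (HIn : forall n, cint (fn n) (In n)).
  { intros n. destruct (HI n) as [l Hl]. unfold In.
    now rewrite (is_RInt_unique (V := C_R_CompleteNormedModule) _ _ _ l Hl). }
  destruct (cint_limit fn f In M e he HIn HM) as [l [Hl Hf]].
  now exists In, l.
Qed.

(** Nonconstant monomials have mean zero on every circle about 0, constants have the same mean on
    both, and sums preserve equality of means. In the limit case the two sequences of integrals
    coincide term by term, hence so do their limits. *)
Lemma laurent_means (rho : R) (F : C -> C) :
  (0 < rho)%R -> laurent rho F ->
  exists l, cint (fun t => F (Cexpi t)) l
            /\ cint (fun t => F (RtoC rho * Cexpi t)) l.
Proof.
  intros hr HF.
  assert (H1 : forall t, Cmod (Cexpi t) = 1%R \/ Cmod (Cexpi t) = rho).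
  { intros t. left. apply Cmod_Cexpi. }
  assert (H2 : forall t, Cmod (RtoC rho * Cexpi t) = 1%R
                         \/ Cmod (RtoC rho * Cexpi t) = rho).
  { intros t. right. rewrite Cmod_mult, Cmod_Cexpi, Cmod_R, Rabs_pos_eq; lra. }
  assert (r0 : RtoC rho <> 0) by (apply RtoC_neq0; lra).
  induction HF as [k n|k n|F G _ [l [Hl Hl']] _ [m [Hm Hm']]|Fn F M e he _ IH HM].
  - destruct n as [|n].
    + exists (2 * RtoC PI * (k * 1)). split; apply cint_const.
    + exists 0. split.
      * replace (RtoC 0) with (k * 0) by ring. apply cint_scal, cint_pow.
      * apply cint_ext with (fun t => k * RtoC rho ^ S n * Cexpi t ^ S n).
        { intros t. rewrite Cpow_mult_l. ring. }
        replace (RtoC 0) with (k * RtoC rho ^ S n * 0) by ring.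
        apply cint_scal, cint_pow.
  - destruct n as [|n].
    + exists (2 * RtoC PI * (k * 1)). split; apply cint_const.
    + exists 0. split.
      * replace (RtoC 0) with (k * 0) by ring. apply cint_scal, cint_inv_pow.
      * apply cint_ext
          with (fun t => k * (/ RtoC rho) ^ S n * (/ Cexpi t) ^ S n).
        { intros t. rewrite <- Cmult_assoc, <- Cpow_mult_l. f_equal. f_equal.
          field. split; auto. apply Cexpi_neq0. }
        replace (RtoC 0) with (k * (/ RtoC rho) ^ S n * 0) by ring.
        apply cint_scal, cint_inv_pow.
  - exists (l + m). split; now apply cint_plus.
  - destruct (cint_limit_ex (fun n t => Fn n (Cexpi t))
                (fun t => F (Cexpi t)) M e he) as [I1 [l1 [A1 [B1 C1]]]].
    { intros n. destruct (IH n) as [l [Hl _]]. now exists l. }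
    { intros n t. now apply HM. }
    destruct (cint_limit_ex (fun n t => Fn n (RtoC rho * Cexpi t))
                (fun t => F (RtoC rho * Cexpi t)) M e he)
      as [I2 [l2 [A2 [B2 C2]]]].
    { intros n. destruct (IH n) as [l [_ Hl]]. now exists l. }
    { intros n t. now apply HM. }
    exists l1. split; auto.
    replace l1 with l2; auto. apply Ccv_unique with I2; auto.
    eapply Ccv_ext; [|apply B1]. intros n. destruct (IH n) as [l [Hl Hl']].
    rewrite (cint_unique _ _ _ (A1 n) Hl). symmetry.
    apply (cint_unique _ _ _ (A2 n) Hl').
Qed.

(** * Rahman's integral *)

Definition inv_pair (q : R) (a z : C) : C :=
  / qpoch_inf (a * z) q * / qpoch_inf (a * / z) q.

Definition rahman_weight (q : R) (m a b c d r z : C) : C :=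
  qpoch_inf (z * z) q * qpoch_inf (/ z * / z) q
  * (qpoch_inf (m * z) q * qpoch_inf (m * / z) q)
  * (inv_pair q a z * inv_pair q b z * inv_pair q c z
     * inv_pair q d z * inv_pair q r z).

(** Common factor on |z| = 1 of the weights at (m; a) and (mq; aq) and of [antishift]: each of them
    is this function times a Laurent polynomial in z. *)
Definition rahman_core (q : R) (m a b c d r z : C) : C :=
  qpoch_inf (z * z * RtoC q) q * qpoch_inf (/ z * / z * RtoC q) q
  * (qpoch_inf (m * z * RtoC q) q * qpoch_inf (m * / z * RtoC q) q)
  * (inv_pair q a z * inv_pair q b z * inv_pair q c z
     * inv_pair q d z * inv_pair q r z).

(** Both arguments, a z and a q / z, have modulus at most |a| for q <= |z| <= 1, so no pole lies
    between the two circles; the exchange of q z and 1/z swaps them. *)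
Definition inv_pair_shifted (q : R) (a z : C) : C :=
  / qpoch_inf (a * z) q * / qpoch_inf (a * RtoC q * / z) q.

(* On |z| = 1 this function satisfies F (q z) = - F (1/z), which makes its
   integral vanish. *)
Definition antishift (q : R) (m a b c d r z : C) : C :=
  (z - RtoC q * / z) * (1 - m * z) * (1 - m * RtoC q * / z)
  * (qpoch_inf (z * z) q * qpoch_inf (RtoC q * RtoC q * (/ z * / z)) q
     * (qpoch_inf (m * RtoC q * z) q
        * qpoch_inf (m * RtoC q * RtoC q * / z) q))
  * (inv_pair_shifted q a z * inv_pair_shifted q b z * inv_pair_shifted q c z
     * inv_pair_shifted q d z * inv_pair_shifted q r z).

Lemma inv_pair_inv (q : R) (a z : C) :
  z <> 0 -> inv_pair q a (/ z) = inv_pair q a z.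
Proof.
  intros hz. unfold inv_pair. replace (/ / z) with z by (field; auto).
  apply Cmult_comm.
Qed.

Lemma rahman_core_inv (q : R) (m a b c d r z : C) :
  z <> 0 -> rahman_core q m a b c d r (/ z) = rahman_core q m a b c d r z.
Proof.
  intros hz. unfold rahman_core. rewrite !inv_pair_inv by auto.
  replace (/ / z) with z by (field; auto). ring.
Qed.

Lemma inv_pair_shifted_q (q : R) (a z : C) :
  (0 < q < 1)%R -> z <> 0 ->
  inv_pair_shifted q a (RtoC q * z) = inv_pair_shifted q a (/ z).
Proof.
  intros hq hz. unfold inv_pair_shifted.
  assert (q0 : RtoC q <> 0) by (apply RtoC_neq0; lra).
  replace (/ / z) with z by (field; auto).
  replace (a * (RtoC q * z)) with (a * RtoC q * z) by ring.
  replace (a * RtoC q * / (RtoC q * z)) with (a * / z) by (field; auto).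
  apply Cmult_comm.
Qed.

(** The exchange of q z and 1/z permutes all the products; the sign comes from the factor z - q / z
    alone. *)
Lemma antishift_q (q : R) (m a b c d r z : C) :
  (0 < q < 1)%R -> z <> 0 ->
  antishift q m a b c d r (RtoC q * z) = - (1) * antishift q m a b c d r (/ z).
Proof.
  intros hq hz. unfold antishift. rewrite !inv_pair_shifted_q by auto.
  assert (q0 : RtoC q <> 0) by (apply RtoC_neq0; lra).
  replace (/ / z) with z by (field; auto).
  replace (RtoC q * z * (RtoC q * z)) with (RtoC q * RtoC q * (z * z)) by ring.
  replace (RtoC q * RtoC q * (/ (RtoC q * z) * / (RtoC q * z)))
    with (/ z * / z) by (field; auto).
  replace (m * RtoC q * (RtoC q * z)) with (m * RtoC q * RtoC q * z) by ring.
  replace (m * RtoC q * RtoC q * / (RtoC q * z))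
    with (m * RtoC q * / z) by (field; auto).
  replace (m * RtoC q * / (RtoC q * z)) with (m * / z) by (field; auto).
  replace (RtoC q * / (RtoC q * z)) with (/ z) by (field; auto).
  ring.
Qed.

Lemma laurent_inv_pair_shifted (q : R) (a : C) :
  (0 < q < 1)%R -> (Cmod a < 1)%R -> laurent q (inv_pair_shifted q a).
Proof.
  intros hq ha. pose proof (Cmod_ge_0 a) as ha0.
  apply laurent_mult; [lra| |];
    apply laurent_inv_qpoch_inf with (Cmod a); try lra.
  - apply laurent_scal_id.
  - intros z hz. apply Cmod_mult_small with 1%R; lra.
  - apply laurent_scal_inv.
  - intros z hz. rewrite Cmod_mult, Cmod_mult, Cmod_RtoC_q by auto.
    rewrite Cmod_inv by (apply (circle_neq0 q); auto; lra).
    destruct hz as [-> | ->].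
    + rewrite Rinv_1. nra.
    + right. field. lra.
Qed.

Lemma laurent_antishift (q : R) (m a b c d r : C) :
  (0 < q < 1)%R ->
  (Cmod a < 1)%R -> (Cmod b < 1)%R -> (Cmod c < 1)%R ->
  (Cmod d < 1)%R -> (Cmod r < 1)%R ->
  laurent q (antishift q m a b c d r).
Proof.
  intros hq ha hb hc hd hr. assert (h0 : (0 < q)%R) by lra.
  assert (Hinv : laurent q (fun z => / z)).
  { apply laurent_ext with (fun z => 1 * / z); [intros; ring|].
    apply laurent_scal_inv. }
  assert (Hid : laurent q (fun z => z)).
  { apply laurent_ext with (fun z => 1 * z); [intros; ring|].
    apply laurent_scal_id. }
  unfold antishift.
  repeat match goal with
  | |- laurent _ (inv_pair_shifted _ _) => now apply laurent_inv_pair_shifted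
  | |- laurent _ (fun z => inv_pair_shifted _ _ _) =>
      now apply laurent_inv_pair_shifted
  | |- laurent _ (fun z => qpoch_inf _ _) => apply laurent_qpoch_inf; auto
  | |- laurent _ (fun z => RtoC 1 - _) => apply laurent_1minus
  | |- laurent _ (fun z => z - ?k * / z) =>
      apply laurent_ext with (fun z => z + - k * / z); [intros; ring|];
      apply laurent_plus; auto
  | |- laurent _ (Cmult _) => apply laurent_scal_id
  | |- laurent _ (fun z => _ * z) => apply laurent_scal_id
  | |- laurent _ (fun z => _ * / z) => apply laurent_scal_inv
  | |- laurent _ (fun z => _ * (/ z * / z)) => apply laurent_scal
  | |- laurent _ (fun z => _ * _) => apply laurent_mult; auto
  end.
Qed.

(** After t -> -t the integral over |z| = q is minus the one over |z| = 1, while [laurent_means]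
    makes the two equal; hence l = - l. *)
Lemma cint_antishift (q : R) (m a b c d r : C) :
  (0 < q < 1)%R ->
  (Cmod a < 1)%R -> (Cmod b < 1)%R -> (Cmod c < 1)%R ->
  (Cmod d < 1)%R -> (Cmod r < 1)%R ->
  cint (fun t => antishift q m a b c d r (Cexpi t)) 0.
Proof.
  intros hq ha hb hc hd hr.
  destruct (laurent_means q (antishift q m a b c d r)) as [l [H1 H2]];
    [lra | now apply laurent_antishift |].
  assert (H3 : cint (fun t => antishift q m a b c d r (RtoC q * Cexpi t))
                 (- (1) * l)).
  { apply cint_ext with
      (fun t => - (1) * antishift q m a b c d r (Cexpi (- t))).
    - intros t. rewrite antishift_q, Cexpi_opp; auto using Cexpi_neq0.
    - apply cint_scal, (cint_opp_var (fun t => antishift q m a b c d r (Cexpi t))).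
      exact H1. }
  assert (E : l = - (1) * l) by (now apply (cint_unique _ _ _ H2 H3)).
  replace (RtoC 0) with l; auto.
  assert (two0 : RtoC 2 <> 0) by (apply RtoC_neq0; lra).
  transitivity (/ 2 * (l + l)); [field; auto|].
  rewrite E at 1. now field.
Qed.

Lemma inv_pair_shifted_unit (q : R) (a z : C) :
  (0 < q < 1)%R -> (Cmod a < 1)%R -> Cmod z = 1%R ->
  inv_pair_shifted q a z = (1 - a * / z) * inv_pair q a z.
Proof.
  intros hq ha hz. unfold inv_pair_shifted, inv_pair.
  assert (hz0 : z <> 0) by (apply Cmod_gt_0; lra).
  assert (haz : (Cmod (a * / z) < 1)%R).
  { rewrite Cmod_mult, Cmod_inv, hz, Rinv_1 by auto. lra. }
  rewrite (qpoch_inf_Sl q (a * / z) hq).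
  replace (a * RtoC q * / z) with (a * / z * RtoC q) by ring.
  pose proof (one_minus_neq0 _ haz) as H1.
  assert (H2 : qpoch_inf (a * / z * RtoC q) q <> 0).
  { apply qpoch_inf_neq0; auto. rewrite Cmod_mult, Cmod_RtoC_q by auto.
    pose proof (Cmod_ge_0 (a * / z)). nra. }
  generalize dependent (qpoch_inf (a * / z * RtoC q) q).
  generalize dependent (a * / z). intros w hw H1 P HP.
  generalize (/ qpoch_inf (a * z) q). intros. field. auto.
Qed.

Lemma antishift_unit (q : R) (m a b c d r z : C) :
  (0 < q < 1)%R ->
  (Cmod a < 1)%R -> (Cmod b < 1)%R -> (Cmod c < 1)%R ->
  (Cmod d < 1)%R -> (Cmod r < 1)%R -> Cmod z = 1%R ->
  antishift q m a b c d r z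
  = (1 - z * z) * z * (1 - m * z)
    * ((1 - a * / z) * (1 - b * / z) * (1 - c * / z)
       * (1 - d * / z) * (1 - r * / z)) * rahman_core q m a b c d r z.
Proof.
  intros hq ha hb hc hd hr hz. unfold antishift, rahman_core.
  assert (hz0 : z <> 0) by (apply Cmod_gt_0; lra).
  rewrite !inv_pair_shifted_unit by auto.
  rewrite (qpoch_inf_Sl q (z * z) hq),
    (qpoch_inf_Sl q (/ z * / z * RtoC q) hq),
    (qpoch_inf_Sl q (m * / z * RtoC q) hq).
  replace (RtoC q * RtoC q * (/ z * / z))
    with (/ z * / z * RtoC q * RtoC q) by ring.
  replace (m * RtoC q * RtoC q * / z) with (m * / z * RtoC q * RtoC q) by ring.
  replace (m * RtoC q * z) with (m * z * RtoC q) by ring.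
  generalize (inv_pair q a z) (inv_pair q b z) (inv_pair q c z)
    (inv_pair q d z) (inv_pair q r z) (qpoch_inf (z * z * RtoC q) q)
    (qpoch_inf (/ z * / z * RtoC q * RtoC q) q) (qpoch_inf (m * z * RtoC q) q)
    (qpoch_inf (m * / z * RtoC q * RtoC q) q).
  intros. field. auto.
Qed.

Lemma rahman_weight_core (q : R) (m a b c d r z : C) :
  (0 < q < 1)%R ->
  rahman_weight q m a b c d r z
  = (1 - z * z) * (1 - / z * / z) * (1 - m * z) * (1 - m * / z)
    * rahman_core q m a b c d r z.
Proof.
  intros hq. unfold rahman_weight, rahman_core.
  rewrite (qpoch_inf_Sl q (z * z) hq), (qpoch_inf_Sl q (/ z * / z) hq),
    (qpoch_inf_Sl q (m * z) hq), (qpoch_inf_Sl q (m * / z) hq). ring.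
Qed.

Lemma inv_pair_q (q : R) (a z : C) :
  (0 < q < 1)%R -> (Cmod a < 1)%R -> Cmod z = 1%R ->
  inv_pair q (a * RtoC q) z
  = (1 - a * z) * (1 - a * / z) * inv_pair q a z.
Proof.
  intros hq ha hz. unfold inv_pair.
  assert (hz0 : z <> 0) by (apply Cmod_gt_0; lra).
  assert (haz : (Cmod (a * / z) < 1)%R).
  { rewrite Cmod_mult, Cmod_inv, hz, Rinv_1 by auto. lra. }
  assert (haz' : (Cmod (a * z) < 1)%R).
  { rewrite Cmod_mult, hz. lra. }
  rewrite (qpoch_inf_Sl q (a * / z) hq), (qpoch_inf_Sl q (a * z) hq).
  replace (a * RtoC q * / z) with (a * / z * RtoC q) by ring.
  replace (a * RtoC q * z) with (a * z * RtoC q) by ring.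
  pose proof (one_minus_neq0 _ haz) as H1.
  pose proof (one_minus_neq0 _ haz') as H2.
  assert (Hn : forall w, (Cmod w < 1)%R -> qpoch_inf (w * RtoC q) q <> 0).
  { intros w hw. apply qpoch_inf_neq0; auto.
    rewrite Cmod_mult, Cmod_RtoC_q by auto. pose proof (Cmod_ge_0 w). nra. }
  pose proof (Hn _ haz) as H3. pose proof (Hn _ haz') as H4.
  generalize dependent (qpoch_inf (a * / z * RtoC q) q).
  generalize dependent (qpoch_inf (a * z * RtoC q) q).
  generalize dependent (a * / z). generalize dependent (a * z).
  intros. field. auto.
Qed.

(** Every summand is a Laurent polynomial in z times [rahman_core]; once that factor is abstracted,
    a rational identity remains, valid for m = abcdr. *)
Lemma rahman_weight_rec (q : R) (a b c d r z : C) :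
  (0 < q < 1)%R ->
  (Cmod a < 1)%R -> (Cmod b < 1)%R -> (Cmod c < 1)%R ->
  (Cmod d < 1)%R -> (Cmod r < 1)%R -> Cmod z = 1%R ->
  let m := a * b * c * d * r in
  (1 - a * c * d * r) * (1 - a * b * d * r) * (1 - a * b * c * r)
    * (1 - a * b * c * d)
    * rahman_weight q (m * RtoC q) (a * RtoC q) b c d r z
  = (1 - a * b) * (1 - a * c) * (1 - a * d) * (1 - a * r)
      * rahman_weight q m a b c d r z
    + - (a * (1 - a * m))
      * (antishift q m a b c d r z + antishift q m a b c d r (/ z)).
Proof.
  intros hq ha hb hc hd hr hz m.
  assert (hz0 : z <> 0) by (apply Cmod_gt_0; lra).
  assert (hz' : Cmod (/ z) = 1%R) by (rewrite Cmod_inv, hz by auto; field).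
  rewrite (antishift_unit q m a b c d r z), (antishift_unit q m a b c d r (/ z));
    auto.
  rewrite rahman_core_inv by auto.
  rewrite (rahman_weight_core q m a) by auto.
  assert (E : rahman_weight q (m * RtoC q) (a * RtoC q) b c d r z
     = (1 - z * z) * (1 - / z * / z) * (1 - a * z) * (1 - a * / z)
       * rahman_core q m a b c d r z).
  { unfold rahman_weight, rahman_core. rewrite inv_pair_q by auto.
    rewrite (qpoch_inf_Sl q (z * z) hq), (qpoch_inf_Sl q (/ z * / z) hq).
    replace (m * RtoC q * / z) with (m * / z * RtoC q) by ring.
    replace (m * RtoC q * z) with (m * z * RtoC q) by ring. ring. }
  rewrite E. generalize (rahman_core q m a b c d r z). intros U.
  unfold m. clear E m ha hb hc hd hr hz hz'. field. auto.
Qed.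

(** * The integral of the weight: recursion and limits in the parameters *)

Definition rahman_int (q : R) (m a b c d r : C) : C :=
  RInt (V := C_R_CompleteNormedModule)
    (fun t => rahman_weight q m a b c d r (Cexpi t)) (- PI) PI.

(** With rho = 1 the two circles coincide; the class then serves for integrability and boundedness
    on |z| = 1. *)
Lemma laurent_inv_pair (q : R) (a : C) :
  (0 < q < 1)%R -> (Cmod a < 1)%R -> laurent 1 (inv_pair q a).
Proof.
  intros hq ha. pose proof (Cmod_ge_0 a) as ha0.
  apply laurent_mult; [lra| |];
    apply laurent_inv_qpoch_inf with (Cmod a); try lra.
  - apply laurent_scal_id.
  - intros z hz. rewrite Cmod_mult. destruct hz as [-> | ->]; lra.
  - apply laurent_scal_inv.
  - intros z hz. rewrite Cmod_mult, Cmod_inv.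
    + destruct hz as [-> | ->]; lra.
    + apply (circle_neq0 1); auto. lra.
Qed.

Lemma laurent_rahman_weight (q : R) (m a b c d r : C) :
  (0 < q < 1)%R ->
  (Cmod a < 1)%R -> (Cmod b < 1)%R -> (Cmod c < 1)%R ->
  (Cmod d < 1)%R -> (Cmod r < 1)%R ->
  laurent 1 (rahman_weight q m a b c d r).
Proof.
  intros hq ha hb hc hd hr. assert (h0 : (0 < 1)%R) by lra.
  assert (Hinv : laurent 1 (fun z => / z)).
  { apply laurent_ext with (fun z => 1 * / z); [intros; ring|].
    apply laurent_scal_inv. }
  assert (Hid : laurent 1 (fun z => z)).
  { apply laurent_ext with (fun z => 1 * z); [intros; ring|].
    apply laurent_scal_id. }
  unfold rahman_weight.
  repeat match goal with
  | |- laurent _ (inv_pair _ _) => now apply laurent_inv_pair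
  | |- laurent _ (fun z => inv_pair _ _ _) => now apply laurent_inv_pair
  | |- laurent _ (fun z => qpoch_inf _ _) => apply laurent_qpoch_inf; auto
  | |- laurent _ (Cmult _) => apply laurent_scal_id
  | |- laurent _ (fun z => m * z) => apply laurent_scal_id
  | |- laurent _ (fun z => m * / z) => apply laurent_scal_inv
  | |- laurent _ (fun z => _ * _) => apply laurent_mult; auto
  end.
Qed.

Lemma cint_rahman (q : R) (m a b c d r : C) :
  (0 < q < 1)%R ->
  (Cmod a < 1)%R -> (Cmod b < 1)%R -> (Cmod c < 1)%R ->
  (Cmod d < 1)%R -> (Cmod r < 1)%R ->
  cint (fun t => rahman_weight q m a b c d r (Cexpi t))
    (rahman_int q m a b c d r).
Proof.
  intros hq ha hb hc hd hr.
  destruct (laurent_means 1 (rahman_weight q m a b c d r)) as [l [Hl _]];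
    [lra | now apply laurent_rahman_weight |].
  unfold rahman_int.
  now rewrite (is_RInt_unique (V := C_R_CompleteNormedModule) _ _ _ l Hl).
Qed.

(** The recursion acts on the first parameter; a cyclic shift brings each of the others to that
    place. *)
Lemma rahman_int_swap (q : R) (m a b c d r : C) :
  rahman_int q m a b c d r = rahman_int q m b c d r a.
Proof.
  apply (RInt_ext (V := C_R_CompleteNormedModule)). intros t _.
  assert (Hc : forall P x1 x2 x3 x4 x5 : C,
    P * (x1 * x2 * x3 * x4 * x5) = P * (x2 * x3 * x4 * x5 * x1))
    by (intros; ring).
  apply Hc.
Qed.

Lemma Cmod_mult_lt1 (x y : C) :
  (Cmod x < 1)%R -> (Cmod y < 1)%R -> (Cmod (x * y) < 1)%R.
Proof.
  intros. rewrite Cmod_mult. pose proof (Cmod_ge_0 x). pose proof (Cmod_ge_0 y).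
  nra.
Qed.

Lemma Cmod_q_lt1 (q : R) : (0 < q < 1)%R -> (Cmod (RtoC q) < 1)%R.
Proof. intros hq. rewrite Cmod_RtoC_q; lra. Qed.

Lemma rahman_int_rec (q : R) (a b c d r : C) :
  (0 < q < 1)%R ->
  (Cmod a < 1)%R -> (Cmod b < 1)%R -> (Cmod c < 1)%R ->
  (Cmod d < 1)%R -> (Cmod r < 1)%R ->
  let m := a * b * c * d * r in
  (1 - a * c * d * r) * (1 - a * b * d * r) * (1 - a * b * c * r)
    * (1 - a * b * c * d) * rahman_int q (m * RtoC q) (a * RtoC q) b c d r
  = (1 - a * b) * (1 - a * c) * (1 - a * d) * (1 - a * r)
    * rahman_int q m a b c d r.
Proof.
  intros hq ha hb hc hd hr m.
  pose proof (cint_antishift q m a b c d r hq ha hb hc hd hr) as H0.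
  pose proof (cint_opp_var _ _ H0) as H0'.
  pose proof (cint_rahman q m a b c d r hq ha hb hc hd hr) as H1.
  assert (haq : (Cmod (a * RtoC q) < 1)%R)
    by (apply Cmod_mult_lt1; auto using Cmod_q_lt1).
  pose proof (cint_rahman q (m * RtoC q) (a * RtoC q) b c d r hq haq hb hc hd hr)
    as H2.
  eapply cint_unique; [apply cint_scal, H2|].
  replace ((1 - a * b) * (1 - a * c) * (1 - a * d) * (1 - a * r)
           * rahman_int q m a b c d r)
    with ((1 - a * b) * (1 - a * c) * (1 - a * d) * (1 - a * r)
           * rahman_int q m a b c d r + - (a * (1 - a * m)) * (0 + 0)) by ring.
  eapply cint_ext;
    [|apply cint_plus; [apply cint_scal, H1|apply cint_scal, cint_plus;
        [apply H0 | apply H0']]].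
  intros t. cbv beta. rewrite Cexpi_opp. symmetry.
  apply rahman_weight_rec; auto. apply Cmod_Cexpi.
Qed.

Lemma rahman_int_iter (q : R) (a b c d r : C) (n : nat) :
  (0 < q < 1)%R ->
  (Cmod a < 1)%R -> (Cmod b < 1)%R -> (Cmod c < 1)%R ->
  (Cmod d < 1)%R -> (Cmod r < 1)%R ->
  let m := a * b * c * d * r in
  qpoch (a * c * d * r) q n * qpoch (a * b * d * r) q n
    * qpoch (a * b * c * r) q n * qpoch (a * b * c * d) q n
    * rahman_int q (m * RtoC q ^ n) (a * RtoC q ^ n) b c d r
  = qpoch (a * b) q n * qpoch (a * c) q n * qpoch (a * d) q n
    * qpoch (a * r) q n * rahman_int q m a b c d r.
Proof.
  intros hq ha hb hc hd hr m. induction n as [|n IH].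
  - simpl. rewrite !Cmult_1_r. reflexivity.
  - assert (han : (Cmod (a * RtoC q ^ n) < 1)%R).
    { eapply Rle_lt_trans; [|apply ha].
      apply Cmod_mult_small with 1%R; try lra. now apply Cmod_pow_q_le1. }
    pose proof (rahman_int_rec q (a * RtoC q ^ n) b c d r hq han hb hc hd hr) as H.
    cbv zeta in H.
    replace (a * RtoC q ^ n * b * c * d * r * RtoC q)
      with (m * RtoC q ^ S n) in H by (unfold m; rewrite Cpow_S; ring).
    replace (a * RtoC q ^ n * b * c * d * r)
      with (m * RtoC q ^ n) in H by (unfold m; ring).
    replace (a * RtoC q ^ n * RtoC q)
      with (a * RtoC q ^ S n) in H by (rewrite Cpow_S; ring).
    cbn [qpoch].
    transitivity (qpoch (a * c * d * r) q n * qpoch (a * b * d * r) q n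
      * qpoch (a * b * c * r) q n * qpoch (a * b * c * d) q n
      * ((1 - a * RtoC q ^ n * c * d * r) * (1 - a * RtoC q ^ n * b * d * r)
         * (1 - a * RtoC q ^ n * b * c * r) * (1 - a * RtoC q ^ n * b * c * d)
         * rahman_int q (m * RtoC q ^ S n) (a * RtoC q ^ S n) b c d r)); [ring|].
    rewrite H.
    transitivity ((1 - a * RtoC q ^ n * b) * (1 - a * RtoC q ^ n * c)
       * (1 - a * RtoC q ^ n * d) * (1 - a * RtoC q ^ n * r)
       * (qpoch (a * c * d * r) q n * qpoch (a * b * d * r) q n
          * qpoch (a * b * c * r) q n * qpoch (a * b * c * d) q n
          * rahman_int q (m * RtoC q ^ n) (a * RtoC q ^ n) b c d r)); [ring|].
    rewrite IH. ring.
Qed.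

Lemma Cmod_mult_near1 (x y : C) (A B M : R) :
  (Cmod (x - 1) <= A)%R -> (Cmod (y - 1) <= B)%R -> (Cmod y <= M)%R ->
  (Cmod (x * y - 1) <= A * M + B)%R.
Proof.
  intros hx hy hM. replace (x * y - 1) with ((x - 1) * y + (y - 1)) by ring.
  eapply Rle_trans; [apply Cmod_triangle|].
  apply Rplus_le_compat; auto. now apply Cmod_mult_le.
Qed.

(** Numerator and denominator are both 1 + O(q^n) uniformly on |z| = 1, and the denominator stays
    away from 0 because |a q^n z| <= |a| < 1. *)
Lemma qpoch_inf_ratio_near1 (q A : R) (m a : C) :
  (0 < q < 1)%R -> (Cmod m <= A)%R -> (Cmod a < 1)%R ->
  exists M : R, forall n z, Cmod z = 1%R ->
  (Cmod (qpoch_inf (m * RtoC q ^ n * z) q * / qpoch_inf (a * RtoC q ^ n * z) q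
         - 1) <= M * q ^ n)%R.
Proof.
  intros hq hm ha.
  set (K1 := (exp (A / (1 - q)) / (1 - q))%R).
  set (K2 := (exp (1 / (1 - q)) / (1 - q))%R).
  set (E := exp (/ ((1 - Cmod a) * (1 - q)))).
  assert (hA : (0 <= A)%R) by (pose proof (Cmod_ge_0 m); lra).
  assert (hK1 : (0 <= K1)%R).
  { apply Rdiv_le_0_compat; [left; apply exp_pos | lra]. }
  assert (hK2 : (0 <= K2)%R).
  { apply Rdiv_le_0_compat; [left; apply exp_pos | lra]. }
  assert (hE : (0 < E)%R) by apply exp_pos.
  exists (K1 * A * E + K2 * E)%R. intros n z hz.
  pose proof (pow_q_bound q n hq) as hqn.
  assert (hmn : (Cmod (m * RtoC q ^ n * z) <= A * q ^ n)%R).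
  { rewrite !Cmod_mult, hz, Cmod_pow_q by auto. nra. }
  assert (han : Cmod (a * RtoC q ^ n * z) = (Cmod a * q ^ n)%R).
  { rewrite !Cmod_mult, hz, Cmod_pow_q by auto. ring. }
  assert (han' : (Cmod (a * RtoC q ^ n * z) <= Cmod a)%R).
  { rewrite han. pose proof (Cmod_ge_0 a). nra. }
  assert (H1 : (Cmod (/ qpoch_inf (a * RtoC q ^ n * z) q) <= E)%R).
  { apply qpoch_inf_inv_le; auto. }
  replace ((K1 * A * E + K2 * E) * q ^ n)%R
    with (K1 * A * q ^ n * E + K2 * q ^ n * E)%R by ring.
  apply Cmod_mult_near1; auto.
  - eapply Rle_trans; [apply (qpoch_inf_near1 q A); auto; nra|].
    fold K1. rewrite Rmult_assoc. now apply Rmult_le_compat_l.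
  - assert (H0 : qpoch_inf (a * RtoC q ^ n * z) q <> 0)
      by (apply qpoch_inf_neq0; auto; lra).
    replace (/ qpoch_inf (a * RtoC q ^ n * z) q - 1)
      with (- (qpoch_inf (a * RtoC q ^ n * z) q - 1)
            * / qpoch_inf (a * RtoC q ^ n * z) q) by (field; auto).
    apply Cmod_mult_le; auto. rewrite Cmod_opp.
    eapply Rle_trans; [apply (qpoch_inf_near1 q 1); auto; lra|].
    fold K2. rewrite han. apply Rmult_le_compat_l; auto. nra.
Qed.

(** Only the products with m and a depend on n. Relative to the weight with both set to 0 they
    contribute a factor 1 + O(q^n), uniformly in t. *)
Lemma rahman_int_limit (q : R) (m a b c d r : C) :
  (0 < q < 1)%R ->
  (Cmod a < 1)%R -> (Cmod b < 1)%R -> (Cmod c < 1)%R ->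
  (Cmod d < 1)%R -> (Cmod r < 1)%R ->
  Ccv (fun n => rahman_int q (m * RtoC q ^ n) (a * RtoC q ^ n) b c d r)
    (rahman_int q 0 0 b c d r).
Proof.
  intros hq ha hb hc hd hr.
  assert (h0 : (Cmod 0 < 1)%R) by (rewrite Cmod_0; lra).
  destruct (laurent_bounded 1 _ ltac:(lra)
    (laurent_rahman_weight q 0 0 b c d r hq h0 hb hc hd hr)) as [B HB].
  destruct (qpoch_inf_ratio_near1 q (Cmod m) m a hq (Rle_refl _) ha) as [M HM].
  assert (han : forall n, (Cmod (a * RtoC q ^ n) < 1)%R).
  { intros n. eapply Rle_lt_trans; [|apply ha].
    apply Cmod_mult_small with 1%R; try lra. now apply Cmod_pow_q_le1. }
  assert (HM0 : (0 <= M)%R).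
  { specialize (HM O 1 Cmod_1). simpl in HM.
    pose proof (Cmod_ge_0 (qpoch_inf (m * 1 * 1) q * / qpoch_inf (a * 1 * 1) q - 1)).
    lra. }
  destruct (cint_limit
    (fun n t => rahman_weight q (m * RtoC q ^ n) (a * RtoC q ^ n) b c d r (Cexpi t))
    (fun t => rahman_weight q 0 0 b c d r (Cexpi t))
    (fun n => rahman_int q (m * RtoC q ^ n) (a * RtoC q ^ n) b c d r)
    (B * (M * (1 + M) + M)) q) as [l [Hl Hc]].
  - lra.
  - intros n. now apply cint_rahman.
  - intros n t.
    set (z := Cexpi t).
    assert (hz : Cmod z = 1%R) by apply Cmod_Cexpi.
    assert (hz' : Cmod (/ z) = 1%R).
    { unfold z. rewrite <- Cexpi_opp. apply Cmod_Cexpi. }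
    set (x := fun w => qpoch_inf (m * RtoC q ^ n * w) q
                       * / qpoch_inf (a * RtoC q ^ n * w) q).
    assert (E : rahman_weight q (m * RtoC q ^ n) (a * RtoC q ^ n) b c d r z
                = rahman_weight q 0 0 b c d r z * (x z * x (/ z))).
    { unfold rahman_weight, x, inv_pair.
      rewrite !Cmult_0_l, !qpoch_inf_0 by auto.
      replace (/ 1) with (RtoC 1) by (now field). ring. }
    rewrite E.
    replace (rahman_weight q 0 0 b c d r z * (x z * x (/ z))
             - rahman_weight q 0 0 b c d r z)
      with (rahman_weight q 0 0 b c d r z * (x z * x (/ z) - 1)) by ring.
    rewrite Rmult_assoc. apply Cmod_mult_le; [apply HB; now left|].
    pose proof (pow_q_bound q n hq) as hqn.
    pose proof (HM n z hz) as X1. pose proof (HM n (/ z) hz') as X2.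
    fold (x z) in X1. fold (x (/ z)) in X2.
    apply Rle_trans with (M * q ^ n * (1 + M) + M * q ^ n)%R; [|right; ring].
    apply Cmod_mult_near1; auto.
    replace (x (/ z)) with (1 + (x (/ z) - 1)) by ring.
    eapply Rle_trans; [apply Cmod_triangle|]. rewrite Cmod_1. nra.
  - rewrite (cint_unique _ _ _ (cint_rahman q 0 0 b c d r hq h0 hb hc hd hr) Hc).
    exact Hl.
Qed.

Lemma rahman_int_zero (q : R) (a b c d r : C) :
  (0 < q < 1)%R ->
  (Cmod a < 1)%R -> (Cmod b < 1)%R -> (Cmod c < 1)%R ->
  (Cmod d < 1)%R -> (Cmod r < 1)%R ->
  qpoch_inf (a * c * d * r) q * qpoch_inf (a * b * d * r) q
    * qpoch_inf (a * b * c * r) q * qpoch_inf (a * b * c * d) q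
    * rahman_int q 0 0 b c d r
  = qpoch_inf (a * b) q * qpoch_inf (a * c) q * qpoch_inf (a * d) q
    * qpoch_inf (a * r) q * rahman_int q (a * b * c * d * r) a b c d r.
Proof.
  intros hq ha hb hc hd hr.
  eapply Ccv_unique.
  - apply Ccv_mult; [repeat apply Ccv_mult; now apply qpoch_cv|].
    apply (rahman_int_limit q (a * b * c * d * r) a); auto.
  - eapply Ccv_ext; [intros n; symmetry; now apply rahman_int_iter|].
    apply Ccv_mult; [repeat apply Ccv_mult; now apply qpoch_cv|].
    apply Ccv_const.
Qed.

(** With a fifth parameter 0 the product m is 0 too, so the recursion stays among weights with m =
    0; the cyclic shift hands the next parameter to the first place. *)
Lemma rahman_int_zero_step (q : R) (b c d r : C) :
  (0 < q < 1)%R ->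
  (Cmod b < 1)%R -> (Cmod c < 1)%R -> (Cmod d < 1)%R -> (Cmod r < 1)%R ->
  qpoch_inf (b * c * d * r) q * rahman_int q 0 0 c d r 0
  = qpoch_inf (b * c) q * qpoch_inf (b * d) q * qpoch_inf (b * r) q
    * rahman_int q 0 0 b c d r.
Proof.
  intros hq hb hc hd hr.
  assert (h0 : (Cmod 0 < 1)%R) by (rewrite Cmod_0; lra).
  pose proof (rahman_int_zero q b c d r 0 hq hb hc hd hr h0) as H.
  rewrite !Cmult_0_r, !qpoch_inf_0, !Cmult_1_l in H by auto.
  rewrite (rahman_int_swap q 0 0 b c d r), H. ring.
Qed.

(** Removing a parameter yields its pair products with those still present, ten in all. Four of the
    quadruple products come from removing a and the fifth from removing b; afterwards every
    quadruple contains a zero. *)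
Lemma rahman_int_eq (q : R) (a b c d r : C) :
  (0 < q < 1)%R ->
  (Cmod a < 1)%R -> (Cmod b < 1)%R -> (Cmod c < 1)%R ->
  (Cmod d < 1)%R -> (Cmod r < 1)%R ->
  qpoch_inf (a * c * d * r) q * qpoch_inf (a * b * d * r) q
    * qpoch_inf (a * b * c * r) q * qpoch_inf (a * b * c * d) q
    * qpoch_inf (b * c * d * r) q * rahman_int q 0 0 0 0 0 0
  = qpoch_inf (a * b) q * qpoch_inf (a * c) q * qpoch_inf (a * d) q
    * qpoch_inf (a * r) q * qpoch_inf (b * c) q * qpoch_inf (b * d) q
    * qpoch_inf (b * r) q * qpoch_inf (c * d) q * qpoch_inf (c * r) q
    * qpoch_inf (d * r) q * rahman_int q (a * b * c * d * r) a b c d r.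
Proof.
  intros hq ha hb hc hd hr.
  assert (h0 : (Cmod 0 < 1)%R) by (rewrite Cmod_0; lra).
  pose proof (rahman_int_zero q a b c d r hq ha hb hc hd hr) as H1.
  pose proof (rahman_int_zero_step q b c d r hq hb hc hd hr) as H2.
  pose proof (rahman_int_zero_step q c d r 0 hq hc hd hr h0) as H3.
  pose proof (rahman_int_zero_step q d r 0 0 hq hd hr h0 h0) as H4.
  pose proof (rahman_int_zero_step q r 0 0 0 hq hr h0 h0 h0) as H5.
  rewrite ?Cmult_0_r, ?qpoch_inf_0, ?Cmult_1_l, ?Cmult_1_r in H3, H4, H5 by auto.
  transitivity (qpoch_inf (a * c * d * r) q * qpoch_inf (a * b * d * r) q
    * qpoch_inf (a * b * c * r) q * qpoch_inf (a * b * c * d) q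
    * (qpoch_inf (c * d) q * qpoch_inf (c * r) q * qpoch_inf (d * r) q
       * (qpoch_inf (b * c * d * r) q * rahman_int q 0 0 c d r 0))).
  { rewrite H5, H4.
    transitivity (qpoch_inf (a * c * d * r) q * qpoch_inf (a * b * d * r) q
      * qpoch_inf (a * b * c * r) q * qpoch_inf (a * b * c * d) q
      * qpoch_inf (b * c * d * r) q * qpoch_inf (d * r) q
      * rahman_int q 0 0 d r 0 0); [ring|]. rewrite H3. ring. }
  rewrite H2.
  transitivity (qpoch_inf (c * d) q * qpoch_inf (c * r) q * qpoch_inf (d * r) q
    * (qpoch_inf (b * c) q * qpoch_inf (b * d) q * qpoch_inf (b * r) q)
    * (qpoch_inf (a * c * d * r) q * qpoch_inf (a * b * d * r) q
       * qpoch_inf (a * b * c * r) q * qpoch_inf (a * b * c * d) q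
       * rahman_int q 0 0 b c d r)); [ring|].
  rewrite H1. ring.
Qed.

(** * The integral with all parameters zero *)

(** Pairing opposite signs gives (q^2 x^2; q^2)_oo and (q x^2; q^2)_oo, the odd- and even-indexed
    factors of the right-hand side. *)
Lemma qpoch_inf_quadruple (q : R) (p x : C) :
  (0 < q < 1)%R -> p * p = RtoC q ->
  qpoch_inf (RtoC q * x) q * qpoch_inf (- RtoC q * x) q
    * (qpoch_inf (p * x) q * qpoch_inf (- p * x) q)
  = qpoch_inf (RtoC q * (x * x)) q.
Proof.
  intros hq hp.
  replace (- RtoC q * x) with (- (RtoC q * x)) by ring.
  replace (- p * x) with (- (p * x)) by ring.
  rewrite <- !qpoch_inf_square by auto.
  rewrite (qpoch_inf_bisect q (RtoC q * (x * x)) hq).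
  replace (p * x * (p * x)) with (RtoC q * (x * x)) by (rewrite <- hp; ring).
  replace (RtoC q * x * (RtoC q * x)) with (RtoC q * (x * x) * RtoC q) by ring.
  apply Cmult_comm.
Qed.

(* At a = q, b = -q, c = sqrt q, d = - sqrt q the denominator cancels all of the
   numerator but an elementary factor. *)
Lemma rahman_int_special (q : R) (p : C) :
  (0 < q < 1)%R -> p * p = RtoC q -> (Cmod p < 1)%R ->
  rahman_int q 0 (RtoC q) (- RtoC q) p (- p) 0 = 4 * RtoC PI.
Proof.
  intros hq hp hp1.
  assert (h0 : (Cmod 0 < 1)%R) by (rewrite Cmod_0; lra).
  pose proof (Cmod_q_lt1 q hq) as hq1.
  eapply cint_unique.
  - apply cint_rahman; auto; now rewrite Cmod_opp.
  (* What survives the cancellation is (1 - z^2)(1 - z^-2) = 2 - z^2 - z^-2, with integral 2 PI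
     times 2. [cint_pow 1] and [cint_inv_pow 1] concern the exponent 2. *)
  - replace (4 * RtoC PI)
      with (2 * RtoC PI * 2 + (- (1) * 0 + - (1) * 0)).
    2:{ replace (RtoC 4) with (2 * 2) by (rewrite <- RtoC_mult; f_equal; ring).
        ring. }
    eapply cint_ext; [|apply cint_plus; [apply cint_const|apply cint_plus;
      [apply cint_scal, (cint_pow 1) | apply cint_scal, (cint_inv_pow 1)]]].
    intros t. cbv beta. set (z := Cexpi t).
    assert (hz0 : z <> 0) by apply Cexpi_neq0.
    assert (hz : Cmod z = 1%R) by apply Cmod_Cexpi.
    assert (hz' : Cmod (/ z) = 1%R) by (rewrite Cmod_inv, hz by auto; field).
    unfold rahman_weight, inv_pair.
    rewrite !Cmult_0_l, !qpoch_inf_0 by auto.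
    rewrite (qpoch_inf_Sl q (z * z) hq), (qpoch_inf_Sl q (/ z * / z) hq).
    rewrite (Cmult_comm (z * z) (RtoC q)), (Cmult_comm (/ z * / z) (RtoC q)).
    rewrite <- (qpoch_inf_quadruple q p z hq hp).
    rewrite <- (qpoch_inf_quadruple q p (/ z) hq hp).
    assert (Hn : forall w x, (Cmod w < 1)%R -> Cmod x = 1%R ->
                 qpoch_inf (w * x) q <> 0).
    { intros w x hw hx. apply qpoch_inf_neq0; auto. rewrite Cmod_mult, hx. lra. }
    assert (hqo : (Cmod (- RtoC q) < 1)%R) by (now rewrite Cmod_opp).
    assert (hpo : (Cmod (- p) < 1)%R) by (now rewrite Cmod_opp).
    pose proof (Hn _ _ hq1 hz) as N1. pose proof (Hn _ _ hq1 hz') as N2.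
    pose proof (Hn _ _ hqo hz) as N3. pose proof (Hn _ _ hqo hz') as N4.
    pose proof (Hn _ _ hp1 hz) as N5. pose proof (Hn _ _ hp1 hz') as N6.
    pose proof (Hn _ _ hpo hz) as N7. pose proof (Hn _ _ hpo hz') as N8.
    clear Hn. revert N1 N2 N3 N4 N5 N6 N7 N8.
    generalize (qpoch_inf (RtoC q * z) q) (qpoch_inf (RtoC q * / z) q)
      (qpoch_inf (- RtoC q * z) q) (qpoch_inf (- RtoC q * / z) q)
      (qpoch_inf (p * z) q) (qpoch_inf (p * / z) q)
      (qpoch_inf (- p * z) q) (qpoch_inf (- p * / z) q).
    intros. simpl. field. repeat split; auto.
Qed.

(** Apart from (q; q)_oo, which remains, the products of the general formula cancel: pairs of
    opposite arguments give (q^2; q^2)_oo, (q^4; q^2)_oo and twice (q^3; q^2)_oo, which recombine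
    into (q^2; q)_oo (q^3; q)_oo. *)
Lemma rahman_int_0 (q : R) :
  (0 < q < 1)%R -> qpoch_inf q q * rahman_int q 0 0 0 0 0 0 = 4 * RtoC PI.
Proof.
  intros hq.
  assert (hqq : (0 < q * q < 1)%R) by nra.
  assert (h0 : (Cmod 0 < 1)%R) by (rewrite Cmod_0; lra).
  pose proof (Cmod_q_lt1 q hq) as hq1.
  set (p := RtoC (sqrt q)).
  assert (hp : p * p = RtoC q).
  { unfold p. rewrite <- RtoC_mult, sqrt_sqrt; auto. lra. }
  assert (hp1 : (Cmod p < 1)%R).
  { unfold p. rewrite Cmod_R, Rabs_pos_eq by apply sqrt_pos.
    rewrite <- sqrt_1. apply sqrt_lt_1; lra. }
  assert (hqo : (Cmod (- RtoC q) < 1)%R) by (now rewrite Cmod_opp).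
  assert (hpo : (Cmod (- p) < 1)%R) by (now rewrite Cmod_opp).
  pose proof (rahman_int_eq q q (- RtoC q) p (- p) 0 hq hq1 hqo hp1 hpo h0) as H.
  rewrite !Cmult_0_r, !qpoch_inf_0, !Cmult_1_r in H by auto.
  rewrite (rahman_int_special q p hq hp hp1) in H.
  set (Q2 := RtoC q * RtoC q). set (w := RtoC q * p).
  replace (RtoC q * - RtoC q * p * - p) with (Q2 * RtoC q) in H
    by (unfold Q2; rewrite <- hp; ring).
  replace (RtoC q * - RtoC q) with (- Q2) in H by (unfold Q2; ring).
  replace (- RtoC q * - p) with w in H by (unfold w; ring).
  replace (RtoC q * - p) with (- w) in H by (unfold w; ring).
  replace (- RtoC q * p) with (- w) in H by (unfold w; ring).
  replace (p * - p) with (- RtoC q) in H by (rewrite <- hp; ring).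
  fold w in H.
  pose proof (qpoch_inf_square q (RtoC q) hq) as E1.
  pose proof (qpoch_inf_square q Q2 hq) as E2.
  pose proof (qpoch_inf_square q w hq) as E3.
  pose proof (qpoch_inf_bisect q Q2 hq) as E4.
  pose proof (qpoch_inf_bisect q (Q2 * RtoC q) hq) as E5.
  replace (w * w) with (Q2 * RtoC q) in E3
    by (unfold w, Q2; rewrite <- hp; ring).
  replace (Q2 * Q2) with (Q2 * RtoC q * RtoC q) in E2 by (unfold Q2; ring).
  fold Q2 in E1.
  assert (hQ2 : (Cmod Q2 < 1)%R) by (now apply Cmod_mult_lt1).
  assert (N2 : qpoch_inf Q2 q <> 0) by (now apply qpoch_inf_neq0).
  assert (N3 : qpoch_inf (Q2 * RtoC q) q <> 0)
    by (apply qpoch_inf_neq0; auto; now apply Cmod_mult_lt1).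
  revert H N2 N3 E1 E2 E3 E4 E5.
  generalize (rahman_int q 0 0 0 0 0 0) (qpoch_inf (Q2 * RtoC q) q)
    (qpoch_inf Q2 q) (qpoch_inf (- Q2) q) (qpoch_inf w q) (qpoch_inf (- w) q)
    (qpoch_inf q q) (qpoch_inf (- RtoC q) q)
    (qpoch_inf Q2 (q * q)) (qpoch_inf (Q2 * RtoC q) (q * q))
    (qpoch_inf (Q2 * RtoC q * RtoC q) (q * q)).
  intros K x3 x2 x2' xw xw' x1 x1' y2 y3 y4 H N2 N3 E1 E2 E3 E4 E5.
  transitivity (/ (x2 * x3) * (x2 * x1 * (x3 * K))); [field; auto|].
  replace (x3 * K) with (x2' * xw * xw' * xw' * xw * x1' * (4 * RtoC PI)).
  - transitivity (/ (x2 * x3) * ((x1 * x1') * (x2 * x2') * (xw * xw') * (xw * xw')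
       * (4 * RtoC PI))); [field; auto|].
    rewrite <- E1, <- E2, <- E3.
    transitivity (/ (x2 * x3) * ((y2 * y3) * (y3 * y4) * (4 * RtoC PI)));
      [field; auto|].
    rewrite <- E4, <- E5. field. auto.
  - etransitivity; [|etransitivity; [symmetry; apply H|]]; ring.
Qed.

Lemma rahman_integral (q : R) (a b c d r : C) :
  (0 < q < 1)%R ->
  (Cmod a < 1)%R -> (Cmod b < 1)%R -> (Cmod c < 1)%R ->
  (Cmod d < 1)%R -> (Cmod r < 1)%R ->
  rahman_int q (a * b * c * d * r) a b c d r
  = 4 * RtoC PI * (qpoch_inf (a * c * d * r) q * qpoch_inf (a * b * d * r) q
    * qpoch_inf (a * b * c * r) q * qpoch_inf (a * b * c * d) q
    * qpoch_inf (b * c * d * r) q)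
    / (qpoch_inf q q * (qpoch_inf (a * b) q * qpoch_inf (a * c) q
       * qpoch_inf (a * d) q * qpoch_inf (a * r) q * qpoch_inf (b * c) q
       * qpoch_inf (b * d) q * qpoch_inf (b * r) q * qpoch_inf (c * d) q
       * qpoch_inf (c * r) q * qpoch_inf (d * r) q)).
Proof.
  intros hq ha hb hc hd hr.
  pose proof (rahman_int_eq q a b c d r hq ha hb hc hd hr) as H.
  rewrite <- (rahman_int_0 q hq).
  assert (Hn : forall x y : C, (Cmod x < 1)%R -> (Cmod y < 1)%R ->
               qpoch_inf (x * y) q <> 0).
  { intros x y hx hy. apply qpoch_inf_neq0; auto. now apply Cmod_mult_lt1. }
  assert (N : qpoch_inf q q <> 0) by (apply qpoch_inf_neq0; auto using Cmod_q_lt1).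
  pose proof (Hn a b ha hb). pose proof (Hn a c ha hc). pose proof (Hn a d ha hd).
  pose proof (Hn a r ha hr). pose proof (Hn b c hb hc). pose proof (Hn b d hb hd).
  pose proof (Hn b r hb hr). pose proof (Hn c d hc hd). pose proof (Hn c r hc hr).
  pose proof (Hn d r hd hr).
  match type of H with ?x * ?k = ?y * ?i =>
    transitivity (/ y * (y * i)); [field; repeat split; auto|];
    rewrite <- H; field; repeat split; auto end.
Qed.

(** * The expansion of the integrand *)

(** The quadratic exponent beats any geometric growth: x is replaced by x q until it drops below
    1/2. The ratio 1/2 is an arbitrary choice. *)
Lemma pow_qtri_le (q x : R) :
  (0 < q < 1)%R -> (0 <= x)%R ->
  exists M : R, forall n,
    (x ^ n * q ^ (n * (n - 1) / 2) <= M * (/ 2) ^ n)%R.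
Proof.
  intros hq.
  assert (H : exists N, (x * q ^ N <= / 2)%R).
  { destruct (pow_lt_1_zero q) with (y := (/ (2 * (Rabs x + 1)))%R) as [N HN].
    - rewrite Rabs_pos_eq; lra.
    - apply Rinv_0_lt_compat. pose proof (Rabs_pos x). lra.
    - exists N. specialize (HN N (le_n N)).
      pose proof (pow_q_bound q N hq) as Hp. pose proof (Rabs_pos x) as Hx.
      pose proof (Rle_abs x).
      rewrite Rabs_pos_eq in HN by lra.
      apply (Rmult_lt_compat_l (2 * (Rabs x + 1))) in HN; [|lra].
      rewrite Rinv_r in HN by lra. nra. }
  destruct H as [N HN]. revert x HN.
  induction N as [|N IH]; intros x HN hx.
  - simpl in HN. rewrite Rmult_1_r in HN. exists 1%R. intros n.
    rewrite Rmult_1_l. pose proof (pow_q_bound q (n * (n - 1) / 2) hq).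
    pose proof (pow_incr x (/ 2) n (conj hx HN)). pose proof (pow_le x n hx). nra.
  - destruct (IH (x * q)%R) as [M HM].
    + simpl in HN. lra.
    + apply Rmult_le_pos; lra.
    + assert (HM0 : (1 <= M)%R) by (specialize (HM O); simpl in HM; lra).
      exists (1 + 2 * x * M)%R. intros [|n].
      * simpl. nra.
      * rewrite triangle_S, pow_add. specialize (HM n).
        rewrite Rpow_mult_distr in HM.
        replace (x ^ S n * (q ^ (n * (n - 1) / 2) * q ^ n))%R
          with (x * (x ^ n * q ^ n * q ^ (n * (n - 1) / 2)))%R by (simpl; ring).
        apply Rle_trans with (x * (M * (/ 2) ^ n))%R.
        -- now apply Rmult_le_compat_l.
        -- simpl. pose proof (pow_lt (/ 2) n ltac:(lra)). nra.
Qed.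

(** One bound for all z on the circle and all pairs (m q^n, a q^n) at once, as termwise integration
    requires. *)
Lemma rahman_weight_le (q : R) (a b c d r : C) :
  (0 < q < 1)%R ->
  (Cmod a < 1)%R -> (Cmod b < 1)%R -> (Cmod c < 1)%R ->
  (Cmod d < 1)%R -> (Cmod r < 1)%R ->
  exists B : R, forall m x z,
    (Cmod m <= 1)%R -> (Cmod x <= Cmod a)%R -> Cmod z = 1%R ->
    (Cmod (rahman_weight q m x b c d r z) <= B)%R.
Proof.
  intros hq ha hb hc hd hr.
  set (I := fun y : C => (exp (/ ((1 - Cmod y) * (1 - q)))
                          * exp (/ ((1 - Cmod y) * (1 - q))))%R).
  assert (HI : forall y x z : C, (Cmod x <= Cmod y < 1)%R -> Cmod z = 1%R ->
               (Cmod (inv_pair q x z) <= I y)%R).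
  { intros y x z hx hz.
    assert (hz0 : z <> 0) by (apply Cmod_gt_0; lra).
    apply Cmod_mult_le; apply qpoch_inf_inv_le; auto; rewrite Cmod_mult.
    - rewrite hz. lra.
    - rewrite Cmod_inv, hz, Rinv_1 by auto. lra. }
  set (E := exp (1 / (1 - q))).
  exists (E * E * (E * E) * (I a * I b * I c * I d * I r))%R.
  intros m x z hm hx hz.
  assert (hz0 : z <> 0) by (apply Cmod_gt_0; lra).
  assert (hz' : Cmod (/ z) = 1%R) by (rewrite Cmod_inv, hz by auto; field).
  unfold rahman_weight.
  assert (HE : forall w : C, (Cmod w <= 1)%R -> (Cmod (qpoch_inf w q) <= E)%R).
  { intros w hw. now apply qpoch_inf_le. }
  apply Cmod_mult_le.
  - repeat apply Cmod_mult_le; apply HE; rewrite Cmod_mult, ?hz, ?hz'; lra.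
  - do 4 (apply Cmod_mult_le; [|apply HI; auto; lra]). apply HI; auto; lra.
Qed.

Lemma phi32_swap (a1 a2 a3 b1 b2 : C) (q : R) (z : C) :
  phi32 a1 a2 a3 b1 b2 q z = phi32 a2 a1 a3 b1 b2 q z.
Proof.
  assert (H : forall n, qpochs [a1; a2; a3] q n = qpochs [a2; a1; a3] q n).
  { intros n. cbn [qpochs fold_right]. ring. }
  unfold phi32, CSeries. f_equal; apply Series_ext; intros n; now rewrite H.
Qed.

Lemma cint_csum (f : nat -> R -> C) (l : nat -> C) (n : nat) :
  (forall k, cint (f k) (l k)) ->
  cint (fun t => csum (fun k => f k t) n) (csum l n).
Proof.
  intros H. induction n as [|n IH].
  - pose proof (cint_const 0) as H0.
    replace (2 * RtoC PI * 0) with (RtoC 0) in H0 by ring. exact H0.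
  - simpl. now apply cint_plus.
Qed.

(** The part of [watson_term] independent of X and Y when α and s are held fixed, hence independent
    of z; the rest is absorbed into the weight by [rahman_weight_shift]. *)
Definition expansion_coef (q : R) (alpha s u v : C) (n : nat) : C :=
  (1 - alpha * RtoC q ^ (2 * n)) * (qpoch alpha q n * / (1 - alpha))
  * (qpoch (RtoC q / u) q n * qpoch (RtoC q / v) q n
     * (/ qpoch q q n * (/ qpoch (alpha * u) q n * / qpoch (alpha * v) q n)))
  * ((- (alpha * s * u * v / RtoC q)) ^ n * RtoC q ^ (n * (n - 1) / 2)).

Lemma expansion_coef_le (q : R) (alpha s u v : C) :
  (0 < q < 1)%R ->
  (forall n, 1 - alpha * u * RtoC q ^ n <> 0) ->
  (forall n, 1 - alpha * v * RtoC q ^ n <> 0) ->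
  exists M : R, forall n,
    (Cmod (expansion_coef q alpha s u v n) <= M * (/ 2) ^ n)%R.
Proof.
  intros hq hu hv.
  destruct (qpoch_inv_le q _ hq hu) as [Bu HBu].
  destruct (qpoch_inv_le q _ hq hv) as [Bv HBv].
  destruct (pow_qtri_le q (Cmod (- (alpha * s * u * v / RtoC q))) hq
              (Cmod_ge_0 _)) as [M HM].
  exists ((1 + Cmod alpha)
      * (exp (Cmod alpha / (1 - q)) * Cmod (/ (1 - alpha)))
      * (exp (Cmod (RtoC q / u) / (1 - q)) * exp (Cmod (RtoC q / v) / (1 - q))
         * (exp (/ ((1 - q) * (1 - q))) * (Bu * Bv)))
      * M)%R.
  intros n. rewrite Rmult_assoc. unfold expansion_coef.
  apply Cmod_mult_le; [apply Cmod_mult_le; [apply Cmod_mult_le|]|].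
  - eapply Rle_trans; [apply Cmod_triangle|]. rewrite Cmod_1, Cmod_opp.
    apply Rplus_le_compat_l. apply Cmod_mult_small with 1%R; try lra.
    now apply Cmod_pow_q_le1.
  - apply Cmod_mult_le; [apply qpoch_le; auto; lra | lra].
  - apply Cmod_mult_le; [apply Cmod_mult_le; apply qpoch_le; auto; lra|].
    apply Cmod_mult_le; [|now apply Cmod_mult_le].
    apply qpoch_small_inv_le; auto. rewrite Cmod_RtoC_q; lra.
  - rewrite Cmod_mult, Cmod_pow, Cmod_pow_q by auto. apply HM.
Qed.

(** Splitting the infinite products after n factors releases (az, a/z; q)_n from the denominator and
    (mz, m/z; q)_n from the numerator, where the given quotient cancels them. *)
Lemma rahman_weight_shift (q : R) (a b c d r z : C) (n : nat) :
  (0 < q < 1)%R ->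
  (Cmod a < 1)%R -> (Cmod b < 1)%R -> (Cmod c < 1)%R ->
  (Cmod d < 1)%R -> (Cmod r < 1)%R -> Cmod z = 1%R ->
  let m := a * b * c * d * r in
  rahman_weight q m a b c d r z
  * (qpoch (a * z) q n * qpoch (a * / z) q n
     * (/ qpoch (m * z) q n * / qpoch (m * / z) q n))
  = rahman_weight q (m * RtoC q ^ n) (a * RtoC q ^ n) b c d r z.
Proof.
  intros hq ha hb hc hd hr hz m.
  assert (hz0 : z <> 0) by (apply Cmod_gt_0; lra).
  assert (hz' : (Cmod (/ z) = 1)%R) by (rewrite Cmod_inv, hz by auto; field).
  assert (hm : (Cmod m < 1)%R) by (unfold m; auto using Cmod_mult_lt1).
  assert (Hs : forall x w : C, (Cmod x < 1)%R -> Cmod w = 1%R ->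
    qpoch_inf (x * w) q = qpoch (x * w) q n * qpoch_inf (x * RtoC q ^ n * w) q
    /\ qpoch (x * w) q n <> 0 /\ qpoch_inf (x * RtoC q ^ n * w) q <> 0).
  { intros x w hx hw.
    assert (hxw : (Cmod (x * w) < 1)%R) by (rewrite Cmod_mult, hw; lra).
    split; [|split].
    - rewrite (qpoch_inf_split q (x * w) n hq). f_equal. f_equal. ring.
    - now apply qpoch_small_neq0.
    - apply qpoch_inf_neq0; auto. rewrite !Cmod_mult, hw, Cmod_pow_q by auto.
      pose proof (pow_q_bound q n hq). pose proof (Cmod_ge_0 x). nra. }
  unfold rahman_weight, inv_pair.
  destruct (Hs m z hm hz) as [-> [M1 M2]].
  destruct (Hs m (/ z) hm hz') as [-> [M3 M4]].
  destruct (Hs a z ha hz) as [-> [A1 A2]].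
  destruct (Hs a (/ z) ha hz') as [-> [A3 A4]].
  clear Hs.
  set (P := / qpoch_inf (b * z) q * _).
  generalize (qpoch_inf (z * z) q) (qpoch_inf (/ z * / z) q).
  revert M1 M2 M3 M4 A1 A2 A3 A4.
  generalize (qpoch (m * z) q n) (qpoch (m * / z) q n)
    (qpoch (a * z) q n) (qpoch (a * / z) q n)
    (qpoch_inf (m * RtoC q ^ n * z) q) (qpoch_inf (m * RtoC q ^ n * / z) q)
    (qpoch_inf (a * RtoC q ^ n * z) q) (qpoch_inf (a * RtoC q ^ n * / z) q).
  clearbody P.
  generalize (/ qpoch_inf (c * z) q * / qpoch_inf (c * / z) q)
    (/ qpoch_inf (d * z) q * / qpoch_inf (d * / z) q)
    (/ qpoch_inf (r * z) q * / qpoch_inf (r * / z) q).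
  intros. field. repeat split; auto.
Qed.

(** * Assembly of the identity *)

Lemma qpochs_inf_cons (x : C) (l : list C) (q : R) :
  qpochs_inf (x :: l) q = qpoch_inf x q * qpochs_inf l q.
Proof. reflexivity. Qed.

Lemma qpochs_cons (x : C) (l : list C) (q : R) (n : nat) :
  qpochs (x :: l) q n = qpoch x q n * qpochs l q n.
Proof. reflexivity. Qed.

Lemma qpochs_inf_nil (q : R) : qpochs_inf [] q = 1.
Proof. reflexivity. Qed.

Lemma qpochs_nil (q : R) (n : nat) : qpochs [] q n = 1.
Proof. reflexivity. Qed.

Lemma Cinv_neq0 (x : C) : x <> 0 -> / x <> 0.
Proof.
  intros H E. apply (RtoC_neq0 1); [lra|].
  rewrite <- (Cinv_r x H), E. ring.
Qed.

Theorem theorem6p3 (q : R) (a b c d r u v alpha : C)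
  (hq : (0 < q < 1)%R)
  (ha : (Cmod a < 1)%R) (hb : (Cmod b < 1)%R) (hc : (Cmod c < 1)%R)
  (hd : (Cmod d < 1)%R) (hr : (Cmod r < 1)%R)
  (halpha : alpha = a ^ 2 * b * c * d * r / q)
  (* every denominator written in the formula is nonzero *)
  (hu0 : u <> 0) (hv0 : v <> 0) (halpha1 : 1 - alpha <> 0)
  (hu : forall n : nat, 1 - alpha * u * q ^ n <> 0)
  (hv : forall n : nat, 1 - alpha * v * q ^ n <> 0) :
  is_RInt (V := C_R_NormedModule)
    (fun t : R =>
       qpochs_inf [Cexpi (2 * t); Cexpi (- (2 * t))] q
       / qpochs_inf [a * Cexpi t; a * Cexpi (- t);
                     b * Cexpi t; b * Cexpi (- t);
                     c * Cexpi t; c * Cexpi (- t);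
                     d * Cexpi t; d * Cexpi (- t);
                     r * Cexpi t; r * Cexpi (- t)] q
       * phi32 (a * Cexpi t) (a * Cexpi (- t)) (alpha * u * v / q)
               (alpha * u) (alpha * v) q (b * c * d * r))
    0%R PI
    (2 * PI * qpochs_inf [a * b * c * d; a * b * c * r;
                          a * b * d * r; a * c * d * r] q
     / qpochs_inf [RtoC q; a * b; a * c; a * d; a * r; b * c; b * d; b * r;
                   c * d; c * r; d * r; a ^ 2 * b * c * d * r] q
     * CSeries (fun n : nat =>
         (1 - alpha * q ^ (2 * n))
         * qpochs [alpha; a * b; a * c; a * d; a * r; q / u; q / v] q n
         / ((1 - alpha)
            * qpochs [RtoC q; a * b * c * d; a * b * c * r; a * b * d * r;
                      a * c * d * r; alpha * u; alpha * v] q n)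
         * (- (alpha * b * c * d * r * u * v / q)) ^ n
         * q ^ (n * (n - 1) / 2))).
Proof.
  set (s := b * c * d * r). set (m := a * b * c * d * r).
  assert (q0 : RtoC q <> 0) by (apply RtoC_neq0; lra).
  assert (hs : (Cmod s < 1)%R) by (unfold s; auto using Cmod_mult_lt1).
  assert (hm : (Cmod m < 1)%R) by (unfold m; auto using Cmod_mult_lt1).
  assert (haas : (Cmod (a ^ 2 * b * c * d * r) < 1)%R).
  { replace (a ^ 2 * b * c * d * r) with (a * m) by (unfold m; simpl; ring).
    now apply Cmod_mult_lt1. }
  (* For k = 0 this is the hypothesis on α, whose modulus may reach 1 because of the division by q;
     from k = 1 on, α q = a^2 bcdr lies in the open unit disc. *)
  assert (Ha : forall k, 1 - alpha * RtoC q ^ k <> 0).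
  { intros [|k].
    - simpl. now rewrite Cmult_1_r.
    - rewrite Cpow_S, Cmult_assoc.
      replace (alpha * RtoC q) with (a ^ 2 * b * c * d * r)
        by (rewrite halpha; field; auto).
      now apply qfactor_neq0. }
  (* This is the part (XYs, s; q)_oo of the prefactor in [watson_limit], free of z since XY = a^2.
     The other part, 1 / (Xs, Ys; q)_oo, cancels (mz, m/z; q)_oo in the weight. *)
  set (N0 := qpoch_inf (a ^ 2 * b * c * d * r) q * qpoch_inf s q).
  assert (hN0 : N0 <> 0) by (apply Cmult_neq_0; now apply qpoch_inf_neq0).
  set (f := fun t : R => _ * phi32 _ _ _ _ _ _ _).
  set (k := expansion_coef q alpha s u v).
  set (W := fun n t => rahman_weight q (m * RtoC q ^ n) (a * RtoC q ^ n)
                         b c d r (Cexpi t)).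
  set (J := fun n => rahman_int q (m * RtoC q ^ n) (a * RtoC q ^ n) b c d r).
  assert (Hz : forall t, Cmod (/ Cexpi t) = 1%R).
  { intros t. rewrite <- Cexpi_opp. apply Cmod_Cexpi. }
  assert (Hpt : forall t, Ccv (csum (fun n => k n * W n t)) (N0 * f t)).
  { intros t. set (z := Cexpi t).
    assert (hz : Cmod z = 1%R) by apply Cmod_Cexpi.
    assert (hz' : Cmod (/ z) = 1%R) by apply Hz.
    assert (hz0 : z <> 0) by apply Cexpi_neq0.
    assert (HX : (Cmod (a * z) <= 1)%R) by (rewrite Cmod_mult, hz; lra).
    assert (HY : (Cmod (a * / z) <= 1)%R) by (rewrite Cmod_mult, hz'; lra).
    assert (HXY : alpha = a * z * (a * / z) * s / RtoC q).
    { rewrite halpha. unfold s. simpl. field. auto. }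
    pose proof (watson_limit q alpha (a * z) (a * / z) s u v hq HX HY hs HXY Ha
                  hu0 hv0 hu hv) as Hw.
    apply (Ccv_scal (rahman_weight q m a b c d r z)) in Hw.
    match type of Hw with Ccv _ ?l => replace (N0 * f t) with l end.
    - eapply Ccv_ext; [|apply Hw]. intros n. cbv beta.
      rewrite <- csum_scal. apply csum_ext. intros j _.
      pose proof (rahman_weight_shift q a b c d r z j hq ha hb hc hd hr hz) as Hsh.
      cbv zeta in Hsh. fold m in Hsh.
      unfold W. fold z. rewrite <- Hsh. unfold k, expansion_coef, watson_term.
      replace (a * z * s) with (m * z) by (unfold m, s; ring).
      replace (a * / z * s) with (m * / z) by (unfold m, s; ring).
      unfold Cdiv. ring.
    - unfold f. rewrite (Cexpi_opp t). fold z.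
      replace (Cexpi (2 * t)) with (z * z)
        by (unfold z; rewrite <- Cexpi_add; f_equal; ring).
      replace (Cexpi (- (2 * t))) with (/ z * / z)
        by (unfold z; rewrite <- Cexpi_opp, <- Cexpi_add; f_equal; ring).
      replace (a * z * (a * / z) * s) with (a ^ 2 * b * c * d * r)
        by (unfold s; simpl; field; auto).
      replace (a * z * s) with (m * z) by (unfold m, s; ring).
      replace (a * / z * s) with (m * / z) by (unfold m, s; ring).
      fold s. generalize (phi32 (a * z) (a * / z) (alpha * u * v / RtoC q)
        (alpha * u) (alpha * v) q s). intros Phi.
      unfold N0, rahman_weight, inv_pair.
      rewrite !qpochs_inf_cons, !qpochs_inf_nil.
      assert (Hn : forall x w : C, (Cmod x < 1)%R -> Cmod w = 1%R ->
                   qpoch_inf (x * w) q <> 0).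
      { intros x w hx hw. apply qpoch_inf_neq0; auto. rewrite Cmod_mult, hw. lra. }
      assert (RtoC 1 <> 0) by (apply RtoC_neq0; lra).
      field. repeat split; auto. }
  destruct (expansion_coef_le q alpha s u v hq hu hv) as [M HM]. fold k in HM.
  destruct (rahman_weight_le q a b c d r hq ha hb hc hd hr) as [B HB].
  assert (HWB : forall n t, (Cmod (W n t) <= B)%R).
  { intros n t. apply HB.
    - apply Cmod_mult_small with 1%R; try lra. now apply Cmod_pow_q_le1.
    - apply Cmod_mult_small with 1%R; try lra. now apply Cmod_pow_q_le1.
    - apply Cmod_Cexpi. }
  assert (han : forall n, (Cmod (a * RtoC q ^ n) < 1)%R).
  { intros n. eapply Rle_lt_trans; [|apply ha].
    apply Cmod_mult_small with 1%R; try lra. now apply Cmod_pow_q_le1. }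
  (* The terms are bounded by M B 2^-j uniformly in t, so the tail of the series is at most M B 2^-n
     / (1 - 1/2). *)
  destruct (cint_limit (fun n t => csum (fun j => k j * W j t) n)
              (fun t => N0 * f t) (fun n => csum (fun j => k j * J j) n)
              (M * B / (1 - / 2)) (/ 2)) as [l [Hl Hc]].
  { lra. }
  { intros n. apply cint_csum. intros j. apply cint_scal.
    apply (cint_rahman q (m * RtoC q ^ j) (a * RtoC q ^ j)); auto. }
  { intros n t.
    destruct (csum_geom (fun j => k j * W j t) (M * B) (/ 2)) as [l [Hl Hb]].
    - lra.
    - intros j. replace (M * B * (/ 2) ^ j)%R with (M * (/ 2) ^ j * B)%R by ring.
      now apply Cmod_mult_le.
    - rewrite (Ccv_unique _ _ _ (Hpt t) Hl).
      replace (M * B / (1 - / 2) * (/ 2) ^ n)%R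
        with (M * B * (/ 2) ^ n / (1 - / 2))%R by (field; lra).
      apply Hb. }
  assert (Hf : cint f (/ N0 * l)).
  { apply cint_ext with (fun t => / N0 * (N0 * f t)).
    - intros t. field. auto.
    - now apply cint_scal. }
  (* Changing the sign of t exchanges the paired factors and the first two numerator parameters of
     the 3phi2. *)
  assert (Heven : forall t, f (- t)%R = f t).
  { intros t. unfold f. rewrite phi32_swap.
    replace (2 * - t)%R with (- (2 * t))%R by ring. rewrite !Ropp_involutive.
    rewrite !qpochs_inf_cons, !qpochs_inf_nil.
    f_equal. f_equal; ring. }
  pose proof (cint_half f _ Heven Hf) as Hfin.
  pose proof (rahman_integral q a b c d r hq ha hb hc hd hr) as HJ0. fold m in HJ0.
  assert (Hn : forall x : C, (Cmod x < 1)%R -> qpoch_inf x q <> 0)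
    by (intros; now apply qpoch_inf_neq0).
  assert (Hn' : forall (x : C) n, (Cmod x < 1)%R -> qpoch x q n <> 0)
    by (intros; now apply qpoch_small_neq0).
  assert (hq1 := Cmod_q_lt1 q hq).
  assert (pi0 : RtoC PI <> 0).
  { apply RtoC_neq0. pose proof PI_RGT_0. lra. }
  assert (four0 : RtoC 4 <> 0) by (apply RtoC_neq0; lra).
  assert (two0 : RtoC 2 <> 0) by (apply RtoC_neq0; lra).
  set (J0 := rahman_int q m a b c d r) in *.
  (* Needed to divide the integrated series by its value at n = 0; every product in the closed form
     has its argument in the open unit disc. *)
  assert (hJ0 : J0 <> 0).
  { rewrite HJ0. unfold Cdiv.
    repeat apply Cmult_neq_0; auto; try (apply Hn; auto using Cmod_mult_lt1).
    apply Cinv_neq0.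
    repeat apply Cmult_neq_0; auto; apply Hn; auto using Cmod_mult_lt1. }
  set (term := fun n : nat => _ * RtoC q ^ (n * (n - 1) / 2)).
  (* The quotient of [J j] by [J0], supplied by [rahman_int_iter], contributes (ab, ac, ad, ar; q)_j
     over the four quadruple factorials, and thus completes the coefficient to the stated term. *)
  assert (Hterm : CSeries term = / J0 * l).
  { apply CSeries_Ccv.
    eapply Ccv_ext; [|apply (Ccv_scal (/ J0)), Hl]. intros n. cbv beta.
    rewrite <- csum_scal. apply csum_ext. intros j _.
    pose proof (rahman_int_iter q a b c d r j hq ha hb hc hd hr) as Hi.
    cbv zeta in Hi. fold m in Hi. fold (J j) J0 in Hi.
    assert (Hu := qpoch_neq0 _ q j hu). assert (Hv := qpoch_neq0 _ q j hv).
    unfold term, k, expansion_coef. rewrite !qpochs_cons, !qpochs_nil.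
    replace (alpha * b * c * d * r * u * v / RtoC q)
      with (alpha * s * u * v / RtoC q) by (unfold s; field; auto).
    pose proof (Hn' (a * c * d * r) j ltac:(auto using Cmod_mult_lt1)) as D1.
    pose proof (Hn' (a * b * d * r) j ltac:(auto using Cmod_mult_lt1)) as D2.
    pose proof (Hn' (a * b * c * r) j ltac:(auto using Cmod_mult_lt1)) as D3.
    pose proof (Hn' (a * b * c * d) j ltac:(auto using Cmod_mult_lt1)) as D4.
    pose proof (Hn' (RtoC q) j hq1) as D5.
    replace (J j) with (/ (qpoch (a * c * d * r) q j * qpoch (a * b * d * r) q j
       * qpoch (a * b * c * r) q j * qpoch (a * b * c * d) q j)
       * (qpoch (a * b) q j * qpoch (a * c) q j * qpoch (a * d) q j
          * qpoch (a * r) q j * J0)) by (rewrite <- Hi; field; auto).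
    generalize (qpoch (RtoC q / u) q j) (qpoch (RtoC q / v) q j)
      ((- (alpha * s * u * v / RtoC q)) ^ j).
    intros x1 x2 x3. field. repeat split; auto. }
  rewrite Hterm, !qpochs_inf_cons, !qpochs_inf_nil.
  match type of Hfin with is_RInt _ _ _ ?x =>
    match goal with |- is_RInt _ _ _ ?y => replace y with x; [exact Hfin|] end end.
  (* The factor 1/2 from halving the interval turns 4 PI into 2 PI, and (bcdr; q)_oo in [J0] cancels
     against [N0], which leaves four quadruple products. *)
  transitivity (/ 2 * (/ N0 * J0 * (/ J0 * l))); [field; auto|].
  rewrite HJ0 at 1. unfold N0. fold s.
  replace (RtoC 4) with (2 * 2) by (rewrite <- RtoC_mult; f_equal; ring).
  pose proof (Hn _ hs). pose proof (Hn _ haas).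
  generalize (/ J0 * l). intros L.
  pose proof (Hn (a * b) ltac:(auto using Cmod_mult_lt1)).
  pose proof (Hn (a * c) ltac:(auto using Cmod_mult_lt1)).
  pose proof (Hn (a * d) ltac:(auto using Cmod_mult_lt1)).
  pose proof (Hn (a * r) ltac:(auto using Cmod_mult_lt1)).
  pose proof (Hn (b * c) ltac:(auto using Cmod_mult_lt1)).
  pose proof (Hn (b * d) ltac:(auto using Cmod_mult_lt1)).
  pose proof (Hn (b * r) ltac:(auto using Cmod_mult_lt1)).
  pose proof (Hn (c * d) ltac:(auto using Cmod_mult_lt1)).
  pose proof (Hn (c * r) ltac:(auto using Cmod_mult_lt1)).
  pose proof (Hn (d * r) ltac:(auto using Cmod_mult_lt1)).
  pose proof (Hn _ hq1).
  field. repeat split; auto.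
Qed.
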